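(* Let $\mathbb{M}=\langle M,\mathcal{C}\rangle$ be a countable transitive model of $\mathsf{GB}^-$. Assume that $\mathbb{M}$ satisfies representatives choice and let $\mathbb{P}=\langle P,\leq_{\mathbb{P}}\rangle$ be a separative and antisymmetric notion of class forcing for $\mathbb{M}$. Then the following statements (over $\mathbb{M}$) are equivalent: (1) $\mathbb{P}$ satisfies the definability lemma for one of the $\mathcal{L}_\in$-formulae ''$v_0\in v_1$'' or ''$v_0=v_1$''. (2) $\mathbb{P}$ satisfies the forcing theorem for all $\mathcal{L}_\in$-formulae. (3) $\mathbb{P}$ satisfies the uniform forcing theorem for all $\mathcal{L}_{\mathrm{Ord},0}^{\Vdash}(\mathbb{P},M)$-formulae. (4) $\mathbb{P}$ has a Boolean completion in $\mathbb{M}$. Moreover, separativity and antisymmetry of $\mathbb{P}$ are only needed for the implication from (3) to (4): for an arbitrary notion of class forcing $\mathbb{P}$ for $\mathbb{M}$, (1), (2) and (3) are equivalent, and (4) implies each of them. In fact, for an arbitrary notion of class forcing $\mathbb{P}$ for $\mathbb{M}$, (4) implies that $\mathbb{P}$ is separative and antisymmetric.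
   Context: We work in a model $\mathsf{V}$ of $\mathsf{ZFC}$. $\mathsf{ZF}^-$ is $\mathsf{ZF}$ without power set and with Collection instead of Replacement. $\mathsf{GB}^-$ is the two-sorted theory (sets and classes) whose set axioms are those of $\mathsf{ZF}^-$ with class parameters allowed in Separation and Collection and whose class axioms are extensionality, foundation and first-order class comprehension (only set quantifiers). A countable transitive model of $\mathsf{GB}^-$ is a model $\mathbb{M}=\langle M,\mathcal{C}\rangle$ of $\mathsf{GB}^-$ (sets: $M$; classes: $\mathcal{C}\subseteq\mathcal{P}(M)$) with $M$ transitive and $M,\mathcal{C}$ countable in $\mathsf{V}$. $\mathbb{M}$ satisfies representatives choice if for every equivalence relation $E\in\mathcal{C}$ there are $A\in\mathcal{C}$ and a surjection $\pi:\mathrm{dom}(E)\to A$ in $\mathcal{C}$ such that $\langle x,y\rangle\in E$ iff $\pi(x)=\pi(y)$. A notion of class forcing for $\mathbb{M}$ is a preorder $\mathbb{P}=\langle P,\leq_{\mathbb{P}}\rangle$ (with a largest element $1_{\mathbb{P}}$) with $P,\leq_{\mathbb{P}}\in\mathcal{C}$. $\mathbb{P}$ is separative if for all $p\not\leq q$ there is $r\leq p$ incompatible with $q$. A $\mathbb{P}$-name is an object all of whose elements are of the form $\langle\tau,p\rangle$ with $\tau$ a $\mathbb{P}$-name and $p\in\mathbb{P}$; $M^{\mathbb{P}}$ is the set of $\mathbb{P}$-names in $M$. A filter $G$ on $\mathbb{P}$ is $\mathbb{P}$-generic over $\mathbb{M}$ if it meets every dense subset of $\mathbb{P}$ in $\mathcal{C}$.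 Put $\sigma^G=\{\tau^G\mid\exists p\in G\ \langle\tau,p\rangle\in\sigma\}$ and $M[G]=\{\sigma^G\mid\sigma\in M^{\mathbb{P}}\}$. For an $\mathcal{L}_\in$-formula $\varphi$, $p\Vdash^{\mathbb{M}}_{\mathbb{P}}\varphi(\sigma_0,\ldots,\sigma_{m-1})$ means that $M[G]\models\varphi(\sigma_0^G,\ldots,\sigma_{m-1}^G)$ whenever $G$ is $\mathbb{P}$-generic over $\mathbb{M}$ with $p\in G$. Definability lemma for $\varphi$: $\{\langle p,\vec\sigma\rangle\mid p\Vdash^{\mathbb{M}}_{\mathbb{P}}\varphi(\vec\sigma)\}\in\mathcal{C}$. Truth lemma for $\varphi$: whenever $G$ is $\mathbb{P}$-generic over $\mathbb{M}$ and $M[G]\models\varphi(\vec\sigma^G)$, some $p\in G$ satisfies $p\Vdash^{\mathbb{M}}_{\mathbb{P}}\varphi(\vec\sigma)$. Forcing theorem for $\varphi$: both. $\mathcal{L}_{\mathrm{Ord},0}^{\Vdash}(\mathbb{P},M)$ is the infinitary quantifier-free forcing language with set-sized conjunctions and disjunctions. Its formulae $\varphi$ and their Gödel codes $\ulcorner\varphi\urcorner$ are defined by simultaneous recursion. Atomic formulae are $\check p\in\dot G$, $\sigma=\tau$, $\sigma\in\tau$ for $p\in\mathbb{P}$, $\sigma,\tau\in M^{\mathbb{P}}$, with codes $\langle 0,p\rangle$, $\langle 1,\sigma,\tau\rangle$, $\langle 2,\sigma,\tau\rangle$; here $\check x=\{\langle\check y,1_{\mathbb{P}}\rangle\mid y\in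 x\}$ and $\dot G=\{\langle\check p,p\rangle\mid p\in\mathbb{P}\}$ is the canonical class name of the generic filter. $\neg\varphi$ has code $\langle 3,\ulcorner\varphi\urcorner\rangle$. If $I\in M$ and $\langle\ulcorner\varphi_i\urcorner\mid i\in I\rangle\in M$, then $\bigvee_{i\in I}\varphi_i$ and $\bigwedge_{i\in I}\varphi_i$ are formulae with codes $\langle 4,I,\{\langle i,\ulcorner\varphi_i\urcorner\rangle\mid i\in I\}\rangle$ and $\langle 5,I,\{\langle i,\ulcorner\varphi_i\urcorner\rangle\mid i\in I\}\rangle$. Let $\mathrm{Fml}_{\mathrm{Ord},0}^{\Vdash}(\mathbb{P},M)\in\mathcal{C}$ be the class of all these codes. For generic $G$, $\varphi^G$ is obtained from $\varphi$ by replacing each name $\sigma$ by $\sigma^G$ and evaluating $\dot G$ as $G$; $p\Vdash^{\mathbb{M}}_{\mathbb{P}}\varphi$ means that $\langle M[G],\in,G\rangle\models\varphi^G$ for every $\mathbb{P}$-generic $G$ over $\mathbb{M}$ with $p\in G$. $\mathbb{P}$ satisfies the uniform forcing theorem for $\mathcal{L}_{\mathrm{Ord},0}^{\Vdash}(\mathbb{P},M)$-formulae if $\{\langle p,\ulcorner\varphi\urcorner\rangle\in P\times\mathrm{Fml}_{\mathrm{Ord},0}^{\Vdash}(\mathbb{P},M)\mid p\Vdash^{\mathbb{M}}_{\mathbb{P}}\varphi\}\in\mathcal{C}$ and, for every such $\varphi$ and every $\mathbb{P}$-generic $G$ over $\mathbb{M}$, if $\varphi^G$ holds in $\langle M[G],\in,G\rangle$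 then there is $p\in G$ with $p\Vdash^{\mathbb{M}}_{\mathbb{P}}\varphi$. A Boolean algebra $\mathbb{B}$ is $M$-complete if $\sup_{\mathbb{B}}A$ exists for every $A\in M$ with $A\subseteq\mathbb{B}$. $\mathbb{P}$ has a Boolean completion in $\mathbb{M}$ if there is an $M$-complete Boolean algebra $\mathbb{B}$ such that its domain, all its Boolean operations and an injective dense embedding $\pi$ of $\mathbb{P}$ into $\mathbb{B}\setminus\{0_{\mathbb{B}}\}$ (an injective map with $p\leq q\Leftrightarrow\pi(p)\leq\pi(q)$ and dense range) are elements of $\mathcal{C}$. *)

(* Defs.v *)
From mathcomp Require Import all_boot.
From mathcomp Require Import boolp classical_sets functions cardinality.
From Stdlib Require Import Wellfounded Relation_Operators.

Set Implicit Arguments.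
Unset Strict Implicit.
Unset Printing Implicit Defensive.

Local Open Scope classical_set_scope.

(* The ambient universe V is Aczel's cumulative hierarchy of well-founded
   trees, quotiented by bisimilarity so that equality of sets is Leibniz
   equality. *)

Inductive ens : Type := Ens (A : Type) (f : A -> ens).

Fixpoint eqv (x y : ens) {struct x} : Prop :=
  match x, y with
  | Ens A f, Ens B g =>
      (forall a, exists b, eqv (f a) (g b)) /\
      (forall b, exists a, eqv (f a) (g b))
  end.

Definition emem (x y : ens) : Prop :=
  match y with Ens B g => exists b, eqv x (g b) end.

Definition V : Type := {X : set ens | exists x, X = eqv x}.

Definition mem (x y : V) : Prop :=
  exists a b, [/\ sval x a, sval y b & emem a b].

Notation "x ∈ y" := (mem x y) (at level 70, no associativity).

Lemma eqv_refl x : eqv x x.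
Proof. by elim: x => A f IH /=; split=> a; exists a. Qed.

Lemma eqv_sym x y : eqv x y -> eqv y x.
Proof.
elim: x y => A f IH [B g] /= [h1 h2]; split=> [b|a].
- by have [a /IH] := h2 b; exists a.
- by have [b /IH] := h1 a; exists b.
Qed.

Lemma eqv_trans x y z : eqv x y -> eqv y z -> eqv x z.
Proof.
elim: x y z => A f IH [B g] [D h] /= [h1 h2] [k1 k2]; split=> [a|d].
- by have [b e1] := h1 a; have [d e2] := k1 b; exists d; apply: IH e1 e2.
- by have [b e2] := k2 d; have [a e1] := h2 b; exists a; apply: IH e1 e2.
Qed.

Lemma eqvE x y : eqv x y -> eqv x = eqv y.
Proof.
move=> xy; rewrite predeqE => z; split; last exact: eqv_trans xy.
exact: eqv_trans (eqv_sym xy).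
Qed.

Lemma emem_eqv x x' y y' : eqv x x' -> eqv y y' -> emem x y -> emem x' y'.
Proof.
case: y y' => [B g] [B' g'] /eqv_sym xx' [h1 _] /= [b xb].
have [b' bb'] := h1 b; exists b'.
exact: eqv_trans xx' (eqv_trans xb bb').
Qed.

Definition cls (x : ens) : V := exist _ (eqv x) (ex_intro _ x erefl).

Lemma V_val_inj (x y : V) : sval x = sval y -> x = y.
Proof.
case: x y => [X hX] [Y hY] /= XY; subst Y.
by congr exist; apply: Prop_irrelevance.
Qed.

Lemma clsP (x : V) : exists a, x = cls a.
Proof. by have [a e] := svalP x; exists a; apply: V_val_inj. Qed.

Lemma cls_eqv a b : cls a = cls b <-> eqv a b.
Proof.
split=> [/(congr1 sval)/= ->|/eqvE ab]; first exact: eqv_refl.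
exact: V_val_inj.
Qed.

Lemma mem_cls a b : cls a ∈ cls b <-> emem a b.
Proof.
split=> [[a' [b' [/= aa' bb']]]|ab].
  by apply: emem_eqv; apply: eqv_sym.
by exists a, b; split=> //=; apply: eqv_refl.
Qed.

Lemma V_ext (x y : V) : (forall z, z ∈ x <-> z ∈ y) -> x = y.
Proof.
have [[A f] ->] := clsP x; have [[B g] ->] := clsP y => h.
apply/cls_eqv; split=> [a|b].
- have /h/mem_cls [b ab] : cls (f a) ∈ cls (Ens f).
    by apply/mem_cls; exists a; apply: eqv_refl.
  by exists b.
- have /h/mem_cls [a ab] : cls (g b) ∈ cls (Ens g).
    by apply/mem_cls; exists b; apply: eqv_refl.
  by exists a; apply: eqv_sym.
Qed.

Lemma mem_wf : well_founded mem.
Proof.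
move=> x; have [a ->] := clsP x; elim: a {x} => A f IH; constructor=> y.
have [b ->] := clsP y => /mem_cls [a /cls_eqv ->]; exact: IH.
Qed.

Definition small (P : set V) : Prop := exists a, forall x, x ∈ a <-> P x.

(* The set whose elements are exactly the x with P x; the empty set when
   P is a proper class. *)
Definition mkset (P : set V) : V :=
  match pselect (small P) with
  | left h => sval (cid h)
  | right _ => cls (Ens (fun t : void => match t with end))
  end.

Lemma mem_mkset (P : set V) : small P -> forall x, x ∈ mkset P <-> P x.
Proof. by rewrite /mkset; case: pselect => // h _; case: (cid h). Qed.

(* Together with V_ext, mem_wf and small_vnat, the next lemmas show that V
   satisfies the axioms of ZF; choice is inherited from the metatheory. *)

Lemma small_mem (a : V) : small [set x | x ∈ a].
Proof. by exists a. Qed.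

Lemma small_empty : small set0.
Proof.
exists (cls (Ens (fun t : void => match t with end))) => x; split=> //.
by have [a ->] := clsP x => /mem_cls [].
Qed.

Lemma small_pair (x y : V) : small [set z | z = x \/ z = y].
Proof.
have [a ->] := clsP x; have [b ->] := clsP y.
exists (cls (Ens (fun t : bool => if t then a else b))) => z /=.
have [d ->] := clsP z; split=> [/mem_cls [[] /cls_eqv]|]; [by left|by right|].
by case=> /cls_eqv h; apply/mem_cls; [exists true|exists false].
Qed.

Lemma small_sub (P Q : set V) : small Q -> P `<=` Q -> small P.
Proof.
move=> [q Qq] PQ; have [[A f] qE] := clsP q.
exists (cls (Ens (fun t : {a : A | P (cls (f a))} => f (sval t)))) => z.
have [d ->] := clsP z; split=> [/mem_cls [[a Pa] /= /cls_eqv ->]//|Pd].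
have /Qq := PQ _ Pd; rewrite qE => /mem_cls [a /cls_eqv da].
apply/mem_cls; rewrite da in Pd.
by exists (exist (fun a => P (cls (f a))) a Pd); apply/cls_eqv.
Qed.

Lemma small_image (P : set V) (F : V -> V) : small P -> small (F @` P).
Proof.
move=> [p Pp]; have [[A f] pE] := clsP p.
pose r x := sval (cid (clsP x)).
have rE x : cls (r x) = x by rewrite /r; case: cid.
exists (cls (Ens (fun a : A => r (F (cls (f a)))))) => z.
rewrite -(rE z); split=> [/mem_cls [a /cls_eqv ->]|[x Px Fx]].
  rewrite rE; exists (cls (f a)) => //; apply/Pp; rewrite pE.
  by apply/mem_cls; exists a; apply: eqv_refl.
move: Px => /Pp; rewrite pE -[x]rE => /mem_cls [a /cls_eqv ra].
by apply/mem_cls; exists a; apply/cls_eqv; rewrite -Fx -ra !rE.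
Qed.

Lemma small_bigcup (P : set V) : small P ->
  small [set z | exists2 y, P y & z ∈ y].
Proof.
move=> [p Pp]; have [[A f] pE] := clsP p.
pose ix (x : ens) := let: Ens B _ := x in B.
pose el (x : ens) : ix x -> ens := let: Ens _ g := x in g.
exists (cls (Ens (fun t : {a : A & ix (f a)} => el _ (tagged t)))) => z.
have [d ->] := clsP z.
have elE x y : emem x y <-> exists i, eqv x (el y i) by case: y.
split=> [/mem_cls [[a i] /= e]|[y /Pp]].
  exists (cls (f a)); last by apply/mem_cls/elE; exists i.
  by apply/Pp; rewrite pE; apply/mem_cls; exists a; apply: eqv_refl.
have [b ->] := clsP y; rewrite pE => /mem_cls [a /cls_eqv ->].
by move=> /mem_cls/elE [i e]; apply/mem_cls; exists (existT (fun a => ix (f a)) a i).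
Qed.

Lemma small_power (a : V) : small [set x | forall z, z ∈ x -> z ∈ a].
Proof.
have [[A f] ->] := clsP a.
pose e (X : A -> Prop) : ens := Ens (fun t : {a | X a} => f (sval t)).
exists (cls (Ens e)) => x; have [d ->] := clsP x; split.
  move=> /mem_cls [X /cls_eqv ->] z; have [b ->] := clsP z.
  move=> /mem_cls [[i Xi] /= /cls_eqv ->].
  by apply/mem_cls; exists i; apply: eqv_refl.
move=> h; apply/mem_cls; exists (fun i => cls (f i) ∈ cls d); apply/cls_eqv.
apply: V_ext => z; split; have [b ->] := clsP z.
  move=> bd; have /mem_cls [i /cls_eqv bi] := h _ bd; rewrite bi in bd *.
  by apply/mem_cls; exists (exist (fun i => cls (f i) ∈ cls d) i bd); apply: eqv_refl.
by move=> /mem_cls [[i di] /= /cls_eqv ->].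
Qed.

Definition upair (x y : V) : V := mkset [set z | z = x \/ z = y].

Definition opair (x y : V) : V := upair (upair x x) (upair x y).

Notation "⟨ x , y ⟩" := (opair x y) (at level 0, x, y at level 99).
Notation "⟨ x , y , z ⟩" := (opair x (opair y z))
  (at level 0, x, y, z at level 99).

Definition vempty : V := mkset set0.
Definition vsucc (x : V) : V := mkset [set z | z ∈ x \/ z = x].
Definition vnat (n : nat) : V := iter n vsucc vempty.

Lemma mem_upair x y z : z ∈ upair x y <-> z = x \/ z = y.
Proof. exact: (mem_mkset (small_pair x y)). Qed.

Lemma opair_inj x y x' y' : ⟨x, y⟩ = ⟨x', y'⟩ -> x = x' /\ y = y'.
Proof.
have U1 a b : upair a a = upair b b -> a = b.
  by move=> e; have /mem_upair [] : a ∈ upair b b by rewrite -e; apply/mem_upair; left.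
have U2 a b d : upair a a = upair b d -> a = b /\ a = d.
  move=> e; split.
    by have /mem_upair [] : b ∈ upair a a by rewrite e; apply/mem_upair; left.
  by have /mem_upair [] : d ∈ upair a a by rewrite e; apply/mem_upair; right.
move=> e.
have xx' : x = x'.
  have : upair x x ∈ ⟨x', y'⟩ by rewrite -e; apply/mem_upair; left.
  by case/mem_upair=> [/U1|/U2 []].
subst x'; split=> //.
have : upair x y ∈ ⟨x, y'⟩ by rewrite -e; apply/mem_upair; right.
have : upair x y' ∈ ⟨x, y⟩ by rewrite e; apply/mem_upair; right.
move=> /mem_upair [/esym/U2 [_ xy']|xy'] /mem_upair [/esym/U2 [_ xy]|xy].
- by rewrite -xy -xy'.
- by move: xy; rewrite -xy' => /esym/U2 [].
- by move: xy'; rewrite -xy => /esym/U2 [].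
- have /mem_upair [yx|//] : y ∈ upair x y' by rewrite -xy; apply/mem_upair; right.
  by move: xy; rewrite yx => /U2 [].
Qed.

Lemma mem_vsucc x z : z ∈ vsucc x <-> z ∈ x \/ z = x.
Proof.
apply: (@mem_mkset [set z | z ∈ x \/ z = x]).
have /small_bigcup h := small_pair x (upair x x).
apply: small_sub h _ => w [wx|->]; first by exists x; [left|].
by exists (upair x x); [right|apply/mem_upair; left].
Qed.

Lemma small_vnat : small (range vnat).
Proof.
pose r x := sval (cid (clsP x)).
have rE x : cls (r x) = x by rewrite /r; case: cid.
exists (cls (Ens (fun n : nat => r (vnat n)))) => z.
rewrite -(rE z); split=> [/mem_cls [n /cls_eqv ->]|[n _]].
  by rewrite rE; exists n.
by move=> nz; apply/mem_cls; exists n; apply/cls_eqv; rewrite -nz !rE.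
Qed.

Definition domr (F : set V) : set V := [set x | exists y, F ⟨x, y⟩].
Definition ranr (F : set V) : set V := [set y | exists x, F ⟨x, y⟩].

Definition is_rel (F : set V) : Prop :=
  forall z, F z -> exists x y, z = ⟨x, y⟩.

Definition is_fun (F : set V) : Prop :=
  is_rel F /\ forall x y y', F ⟨x, y⟩ -> F ⟨x, y'⟩ -> y = y'.

(* E is an equivalence relation on its own domain. *)
Definition is_equiv (E : set V) : Prop :=
  [/\ is_rel E,
      (forall x, domr E x -> E ⟨x, x⟩),
      (forall x y, E ⟨x, y⟩ -> E ⟨y, x⟩) &
      (forall x y z, E ⟨x, y⟩ -> E ⟨y, z⟩ -> E ⟨x, z⟩)].

(* formula k n: formulas with k class parameters, free set variables
   v_0, ..., v_(n-1) and set quantifiers only; the language of set theory is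
   the case k = 0. In fAll the bound variable is v_0 and the variables v_i of
   the enclosing context become v_(i+1). *)
Inductive formula (k : nat) : nat -> Type :=
| fMem n (i j : 'I_n) : formula k n
| fEq n (i j : 'I_n) : formula k n
| fCls n (i : 'I_n) (X : 'I_k) : formula k n
| fNot n (phi : formula k n) : formula k n
| fAnd n (phi psi : formula k n) : formula k n
| fAll n (phi : formula k n.+1) : formula k n.

Fixpoint sat (A : set V) k (X : k.-tuple (set V)) n (phi : formula k n) :
    n.-tuple V -> Prop :=
  match phi in formula _ n return n.-tuple V -> Prop with
  | fMem _ i j => fun e => tnth e i ∈ tnth e j
  | fEq _ i j => fun e => tnth e i = tnth e j
  | fCls _ i Y => fun e => tnth X Y (tnth e i)
  | fNot _ phi => fun e => ~ sat A X phi e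
  | fAnd _ phi psi => fun e => sat A X phi e /\ sat A X psi e
  | fAll _ phi => fun e => forall x, A x -> sat A X phi [tuple of x :: e]
  end.

Definition sat0 (A : set V) n (phi : formula 0 n) (e : n.-tuple V) : Prop :=
  sat A [tuple] phi e.

Definition all_in T (A : set T) n (e : n.-tuple T) : Prop :=
  forall i, A (tnth e i).

Record GBm (M : set V) (C : set (set V)) : Prop := {
  GBm_set_ext : forall x y, M x -> M y ->
    (forall z, M z -> z ∈ x <-> z ∈ y) -> x = y;
  GBm_set_found : forall x, M x -> (exists2 y, M y & y ∈ x) ->
    exists y, [/\ M y, y ∈ x & forall z, M z -> z ∈ y -> ~ z ∈ x];
  GBm_pairing : forall x y, M x -> M y ->
    exists2 z, M z & forall w, M w -> w ∈ z <-> w = x \/ w = y;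
  GBm_union : forall x, M x ->
    exists2 u, M u & forall w, M w ->
      w ∈ u <-> exists y, [/\ M y, y ∈ x & w ∈ y];
  GBm_infinity : exists w, [/\ M w,
    exists e, [/\ M e, e ∈ w & forall z, M z -> ~ z ∈ e] &
    forall n, M n -> n ∈ w -> exists s, [/\ M s, s ∈ w &
      forall z, M z -> z ∈ s <-> z ∈ n \/ z = n]];
  GBm_separation : forall k n (phi : formula k n.+1)
      (X : k.-tuple (set V)) (e : n.-tuple V) a,
    all_in C X -> all_in M e -> M a ->
    exists2 b, M b & forall x, M x ->
      x ∈ b <-> x ∈ a /\ sat M X phi [tuple of x :: e];
  GBm_collection : forall k n (phi : formula k n.+2)
      (X : k.-tuple (set V)) (e : n.-tuple V) a,
    all_in C X -> all_in M e -> M a ->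
    (forall x, M x -> x ∈ a ->
       exists2 y, M y & sat M X phi [tuple of x :: y :: e]) ->
    exists2 b, M b & forall x, M x -> x ∈ a ->
      exists y, [/\ M y, y ∈ b & sat M X phi [tuple of x :: y :: e]];
  GBm_class_ext : forall X Y, C X -> C Y ->
    (forall x, M x -> X x <-> Y x) -> X = Y;
  GBm_class_found : forall X, C X -> (exists2 x, M x & X x) ->
    exists x, [/\ M x, X x & forall z, M z -> z ∈ x -> ~ X z];
  GBm_comprehension : forall k n (phi : formula k n.+1)
      (X : k.-tuple (set V)) (e : n.-tuple V),
    all_in C X -> all_in M e ->
    exists2 Y, C Y & forall x, M x -> Y x <-> sat M X phi [tuple of x :: e]
}.

(* Since M is countable, M itself, the classes in C and the filters on class forcings
   are coextensive with elements of V; they are represented as predicates. *)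
Record ctm_GBm (M : set V) (C : set (set V)) : Prop := {
  ctm_transitive : forall x y, M y -> x ∈ y -> M x;
  ctm_classes : forall X, C X -> X `<=` M;
  ctm_countable_sets : countable M;
  ctm_countable_classes : countable C;
  ctm_axioms : GBm M C
}.

Definition rep_choice (C : set (set V)) : Prop :=
  forall E, C E -> is_equiv E ->
  exists A pi, [/\ C A, C pi & [/\ is_fun pi, domr pi = domr E, ranr pi = A &
    forall x y, domr E x -> domr E y ->
      E ⟨x, y⟩ <-> exists2 z, pi ⟨x, z⟩ & pi ⟨y, z⟩]].

Record class_forcing (C : set (set V)) (P le : set V) (one : V) : Prop := {
  cf_dom_class : C P;
  cf_le_class : C le;
  cf_le_rel : forall z, le z -> exists p q, [/\ P p, P q & z = ⟨p, q⟩];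
  cf_refl : forall p, P p -> le ⟨p, p⟩;
  cf_trans : forall p q r, le ⟨p, q⟩ -> le ⟨q, r⟩ -> le ⟨p, r⟩;
  cf_one : P one;
  cf_top : forall p, P p -> le ⟨p, one⟩
}.

Definition antisymmetric_po (le : set V) : Prop :=
  forall p q, le ⟨p, q⟩ -> le ⟨q, p⟩ -> p = q.

Definition compatible (P le : set V) (p q : V) : Prop :=
  exists r, [/\ P r, le ⟨r, p⟩ & le ⟨r, q⟩].

Definition separative (P le : set V) : Prop :=
  forall p q, P p -> P q -> ~ le ⟨p, q⟩ ->
  exists r, [/\ P r, le ⟨r, p⟩ & ~ compatible P le r q].

Definition dense (P le D : set V) : Prop :=
  D `<=` P /\ forall p, P p -> exists2 q, D q & le ⟨q, p⟩.

Record filter_on (P le G : set V) : Prop := {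
  filter_sub : G `<=` P;
  filter_nonempty : G !=set0;
  filter_up : forall p q, G p -> P q -> le ⟨p, q⟩ -> G q;
  filter_dir : forall p q, G p -> G q ->
    exists r, [/\ G r, le ⟨r, p⟩ & le ⟨r, q⟩]
}.

Definition generic (C : set (set V)) (P le G : set V) : Prop :=
  filter_on P le G /\ forall D, C D -> dense P le D -> G `&` D !=set0.

Inductive is_name (P : set V) : V -> Prop :=
  IsName sigma :
    (forall z, z ∈ sigma -> exists tau p, P p /\ z = ⟨tau, p⟩) ->
    (forall tau p, ⟨tau, p⟩ ∈ sigma -> is_name P tau) ->
    is_name P sigma.

Definition names (M P : set V) : set V := M `&` is_name P.

Definition name_rel (tau sigma : V) : Prop := exists p, ⟨tau, p⟩ ∈ sigma.

Lemma name_rel_wf : well_founded name_rel.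
Proof.
apply: (wf_incl _ _ (clos_trans V mem)); last exact: wf_clos_trans mem_wf.
move=> tau sigma [p h].
apply: (t_trans _ _ _ (upair tau tau)).
  by apply: t_step; apply/mem_upair; left.
apply: (t_trans _ _ _ ⟨tau, p⟩); last exact: t_step.
by apply: t_step; apply/mem_upair; left.
Qed.

Definition val_step (G : set V) (sigma : V)
    (rec : forall tau, name_rel tau sigma -> V) : V :=
  mkset [set y | exists tau p (h : ⟨tau, p⟩ ∈ sigma),
                   G p /\ y = rec tau (ex_intro _ p h)].

Definition nval (G : set V) : V -> V :=
  Fix name_rel_wf (fun=> V) (@val_step G).

Lemma val_unfold G sigma : nval G sigma =
  mkset [set y | exists tau p, [/\ ⟨tau, p⟩ ∈ sigma, G p & y = nval G tau]].
Proof.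
rewrite /nval Fix_eq -/(nval G); last first.
  by move=> x f g fg; congr val_step; apply: functional_extensionality_dep => y;
     apply: functional_extensionality_dep.
congr mkset; rewrite predeqE => y; split.
  by move=> [tau [p [h [Gp ->]]]]; exists tau, p.
by move=> [tau [p [h Gp ->]]]; exists tau, p, h.
Qed.

Lemma small_name_rel sigma : small [set tau | name_rel tau sigma].
Proof.
apply: small_sub (small_bigcup (small_bigcup (small_mem sigma))) _.
move=> tau [p h]; exists (upair tau tau).
  by exists ⟨tau, p⟩ => //; apply/mem_upair; left.
by apply/mem_upair; left.
Qed.

Lemma mem_val G sigma y : y ∈ nval G sigma <->
  exists tau p, [/\ ⟨tau, p⟩ ∈ sigma, G p & y = nval G tau].
Proof.
rewrite val_unfold.
apply: (@mem_mkset
  [set y | exists tau p, [/\ ⟨tau, p⟩ ∈ sigma, G p & y = nval G tau]]).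
apply: (small_sub (small_image (nval G) (small_name_rel sigma))).
by move=> z [tau [p [h _ ->]]]; exists tau => //; exists p.
Qed.

Definition generic_ext (M P G : set V) : set V := nval G @` names M P.

Definition check_step (one : V) (x : V) (rec : forall y, y ∈ x -> V) : V :=
  mkset [set z | exists y (h : y ∈ x), z = ⟨rec y h, one⟩].

Definition check (one : V) : V -> V :=
  Fix mem_wf (fun=> V) (@check_step one).

Lemma mem_check one x z : z ∈ check one x <->
  exists2 y, y ∈ x & z = ⟨check one y, one⟩.
Proof.
rewrite {1}/check Fix_eq -/(check one); last first.
  by move=> w f g fg; congr check_step; apply: functional_extensionality_dep => y;
     apply: functional_extensionality_dep.
rewrite /check_step mem_mkset.
  by split=> [[y [h ->]]|[y h ->]]; [exists y|exists y, h].
apply: (small_sub (small_image (fun y => ⟨check one y, one⟩) (small_mem x))).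
by move=> w [y [h ->]]; exists y.
Qed.

Definition val_tuple (G : set V) m (s : m.-tuple V) : m.-tuple V :=
  [tuple of map (nval G) s].

Definition forces (M : set V) (C : set (set V)) (P le : set V)
    m (phi : formula 0 m) (p : V) (s : m.-tuple V) : Prop :=
  forall G, generic C P le G -> G p ->
    sat0 (generic_ext M P G) phi (val_tuple G s).

(* vtuple p [:: x1; x2; x3] = ⟨p, ⟨x1, ⟨x2, x3⟩⟩⟩ *)
Fixpoint vtuple (x : V) (s : seq V) : V :=
  if s is y :: s' then ⟨x, vtuple y s'⟩ else x.

Definition definability_lemma (M : set V) (C : set (set V)) (P le : set V)
    m (phi : formula 0 m) : Prop :=
  C [set z | exists p (s : m.-tuple V),
       [/\ P p, all_in (names M P) s, z = vtuple p s &
           forces M C P le phi p s]].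

Definition truth_lemma (M : set V) (C : set (set V)) (P le : set V)
    m (phi : formula 0 m) : Prop :=
  forall (s : m.-tuple V) G, all_in (names M P) s -> generic C P le G ->
    sat0 (generic_ext M P G) phi (val_tuple G s) ->
    exists2 p, G p & forces M C P le phi p s.

Definition forcing_theorem (M : set V) (C : set (set V)) (P le : set V)
    m (phi : formula 0 m) : Prop :=
  definability_lemma M C P le phi /\ truth_lemma M C P le phi.

Definition v0_in_v1 : formula 0 2 := fMem 0 ord0 ord_max.
Definition v0_eq_v1 : formula 0 2 := fEq 0 ord0 ord_max.

(* Raw formulas; membership in the forcing language of P over M is wf_ifml. *)
Inductive ifml : Type :=
| iGen (p : V)                                   (* check p in dot G *)
| iEq (sigma tau : V)
| iMem (sigma tau : V)
| iNot (phi : ifml)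
| iOr (I : V) (phi : {i : V | i ∈ I} -> ifml)
| iAnd (I : V) (phi : {i : V | i ∈ I} -> ifml).

Definition family (I : V) (c : {i : V | i ∈ I} -> V) : V :=
  mkset [set z | exists i : {i : V | i ∈ I}, z = ⟨sval i, c i⟩].

Lemma mem_family I (c : {i : V | i ∈ I} -> V) z :
  z ∈ family c <-> exists i : {i : V | i ∈ I}, z = ⟨sval i, c i⟩.
Proof.
apply: (@mem_mkset [set z | exists i : {i : V | i ∈ I}, z = ⟨sval i, c i⟩]).
pose F i := if pselect (i ∈ I) is left h then ⟨i, c (exist _ i h)⟩ else i.
apply: (small_sub (small_image F (small_mem I))) => w [[i h] /= ->].
exists i => //; rewrite /F; case: pselect => // h'.
by rewrite (Prop_irrelevance h h').
Qed.

Fixpoint code (phi : ifml) : V :=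
  match phi with
  | iGen p => ⟨vnat 0, p⟩
  | iEq sigma tau => ⟨vnat 1, sigma, tau⟩
  | iMem sigma tau => ⟨vnat 2, sigma, tau⟩
  | iNot phi => ⟨vnat 3, code phi⟩
  | iOr J phi => ⟨vnat 4, J, family (fun i => code (phi i))⟩
  | iAnd J phi => ⟨vnat 5, J, family (fun i => code (phi i))⟩
  end.

Fixpoint wf_ifml (M P : set V) (phi : ifml) : Prop :=
  match phi with
  | iGen p => P p
  | iEq sigma tau => names M P sigma /\ names M P tau
  | iMem sigma tau => names M P sigma /\ names M P tau
  | iNot phi => wf_ifml M P phi
  | iOr J phi | iAnd J phi =>
      [/\ M J, M (family (fun i => code (phi i))) &
          forall i, wf_ifml M P (phi i)]
  end.

Fixpoint isat (one : V) (G : set V) (phi : ifml) : Prop :=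
  match phi with
  | iGen p => G (nval G (check one p))
  | iEq sigma tau => nval G sigma = nval G tau
  | iMem sigma tau => nval G sigma ∈ nval G tau
  | iNot phi => ~ isat one G phi
  | iOr J phi => exists i, isat one G (phi i)
  | iAnd J phi => forall i, isat one G (phi i)
  end.

Definition iforces (C : set (set V)) (P le : set V) (one : V)
    (phi : ifml) (p : V) : Prop :=
  forall G, generic C P le G -> G p -> isat one G phi.

Definition uniform_forcing_theorem (M : set V) (C : set (set V))
    (P le : set V) (one : V) : Prop :=
  C [set z | exists p phi, [/\ P p, wf_ifml M P phi, z = ⟨p, code phi⟩ &
                               iforces C P le one phi p]] /\
  forall phi G, wf_ifml M P phi -> generic C P le G -> isat one G phi ->
    exists2 p, G p & iforces C P le one phi p.

(* B is allowed to be degenerate; a dense embedding of a class forcing forces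
   bot <> top, because a class forcing is nonempty. *)
Record boolean_algebra (B : set V) (meet join : V -> V -> V) (compl : V -> V)
    (bot top : V) : Prop := {
  ba_meet_closed : forall a b, B a -> B b -> B (meet a b);
  ba_join_closed : forall a b, B a -> B b -> B (join a b);
  ba_compl_closed : forall a, B a -> B (compl a);
  ba_bot : B bot;
  ba_top : B top;
  ba_meetC : forall a b, B a -> B b -> meet a b = meet b a;
  ba_joinC : forall a b, B a -> B b -> join a b = join b a;
  ba_meetA : forall a b c, B a -> B b -> B c ->
    meet a (meet b c) = meet (meet a b) c;
  ba_joinA : forall a b c, B a -> B b -> B c ->
    join a (join b c) = join (join a b) c;
  ba_joinK : forall a b, B a -> B b -> meet a (join a b) = a;
  ba_meetK : forall a b, B a -> B b -> join a (meet a b) = a;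
  ba_meetD : forall a b c, B a -> B b -> B c ->
    meet a (join b c) = join (meet a b) (meet a c);
  ba_joinD : forall a b c, B a -> B b -> B c ->
    join a (meet b c) = meet (join a b) (join a c);
  ba_meet_compl : forall a, B a -> meet a (compl a) = bot;
  ba_join_compl : forall a, B a -> join a (compl a) = top
}.

Definition ba_le (meet : V -> V -> V) (a b : V) : Prop := meet a b = a.

Definition is_sup (B : set V) (meet : V -> V -> V) (A : set V) (s : V) : Prop :=
  [/\ B s, (forall a, A a -> ba_le meet a s) &
      forall b, B b -> (forall a, A a -> ba_le meet a b) -> ba_le meet s b].

Definition M_complete (M B : set V) (meet : V -> V -> V) : Prop :=
  forall a, M a -> [set x | x ∈ a] `<=` B ->
    exists s, is_sup B meet [set x | x ∈ a] s.

Definition graph1 (D : set V) (f : V -> V) : set V :=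
  [set z | exists2 x, D x & z = ⟨x, f x⟩].

Definition graph2 (D : set V) (f : V -> V -> V) : set V :=
  [set z | exists x y, [/\ D x, D y & z = ⟨⟨x, y⟩, f x y⟩]].

Record dense_embedding (P le B : set V) (meet : V -> V -> V) (bot : V)
    (pi : V -> V) : Prop := {
  de_range : forall p, P p -> B (pi p) /\ pi p <> bot;
  de_inj : forall p q, P p -> P q -> pi p = pi q -> p = q;
  de_le : forall p q, P p -> P q -> le ⟨p, q⟩ <-> ba_le meet (pi p) (pi q);
  de_dense : forall b, B b -> b <> bot ->
    exists2 p, P p & ba_le meet (pi p) b
}.

Definition has_boolean_completion (M : set V) (C : set (set V))
    (P le : set V) : Prop :=
  exists (B : set V) (meet join : V -> V -> V) (compl : V -> V) (bot top : V)
         (pi : V -> V),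
    [/\ boolean_algebra B meet join compl bot top,
        M_complete M B meet,
        [/\ C B, C (graph2 B meet), C (graph2 B join) & C (graph1 B compl)],
        dense_embedding P le B meet bot pi &
        C (graph1 P pi)].

(* Main.v *)
From HB Require Import structures.
From mathcomp Require Import all_boot.
From mathcomp Require Import boolp classical_sets cardinality.
From Stdlib Require Import Wellfounded Relation_Operators.
Require Import Defs.

(** The obstacle is the weakness of recursion over the model. Comprehension has set quantifiers
    only, so a forcing relation for infinitary formulas cannot be built level by level as a sequence
    of classes; a recursion succeeds when all its values are sets of [M]. A formula is therefore
    compressed into a set whose forcing relation is already known to be a class, and under (1) an
    equation between two names is such a set. Negation is the second difficulty. Passing from
    forcing an equation to forcing its negation by looking at stronger conditions presupposes the
    truth lemma, which is not yet available. Carrying an equation for the negation along makes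
    negation a swap, and every existential or universal step then has to be rewritten as an equation
    both positively and negatively. Countability of the model supplies generic filters through every
    condition. This allows forcing, equivalence of formulas and the laws of the completion to be
    tested in all extensions at once, while definability over the model is kept as a separate
    concern. *)

(* The key step is (1) -> (3). By recursion on codes, carried out inside M, every
   infinitary formula is assigned two equations between names in M, one equivalent
   to the formula and one to its negation in every generic extension: conjunctions
   and disjunctions of equations are again equations, and atomic formulas between
   names are unfolded to the literals "r in G" and "r not in G". Forcing such an
   equation is definable by (1), and the truth lemma follows by induction, since by
   definability the conditions deciding a conjunction form a dense class in C.

   The same recursion with truth values in a Boolean completion gives (4) -> (3).
   For (3) -> (2) first-order formulas are treated by the usual induction, and for
   (3) -> (4) the completion is the algebra of codes of infinitary formulas modulo
   forced equivalence, made into a class by representatives choice. *)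

Set Implicit Arguments.
Unset Strict Implicit.
Unset Printing Implicit Defensive.

Local Open Scope classical_set_scope.

(** * Definability over a model of GB^- *)

Definition env_cons (x : V) (e : nat -> V) (i : nat) : V :=
  if i is j.+1 then e j else x.

(** The default [vempty] is a set of [M], so that a definable description has a value in [M] on
    every environment, as [DefT] requires. *)
Definition the (Q : V -> Prop) : V :=
  if pselect (exists x, Q x) is left h then sval (cid h) else vempty.

Lemma theP (Q : V -> Prop) : (exists x, Q x) -> Q (the Q).
Proof. by rewrite /the; case: pselect => // h _; case: (cid h). Qed.

Lemma the_none (Q : V -> Prop) : ~ (exists x, Q x) -> the Q = vempty.
Proof. by rewrite /the; case: pselect. Qed.

Lemma the_eq (Q : V -> Prop) x :
  (forall y y', Q y -> Q y' -> y = y') -> Q x -> the Q = x.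
Proof. by move=> u Qx; apply: u (Qx); apply: theP; exists x. Qed.

HB.lock Definition vfst (x : V) : V := the (fun y => exists z, x = ⟨y, z⟩).
HB.lock Definition vsnd (x : V) : V := the (fun y => exists z, x = ⟨z, y⟩).
HB.lock Definition vunion (x : V) : V := mkset [set z | exists2 y, y ∈ x & z ∈ y].
Definition vcup (x y : V) : V := vunion (upair x y).
HB.lock Definition vimg (a : V) (f : V -> V) : V := mkset [set z | exists2 x, x ∈ a & z = f x].
HB.lock Definition vsep (a : V) (Q : V -> Prop) : V := mkset [set z | z ∈ a /\ Q z].
(** Application of a set function: if [y] is the only value at [x], the union of {y} is [y].
    Components of pairs in [f] lie in its double union. Built from union and separation, the
    operation inherits definability from them. *)
HB.lock Definition vapp (f x : V) : V :=
  vunion (vsep (vunion (vunion f)) (fun y => ⟨x, y⟩ ∈ f)).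
HB.lock Definition vdom (x : V) : V :=
  vsep (vunion (vunion x)) (fun y => exists p, ⟨y, p⟩ ∈ x).

Lemma vfstE x y : vfst ⟨x, y⟩ = x.
Proof.
by rewrite vfst.unlock; apply: the_eq => [z z' [w ->] [w' /opair_inj []]|]//; exists y.
Qed.

Lemma vsndE x y : vsnd ⟨x, y⟩ = y.
Proof.
by rewrite vsnd.unlock; apply: the_eq => [z z' [w ->] [w' /opair_inj []]|]//; exists x.
Qed.

Lemma mem_vunion x z : z ∈ vunion x <-> exists2 y, y ∈ x & z ∈ y.
Proof.
rewrite vunion.unlock.
exact: (@mem_mkset [set z | exists2 y, y ∈ x & z ∈ y] (small_bigcup (small_mem x))).
Qed.

Lemma mem_vcup x y z : z ∈ vcup x y <-> z ∈ x \/ z ∈ y.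
Proof.
rewrite mem_vunion; split=> [[w /mem_upair [] ->]|[h|h]]; [by left|by right| |].
- by exists x => //; apply/mem_upair; left.
- by exists y => //; apply/mem_upair; right.
Qed.

Lemma mem_vimg a f z : z ∈ vimg a f <-> exists2 x, x ∈ a & z = f x.
Proof.
rewrite vimg.unlock; apply: (@mem_mkset [set z | exists2 x, x ∈ a & z = f x]).
by apply: small_sub (small_image f (small_mem a)) _ => w [x xa ->]; exists x.
Qed.

Lemma mem_vsep a Q z : z ∈ vsep a Q <-> z ∈ a /\ Q z.
Proof.
rewrite vsep.unlock; apply: (@mem_mkset [set z | z ∈ a /\ Q z]).
by apply: small_sub (small_mem a) _ => w [].
Qed.

Lemma mem_opair_union x y : y ∈ vunion ⟨x, y⟩.
Proof.
by apply/mem_vunion; exists (upair x y); apply/mem_upair; right.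
Qed.

Lemma mem_vunion2_opair x y f :
  ⟨x, y⟩ ∈ f -> x ∈ vunion (vunion f) /\ y ∈ vunion (vunion f).
Proof.
move=> h; split; apply/mem_vunion; exists (upair x y).
- by apply/mem_vunion; exists ⟨x, y⟩ => //; apply/mem_upair; right.
- by apply/mem_upair; left.
- by apply/mem_vunion; exists ⟨x, y⟩ => //; apply/mem_upair; right.
- by apply/mem_upair; right.
Qed.

Lemma mem_vdom x y : y ∈ vdom x <-> name_rel y x.
Proof.
rewrite vdom.unlock mem_vsep; split=> [[]//|h]; split=> //.
by case: h => p /mem_vunion2_opair [].
Qed.

Lemma not_mem_vempty x : ~ x ∈ vempty.
Proof. by move/(mem_mkset small_empty). Qed.

Lemma vappE f x y :
  (forall z, ⟨x, z⟩ ∈ f -> z = y) -> ⟨x, y⟩ ∈ f -> vapp f x = y.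
Proof.
move=> u h; rewrite vapp.unlock; apply: V_ext => z; rewrite mem_vunion.
split=> [[w /mem_vsep[_ /u ->]]//|zy].
by exists y => //; apply/mem_vsep; split=> //; have [] := mem_vunion2_opair h.
Qed.

Lemma vapp_graph a f x : x ∈ a -> vapp (vimg a (fun y => ⟨y, f y⟩)) x = f x.
Proof.
move=> xa; apply: vappE.
  by move=> z /mem_vimg [y _ /opair_inj[-> ->]].
by apply/mem_vimg; exists x.
Qed.

Section Definability.
Variables (M : set V) (C : set (set V)).
Hypothesis hM : ctm_GBm M C.

Let ax := ctm_axioms hM.

Lemma M_trans x y : M y -> x ∈ y -> M x.
Proof. exact: (ctm_transitive hM). Qed.

Definition Menv (e : nat -> V) : Prop := forall i, M (e i).

Lemma Menv_cons x e : M x -> Menv e -> Menv (env_cons x e).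
Proof. by move=> Mx Me [|i] //=. Qed.

Lemma Menv_shift e : Menv e -> Menv (fun i => e i.+1).
Proof. by move=> Me i. Qed.

(* Predicates on environments that are first-order definable over (M, C) from
   class parameters, with set quantifiers bounded by M. *)
Inductive Def : ((nat -> V) -> Prop) -> Prop :=
| Def_mem0 i j : Def (fun e => e i ∈ e j)
| Def_eq0 i j : Def (fun e => e i = e j)
| Def_cls0 (X : set V) i : C X -> Def (fun e => X (e i))
| Def_not Q : Def Q -> Def (fun e => ~ Q e)
| Def_and Q R : Def Q -> Def R -> Def (fun e => Q e /\ R e)
| Def_all0 Q : Def Q -> Def (fun e => forall x, M x -> Q (env_cons x e))
| Def_ext Q R : (forall e, Menv e -> Q e <-> R e) -> Def Q -> Def R.

Definition etuple n (e : nat -> V) : n.-tuple V := [tuple e i | i < n].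

Lemma etuple_cons n x e :
  [tuple of x :: etuple n e] = etuple n.+1 (env_cons x e).
Proof.
apply: eq_from_tnth => i; rewrite tnth_mktuple.
by case: (unliftP ord0 i) => [j ->|->]; rewrite ?tnth0 // tnthS tnth_mktuple.
Qed.

(** A formula fixes its number of variables and its class parameters in advance, while two conjuncts
    may use different ones. Stating the result for all large [n] and all tuples containing [L] lets
    both subformulas be taken in a common context. *)
Lemma Def_formula Q : Def Q ->
  exists (N : nat) (L : seq (set V)), List.Forall C L /\
  forall n, N <= n -> forall k (X : k.-tuple (set V)),
    (forall Y, List.In Y L -> exists j, tnth X j = Y) ->
  exists phi : formula k n, forall e, Menv e ->
    sat M X phi (etuple n e) <-> Q e.
Proof.
elim=> {Q} [i j|i j|X i CX|Q _ [N [L [CL h]]]|Q R _ [N [L [CL h]]] _ [N' [L' [CL' h']]]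
           |Q _ [N [L [CL h]]]|Q R QR _ [N [L [CL h]]]].
- exists (maxn i j).+1, [::]; split=> // n; rewrite gtn_max => /andP[ni nj] k X _.
  by exists (fMem k (Ordinal ni) (Ordinal nj)) => e Me /=; rewrite !tnth_mktuple.
- exists (maxn i j).+1, [::]; split=> // n; rewrite gtn_max => /andP[ni nj] k X _.
  by exists (fEq k (Ordinal ni) (Ordinal nj)) => e Me /=; rewrite !tnth_mktuple.
- exists i.+1, [:: X]; split=> [|n ni k Y /(_ X) [|j Yj]]; [by constructor|by left|].
  by exists (fCls (Ordinal ni) j) => e Me /=; rewrite !tnth_mktuple Yj.
- exists N, L; split=> // n Nn k X XL; have [phi phiP] := h n Nn k X XL.
  by exists (fNot phi) => e Me /=; rewrite phiP.
- exists (maxn N N'), (L ++ L'); split; first by apply/List.Forall_app.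
  move=> n; rewrite geq_max => /andP[nN nN'] k X XL.
  have [Y YL|phi phiP] := h n nN k X; first by apply: XL; apply/List.in_app_iff; left.
  have [Y YL|psi psiP] := h' n nN' k X; first by apply: XL; apply/List.in_app_iff; right.
  by exists (fAnd phi psi) => e Me /=; rewrite phiP ?psiP.
- exists N, L; split=> // n Nn k X XL; have [phi phiP] := h n.+1 (leqW Nn) k X XL.
  exists (fAll phi) => e Me /=; split=> H x Mx; have Mxe := Menv_cons Mx Me.
    by have := H x Mx; rewrite etuple_cons phiP.
  by rewrite etuple_cons phiP //; apply: H.
- exists N, L; split=> // n Nn k X XL; have [phi phiP] := h n Nn k X XL.
  by exists phi => e Me; rewrite phiP // QR.
Qed.

Lemma Forall_tuple (L : seq (set V)) : List.Forall C L ->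
  exists k (X : k.-tuple (set V)), all_in C X /\
    forall Y, List.In Y L -> exists j, tnth X j = Y.
Proof.
elim=> {L} [|Y L CY _ [k [X [CX XL]]]].
  by exists 0, [tuple]; split=> // -[].
exists k.+1, [tuple of Y :: X]; split=> [i|Z [<-|/XL [j <-]]].
- by case: (unliftP ord0 i) => [j ->|->]; rewrite ?tnth0 ?tnthS.
- by exists ord0; rewrite tnth0.
- by exists (lift ord0 j); rewrite tnthS.
Qed.

Lemma Def_compr Q e : Def Q -> Menv e -> C [set x | M x /\ Q (env_cons x e)].
Proof.
move=> /Def_formula [N [L [/Forall_tuple [k [X [CX XL]]] h]]] Me.
have [phi phiP] := h N.+1 (leqnSn N) k X XL.
have [|Y CY YP] := GBm_comprehension ax phi CX (e := etuple N e).
  by move=> i; rewrite tnth_mktuple.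
suff -> : [set x | M x /\ Q (env_cons x e)] = Y by [].
rewrite predeqE => x; split=> [[Mx Qx]|Yx].
  by apply/(YP _ Mx); rewrite etuple_cons; apply/phiP => //; apply: Menv_cons.
have Mx := ctm_classes hM CY Yx; split=> //.
by have /(YP _ Mx) := Yx; rewrite etuple_cons => /phiP; apply; apply: Menv_cons.
Qed.

Lemma M_empty : M vempty.
Proof.
have [w [_ [e [Me _ h]] _]] := GBm_infinity ax.
suff -> : vempty = e by [].
apply: V_ext => z; split=> [/not_mem_vempty//|ze].
by case: (h z (M_trans Me ze)).
Qed.

Lemma C_sub X x : C X -> X x -> M x.
Proof. by move=> /(ctm_classes hM); apply. Qed.

Lemma M_sep X a : C X -> M a -> M (vsep a X).
Proof.
move=> CX Ma.
have [| |//|b Mb bP] := @GBm_separation _ _ ax 1 0 (fCls ord0 ord0) [tuple X] [tuple] a.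
- by move=> i; rewrite ord1 tnth0.
- by case.
suff -> : vsep a X = b by [].
apply: V_ext => z; rewrite mem_vsep; split=> [[za Xz]|zb].
  by apply/(bP _ (M_trans Ma za)).
by have /(bP _ (M_trans Mb zb)) := zb.
Qed.

Lemma M_upair x y : M x -> M y -> M (upair x y).
Proof.
move=> Mx My; have [z Mz zP] := GBm_pairing ax Mx My.
suff -> : upair x y = z by [].
apply: V_ext => w; rewrite mem_upair; split=> h.
  by apply/zP => //; case: h => ->.
by apply/zP => //; apply: M_trans Mz h.
Qed.

Lemma M_opair x y : M x -> M y -> M ⟨x, y⟩.
Proof. by move=> Mx My; apply: M_upair; apply: M_upair. Qed.

Lemma M_opair_inv x y : M ⟨x, y⟩ -> M x /\ M y.
Proof.
move=> h; have h' : M (upair x y) by apply: M_trans h _; apply/mem_upair; right.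
by split; apply: M_trans h' _; apply/mem_upair; [left|right].
Qed.

Lemma M_vunion x : M x -> M (vunion x).
Proof.
move=> Mx; have [u Mu uP] := GBm_union ax Mx.
suff -> : vunion x = u by [].
apply: V_ext => w; rewrite mem_vunion; split=> [[y yx wy]|h].
  have My := M_trans Mx yx.
  by apply/(uP _ (M_trans My wy)); exists y; split.
by have /(uP _ (M_trans Mu h)) [y [My yx wy]] := h; exists y.
Qed.

(** Environments are infinite, so an arbitrary map [r] covers weakening, exchange and contraction at
    once. Below a quantifier [r] is shifted and fixes variable 0. *)
Lemma Def_ren Q (r : nat -> nat) : Def Q -> Def (fun e => Q (fun i => e (r i))).
Proof.
move=> dQ; elim: dQ r => {Q}.
- by move=> i j r; apply: Def_mem0.
- by move=> i j r; apply: Def_eq0.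
- by move=> X i CX r; apply: Def_cls0.
- by move=> Q _ h r; apply: Def_not.
- by move=> Q R _ h _ h' r; apply: Def_and.
- move=> Q _ h r; have := Def_all0 (h (fun i => if i is j.+1 then (r j).+1 else 0)).
  apply: Def_ext => e Me; suff E x : (fun i => env_cons x e
    match i with 0 => 0 | j.+1 => (r j).+1 end) = env_cons x (fun i => e (r i)).
    by split=> H x Mx; have := H x Mx; rewrite E.
  by apply: funext => -[].
- by move=> Q R QR _ h r; apply: Def_ext (h r) => e Me; apply: QR => i.
Qed.

(** A total operation with definable graph: the value sits in variable 0 and the arguments are
    shifted up by one. Values in [M] are required so that a term can be named by a quantifier
    ranging over [M]. *)
Definition DefT (t : (nat -> V) -> V) : Prop :=
  (forall e, Menv e -> M (t e)) /\ Def (fun e => e 0 = t (fun i => e i.+1)).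

Lemma Def_or Q R : Def Q -> Def R -> Def (fun e => Q e \/ R e).
Proof.
move=> dQ dR; apply: Def_ext (Def_not (Def_and (Def_not dQ) (Def_not dR))) => e _.
by split=> [/not_andP[]/contrapT|[] h []]; [left|right| |].
Qed.

Lemma Def_imp Q R : Def Q -> Def R -> Def (fun e => Q e -> R e).
Proof.
move=> dQ dR; apply: Def_ext (Def_or (Def_not dQ) dR) => e _.
split=> [[]//|h]; case: (EM (Q e)) => q; [right|left] => //; exact: h.
Qed.

Lemma Def_iff Q R : Def Q -> Def R -> Def (fun e => Q e <-> R e).
Proof. by move=> dQ dR; apply: Def_and; apply: Def_imp. Qed.

Lemma Def_all (Q : (nat -> V) -> V -> Prop) :
  Def (fun e => Q (fun i => e i.+1) (e 0)) ->
  Def (fun e => forall x, M x -> Q e x).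
Proof. by move=> /Def_all0; apply: Def_ext. Qed.

Lemma Def_ex (Q : (nat -> V) -> V -> Prop) :
  Def (fun e => Q (fun i => e i.+1) (e 0)) ->
  Def (fun e => exists x, M x /\ Q e x).
Proof.
move=> dQ.
apply: Def_ext (Def_not (@Def_all (fun e x => ~ Q e x) (Def_not dQ))) => e _.
split=> [/existsNP [x /not_implyP [Mx /contrapT Qx]]|[x [Mx Qx]]]; first by exists x.
by move/(_ x Mx).
Qed.

(** The term is eliminated by a quantifier: some [x] in [M] equals it and satisfies [Q]. *)
Lemma Def_subst (Q : (nat -> V) -> V -> Prop) t :
  Def (fun e => Q (fun i => e i.+1) (e 0)) -> DefT t -> Def (fun e => Q e (t e)).
Proof.
move=> dQ [Mt dt]; apply: Def_ext (@Def_ex (fun e x => x = t e /\ Q e x) (Def_and dt dQ)).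
by move=> e Me; split=> [[x [_ [->]]]//|h]; exists (t e); split=> //; apply: Mt.
Qed.

Lemma DefT_ren t (r : nat -> nat) : DefT t -> DefT (fun e => t (fun i => e (r i))).
Proof.
move=> [Mt dt]; split=> [e Me|]; first by apply: Mt.
exact: (Def_ren (fun i => if i is j.+1 then (r j).+1 else 0) dt).
Qed.

Lemma DefT_shift t : DefT t -> DefT (fun e => t (fun i => e i.+1)).
Proof. exact: DefT_ren. Qed.

Lemma Def_cls X t : C X -> DefT t -> Def (fun e => X (t e)).
Proof. by move=> CX; apply: (@Def_subst (fun _ x => X x)); apply: Def_cls0. Qed.

Lemma Def_mem t s : DefT t -> DefT s -> Def (fun e => t e ∈ s e).
Proof.
move=> dt ds; apply: (@Def_subst (fun e x => x ∈ s e)) dt.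
apply: (@Def_subst (fun e x => e 0 ∈ x)); first exact: Def_mem0.
exact: DefT_shift.
Qed.

Lemma Def_eq t s : DefT t -> DefT s -> Def (fun e => t e = s e).
Proof.
move=> dt ds; apply: (@Def_subst (fun e x => x = s e)) dt.
apply: (@Def_subst (fun e x => e 0 = x)); first exact: Def_eq0.
exact: DefT_shift.
Qed.

Lemma DefT_var i : DefT (fun e => e i).
Proof. by split=> [e|]; [apply|apply: Def_eq0]. Qed.

Lemma C_sing a : M a -> C [set a].
Proof.
move=> Ma; have := @Def_compr (fun e => e 0 = e 1) (fun=> a) (Def_eq0 _ _) (fun=> Ma).
by congr C; rewrite predeqE => x; split=> [[]|->].
Qed.

Lemma DefT_const a : M a -> DefT (fun=> a).
Proof. by move=> Ma; split=> // ; apply: (@Def_cls0 [set a]); apply: C_sing. Qed.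

Lemma DefT_subst (f : (nat -> V) -> V -> V) t :
  DefT (fun e => f (fun i => e i.+1) (e 0)) -> DefT t -> DefT (fun e => f e (t e)).
Proof.
move=> [Mf df] dt; split=> [e Me|].
  by apply: (Mf (env_cons (t e) e)); apply: Menv_cons => //; apply: dt.1.
apply: (@Def_subst (fun e x => e 0 = f (fun i => e i.+1) x)); last exact: DefT_shift dt.
exact: (Def_ren (fun i => match i with 0 => 1 | 1 => 0 | j => j end) df).
Qed.

Lemma DefT_comp (f : V -> V) t :
  DefT (fun e => f (e 0)) -> DefT t -> DefT (fun e => f (t e)).
Proof. exact: (@DefT_subst (fun=> f)). Qed.

Lemma DefT_comp2 (f : V -> V -> V) t s :
  DefT (fun e => f (e 0) (e 1)) -> DefT t -> DefT s -> DefT (fun e => f (t e) (s e)).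
Proof.
move=> [Mf df] dt ds; split=> [e Me|].
  by apply: (Mf (fun i => if i is 0 then t e else s e)) => -[|i];
    [case: dt => + _|case: ds => + _]; apply.
apply: (@Def_subst (fun e x => e 0 = f x (s (fun i => e i.+1)))); last exact: DefT_shift dt.
apply: (@Def_subst (fun e x => e 1 = f (e 0) x)); last first.
  exact: (DefT_ren (fun i => i.+2) ds).
exact: (Def_ren (fun i => match i with 0 => 2 | 1 => 1 | _ => 0 end) df).
Qed.

Lemma Def_ball (Q : (nat -> V) -> V -> Prop) t :
  DefT t -> Def (fun e => Q (fun i => e i.+1) (e 0)) ->
  Def (fun e => forall x, x ∈ t e -> Q e x).
Proof.
move=> dt dQ; have Q' := Def_imp (Def_mem (DefT_var 0) (DefT_shift dt)) dQ.
apply: Def_ext (@Def_all (fun e x => x ∈ t e -> Q e x) Q') => e Me.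
split=> h x; last by move=> _; apply: h.
by move=> xt; apply: h => //; apply: M_trans xt; apply: dt.1.
Qed.

Lemma Def_bex (Q : (nat -> V) -> V -> Prop) t :
  DefT t -> Def (fun e => Q (fun i => e i.+1) (e 0)) ->
  Def (fun e => exists2 x, x ∈ t e & Q e x).
Proof.
move=> dt dQ; have Q' := Def_and (Def_mem (DefT_var 0) (DefT_shift dt)) dQ.
apply: Def_ext (@Def_ex (fun e x => x ∈ t e /\ Q e x) Q') => e Me.
split=> [[x [_ []]]|[x xt Qx]]; exists x => //; split=> //.
by apply: M_trans xt; apply: dt.1.
Qed.

Lemma DefT_the (Q : (nat -> V) -> V -> Prop) :
  (forall e y, Menv e -> Q e y -> M y) ->
  (forall e y y', Menv e -> Q e y -> Q e y' -> y = y') ->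
  Def (fun e => Q (fun i => e i.+1) (e 0)) -> DefT (fun e => the (Q e)).
Proof.
move=> QM Qu dQ; split=> [e Me|].
  case: (EM (exists y, Q e y)) => [/theP/QM|/the_none ->]; first exact.
  exact: M_empty.
have dex := DefT_const M_empty.
have dQ' := @Def_ex Q dQ.
have d0 := Def_and (Def_ren S (Def_not dQ')) (Def_eq (DefT_var 0) dex).
apply: Def_ext (Def_or dQ d0) => e Me /=; have Me' := Menv_shift Me; split.
  case=> [h|[h ->]]; first by apply/esym/the_eq => // y y'; apply: Qu.
  by rewrite the_none // => -[y Qy]; apply: h; exists y; split=> //; apply: QM Qy.
move=> e0; case: (EM (exists y, Q (fun i => e i.+1) y)) => h.
  by left; rewrite e0; apply: theP.
by right; split; [move=> [y [_ Qy]]; apply: h; exists y|rewrite e0 the_none].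
Qed.

(** By extensionality, being equal to a set term means having the same elements. Those of either
    side lie in [M] by transitivity, so the quantifier over them may be bounded by [M]. *)
Lemma DefT_set (Q : (nat -> V) -> V -> Prop) (t : (nat -> V) -> V) :
  (forall e z, z ∈ t e <-> Q e z) -> (forall e, Menv e -> M (t e)) ->
  Def (fun e => Q (fun i => e i.+1) (e 0)) -> DefT t.
Proof.
move=> tP Mt dQ; split=> //.
have d := Def_iff (Def_mem (DefT_var 0) (DefT_var 1))
  (Def_ren (fun i => if i is j.+1 then j.+2 else 0) dQ).
have := @Def_all (fun e x => x ∈ e 0 <-> Q (fun i => e i.+1) x) d.
apply: Def_ext => e Me; split=> [h|e0 x _]; last by rewrite e0 tP.
have Me' := Menv_shift Me.
apply: V_ext => z; rewrite tP; split=> hz.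
  by apply/h => //; apply: M_trans hz; apply: Me.
by apply/h => //; apply: (M_trans (Mt _ Me')); apply/tP.
Qed.

Lemma DefT_upair t s : DefT t -> DefT s -> DefT (fun e => upair (t e) (s e)).
Proof.
apply: DefT_comp2; apply: (@DefT_set (fun e z => z = e 0 \/ z = e 1)).
- by move=> e z; apply: mem_upair.
- by move=> e Me; apply: M_upair.
- by apply: Def_or; apply: Def_eq0.
Qed.

Lemma DefT_opair t s : DefT t -> DefT s -> DefT (fun e => ⟨t e, s e⟩).
Proof. by move=> dt ds; do ! apply: DefT_upair. Qed.

Lemma DefT_vunion t : DefT t -> DefT (fun e => vunion (t e)).
Proof.
apply: DefT_comp; apply: (@DefT_set (fun e z => exists2 y, y ∈ e 0 & z ∈ y)).
- by move=> e z; apply: mem_vunion.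
- by move=> e Me; apply: M_vunion.
- by apply: Def_bex; [apply: DefT_var|apply: Def_mem0].
Qed.

Lemma DefT_vcup t s : DefT t -> DefT s -> DefT (fun e => vcup (t e) (s e)).
Proof. by move=> dt ds; apply/DefT_vunion/DefT_upair. Qed.

Lemma DefT_vsep t (Q : (nat -> V) -> V -> Prop) :
  DefT t -> Def (fun e => Q (fun i => e i.+1) (e 0)) ->
  DefT (fun e => vsep (t e) (Q e)).
Proof.
move=> dt dQ; apply: (@DefT_set (fun e z => z ∈ t e /\ Q e z)).
- by move=> e z; apply: mem_vsep.
- move=> e Me; have Mt := dt.1 _ Me.
  suff -> : vsep (t e) (Q e) = vsep (t e) [set x | M x /\ Q e x].
    by apply: M_sep => //; apply: (Def_compr dQ Me).
  apply: V_ext => z; rewrite !mem_vsep; split=> -[zt]; last by case.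
  by split=> //; split=> //; apply: M_trans zt.
- apply: Def_and => //; apply: Def_mem; first exact: DefT_var.
  exact: DefT_shift.
Qed.

Lemma M_collect R a : C R -> M a -> (forall x, x ∈ a -> exists y, R ⟨x, y⟩) ->
  exists2 b, M b & forall x, x ∈ a -> exists2 y, y ∈ b & R ⟨x, y⟩.
Proof.
move=> CR Ma h.
have d : Def (fun e => R ⟨e 0, e 1⟩).
  by apply: Def_cls => //; apply: DefT_opair; apply: DefT_var.
have [N [L [/Forall_tuple [k [X [CX XL]]] H]]] := Def_formula d.
have [phi phiP] := H N.+2 (leqW (leqnSn N)) k X XL.
have Me : Menv (fun=> a) by [].
have E x y : [tuple of x :: y :: etuple N (fun=> a)] =
    etuple N.+2 (env_cons x (env_cons y (fun=> a))).
  by rewrite -!etuple_cons; apply: val_inj.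
have satE x y : M x -> M y ->
    sat M X phi [tuple of x :: y :: etuple N (fun=> a)] <-> R ⟨x, y⟩.
  by move=> Mx My; rewrite E phiP //; do 2 apply: Menv_cons => //.
have [|//|x Mx xa|b Mb bP] := GBm_collection ax CX (phi := phi) (e := etuple N (fun=> a)) (a := a).
- by move=> i; rewrite tnth_mktuple.
- have [y Rxy] := h x xa; have [_ My] := M_opair_inv (C_sub CR Rxy).
  by exists y => //; apply/satE.
exists b => // x xa; have Mx := M_trans Ma xa.
by have [y [My yb /satE]] := bP x Mx xa; exists y => //; auto.
Qed.

(** Replacement derived from Collection: the collecting set [b] may be too large, and Separation
    cuts it down to the image, which is a class by comprehension. *)
Lemma DefT_vimg t (f : (nat -> V) -> V -> V) :
  DefT t -> DefT (fun e => f (fun i => e i.+1) (e 0)) ->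
  DefT (fun e => vimg (t e) (f e)).
Proof.
move=> dt df; have dfe : Def (fun e => e 0 = f (fun i => e i.+2) (e 1)) := df.2.
have dQ' : Def (fun e => exists2 x, x ∈ t (fun i => e i.+1) & e 0 = f (fun i => e i.+1) x).
  apply: (@Def_bex (fun e x => e 0 = f (fun i => e i.+1) x)); first exact: DefT_shift.
  exact: (Def_ren (fun i => match i with 0 => 1 | 1 => 0 | j => j end) dfe).
apply: (@DefT_set (fun e z => exists2 x, x ∈ t e & z = f e x)) => //.
  by move=> e z; apply: mem_vimg.
move=> e Me; have Mt := dt.1 _ Me.
have Mf x : M x -> M (f e x).
  by move=> Mx; have := df.1 _ (Menv_cons Mx Me).
pose R := [set z | M z /\ exists x, M x /\ z = ⟨x, f e x⟩].
have CR : C R.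
  apply: (@Def_compr (fun e => exists x, M x /\ e 0 = ⟨x, f (fun i => e i.+1) x⟩)) => //.
  apply: (@Def_ex (fun e x => e 0 = ⟨x, f (fun i => e i.+1) x⟩)).
  apply: Def_eq; first exact: DefT_var.
  apply: DefT_opair; first exact: DefT_var.
  exact: (DefT_ren (fun i => if i is j.+1 then j.+2 else 0) df).
have [|b Mb bP] := M_collect CR Mt.
  move=> x xt; have Mx := M_trans Mt xt; have Mfx := Mf x Mx.
  by exists (f e x); split; [apply: M_opair|exists x].
have Cim := Def_compr dQ' Me.
suff -> : vimg (t e) (f e) = vsep b [set x | M x /\ exists2 y, y ∈ t e & x = f e y].
  exact: M_sep.
apply: V_ext => z; rewrite mem_vimg mem_vsep; split=> [[x xt ->]|[_ [_]]//].
have [y yb [_ [x' [_ /opair_inj[xx' yf]]]]] := bP x xt.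
subst x' y; split=> //; split; last by exists x.
by apply: Mf; apply: M_trans xt.
Qed.

Lemma DefT_if Q t s : Def Q -> DefT t -> DefT s ->
  DefT (fun e => if `[< Q e >] then t e else s e).
Proof.
move=> dQ dt ds; split=> [e Me|].
  by case: asboolP => _; [apply: dt.1|apply: ds.1].
have dQ' := Def_ren S dQ.
have := Def_or (Def_and dQ' dt.2) (Def_and (Def_not dQ') ds.2).
apply: Def_ext => e _; case: asboolP => q; split=> [[]|]; try by case.
- by left.
- by right.
Qed.

End Definability.

(** [Def] only provides quantifiers over [M]; a quantifier over the universe is admissible once its
    witnesses are known to lie in [M]. *)
Lemma Def_exb M C (Q : (nat -> V) -> V -> Prop) :
  (forall e x, Menv M e -> Q e x -> M x) ->
  Def M C (fun e => Q (fun i => e i.+1) (e 0)) ->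
  Def M C (fun e => exists x, Q e x).
Proof.
move=> QM /Def_ex; apply: Def_ext => e Me.
by split=> [[x []]|[x Qx]]; exists x => //; split=> //; apply: QM Qx.
Qed.

Ltac df_user := fail.

(** Definability goals are solved by their outermost symbol: each clause applies one closure
    property, and hypotheses on operations of one or two arguments act as further closure
    properties. Later operations enter through [df_user]. *)
Ltac df_step :=
  cbv beta;
  match goal with
  | _ => assumption
  | |- DefT _ _ (fun e => e _) => apply DefT_var
  | h : DefT _ _ (fun e => ?f (e 0)) |- DefT _ _ (fun e => ?f (@?t e)) =>
      apply (DefT_comp h)
  | h : DefT _ _ (fun e => ?f (e 0) (e 1)) |- DefT _ _ (fun e => ?f _ _) =>
      apply (DefT_comp2 h)
  | |- DefT _ _ (fun e => opair _ _) => refine (DefT_opair _ _ _); [eassumption| |]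
  | |- DefT _ _ (fun e => upair _ _) => refine (DefT_upair _ _ _); [eassumption| |]
  | |- DefT _ _ (fun e => vunion _) => refine (DefT_vunion _ _); [eassumption|]
  | |- DefT _ _ (fun e => vcup _ _) => refine (DefT_vcup _ _ _); [eassumption| |]
  | |- DefT _ _ (fun e => vsep _ _) => refine (DefT_vsep _ _ _); [eassumption| |]
  | |- DefT _ _ (fun e => vimg _ _) => refine (DefT_vimg _ _ _); [eassumption| |]
  | |- DefT _ _ (fun e => if `[< _ >] then _ else _) => refine (DefT_if _ _ _)
  | |- DefT _ _ (fun e => ?a) =>
      refine (DefT_const _ _); [eassumption|first [assumption|eapply M_empty; eassumption]]
  | |- DefT _ _ (fun e => _) => df_user
  | |- Def _ _ (fun e => _ /\ _) => refine (Def_and _ _)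
  | |- Def _ _ (fun e => _ \/ _) => refine (Def_or _ _)
  | |- Def _ _ (fun e => _ <-> _) => refine (Def_iff _ _)
  | |- Def _ _ (fun e => ~ _) => refine (Def_not _)
  | |- Def _ _ (fun e => _ = _) => refine (Def_eq _ _)
  | |- Def _ _ (fun e => _ ∈ _) => refine (Def_mem _ _)
  | |- Def _ _ (fun e => forall x, x ∈ _ -> _) => refine (Def_ball _ _ _); [eassumption| |]
  | |- Def _ _ (fun e => exists2 x, x ∈ _ & _) => refine (Def_bex _ _ _); [eassumption| |]
  | |- Def _ _ (fun e => exists x, _ x /\ _) => refine (Def_ex _)
  | |- Def ?M _ (fun e => forall x, ?M x -> _) => refine (Def_all _)
  | |- Def _ _ (fun e => _ -> _) => refine (Def_imp _ _)
  | |- Def _ _ (fun e => _) => df_user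
  | |- Def _ _ (fun e => ?X _) => refine (@Def_cls _ _ X _ _ _); [assumption|]
  end.

Ltac df := repeat df_step.

Section Projections.
Variables (M : set V) (C : set (set V)).
Hypothesis hM : ctm_GBm M C.

Lemma DefT_vfst t : DefT M C t -> DefT M C (fun e => vfst (t e)).
Proof.
apply: DefT_comp; rewrite vfst.unlock; apply: (DefT_the hM).
- by move=> e y Me [z E]; have := Me 0; rewrite E => /(M_opair_inv hM)[].
- by move=> e y y' Me [z ->] [z' /opair_inj[]].
apply: Def_exb; last by df.
by move=> e x Me E; have := Me 1; rewrite E => /(M_opair_inv hM)[].
Qed.

Lemma DefT_vsnd t : DefT M C t -> DefT M C (fun e => vsnd (t e)).
Proof.
apply: DefT_comp; rewrite vsnd.unlock; apply: (DefT_the hM).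
- by move=> e y Me [z E]; have := Me 0; rewrite E => /(M_opair_inv hM)[].
- by move=> e y y' Me [z ->] [z' /opair_inj[]].
apply: Def_exb; last by df.
by move=> e x Me E; have := Me 1; rewrite E => /(M_opair_inv hM)[].
Qed.

Lemma DefT_vdom t : DefT M C t -> DefT M C (fun e => vdom (t e)).
Proof.
apply: DefT_comp; rewrite vdom.unlock; df; apply: Def_exb; last by df.
by move=> e x Me h; have := M_trans hM (Me 1) h => /(M_opair_inv hM)[].
Qed.

Lemma DefT_vapp t s : DefT M C t -> DefT M C s -> DefT M C (fun e => vapp (t e) (s e)).
Proof. by apply: DefT_comp2; rewrite vapp.unlock; df. Qed.
End Projections.

Ltac df_user ::=
  match goal with
  | |- DefT _ _ (fun e => vfst _) => refine (DefT_vfst _ _); [eassumption|]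
  | |- DefT _ _ (fun e => vsnd _) => refine (DefT_vsnd _ _); [eassumption|]
  | |- DefT _ _ (fun e => vdom _) => refine (DefT_vdom _ _); [eassumption|]
  | |- DefT _ _ (fun e => vapp _ _) => refine (DefT_vapp _ _ _); [eassumption| |]
  end.

(** * Recursion inside the model *)

Definition vgraph (a : V) (f : V -> V) : V := vimg a (fun x => ⟨x, f x⟩).

Lemma eq_vimg a f g : (forall x, x ∈ a -> f x = g x) -> vimg a f = vimg a g.
Proof.
move=> fg; apply: V_ext => z; rewrite !mem_vimg.
by split=> -[x xa ->]; exists x; rewrite ?fg.
Qed.

Section Recursion.
Variables (ch : V -> V) (H : V -> V -> V).
Hypothesis ch_wf : well_founded (fun y x => y ∈ ch x).

(** The recursion is first performed in the universe, with [H] receiving the values on the children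
    as a set. What remains is to show that this function maps [M] to [M] and is definable there. *)
Definition vrec : V -> V :=
  Fix ch_wf (fun=> V) (fun x rec =>
    H x (mkset [set z | exists y (h : y ∈ ch x), z = ⟨y, rec y h⟩])).

Lemma vrec_eq x : vrec x = H x (vgraph (ch x) vrec).
Proof.
rewrite {1}/vrec Fix_eq -/vrec; last first.
  move=> w f g fg; congr (H _ (mkset _)); rewrite predeqE => z.
  by split=> -[y [h ->]]; exists y, h; rewrite fg.
rewrite /vgraph vimg.unlock; congr (H _ (mkset _)); rewrite predeqE => z.
by split=> [[y [h ->]]|[y h ->]]; [exists y|exists y, h].
Qed.

Variables (M : set V) (C : set (set V)).
Hypothesis hM : ctm_GBm M C.
Hypothesis dch : DefT M C (fun e => ch (e 0)).
Hypothesis dH : DefT M C (fun e => H (e 0) (e 1)).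

Lemma M_ch x : M x -> M (ch x).
Proof. by move=> Mx; apply: (dch.1 (fun=> x)). Qed.

Lemma M_H x f : M x -> M f -> M (H x f).
Proof. by move=> Mx Mf; apply: (dH.1 (fun i => if i is 0 then x else f)) => -[]. Qed.

(** Attempts at the recursion: sets of pairs closed under children, each value being computed from
    the values in the set. The condition mentions [ch] and [H] only, so it is definable before
    [vrec] is known to be. *)
Let approx (g : V) := forall z, z ∈ g ->
  z = ⟨vfst z, H (vfst z) (vimg (ch (vfst z)) (fun u => ⟨u, vapp g u⟩))⟩ /\
  forall u, u ∈ ch (vfst z) -> exists2 w, w ∈ g & vfst w = u.

(** Induction along the children compares an attempt directly with [vrec]; in particular any two
    attempts agree where both are defined. *)
Lemma approx_val g z : approx g -> z ∈ g -> z = ⟨vfst z, vrec (vfst z)⟩.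
Proof.
move=> ag; move Ex : (vfst z) => x; elim/(well_founded_ind ch_wf): x z Ex => x IH z Ex zg.
have [E chg] := ag z zg; rewrite {1}E Ex vrec_eq; congr ⟨_, H _ _⟩.
apply: eq_vimg => u ux; congr ⟨_, _⟩.
rewrite -Ex in ux; have [w wg wu] := chg u ux; rewrite Ex in ux.
apply: vappE => [y yg|]; last by rewrite -(IH u ux w).
by have := IH u ux _ (vfstE u y) yg => /opair_inj[].
Qed.

Lemma approxP g : approx g <-> forall z, z ∈ g ->
  z = ⟨vfst z, vrec (vfst z)⟩ /\ forall u, u ∈ ch (vfst z) -> ⟨u, vrec u⟩ ∈ g.
Proof.
split=> [ag z zg|h z zg].
  split=> [|u uz]; first exact: approx_val ag zg.
  have [_ /(_ u uz) [w wg wu]] := ag z zg.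
  by rewrite -wu -(approx_val ag wg).
have [E chg] := h z zg; split; last first.
  by move=> u uz; exists ⟨u, vrec u⟩; [apply: chg|rewrite vfstE].
rewrite {1}E vrec_eq; congr ⟨_, H _ _⟩; apply: eq_vimg => u uz; congr ⟨_, _⟩.
apply/esym/vappE; last exact: chg.
by move=> y /h []; rewrite vfstE => /opair_inj[].
Qed.

Lemma approx_ex x : M x -> exists g, [/\ M g, approx g & ⟨x, vrec x⟩ ∈ g].
Proof.
elim/(well_founded_ind ch_wf): x => x IH Mx.

have dapprox : Def M C (fun e => approx (e 0)).
  by rewrite /approx; df.
have CA : C [set g | M g /\ approx g] := Def_compr hM dapprox (fun=> Mx).
pose R := [set z | M z /\ approx (vsnd z) /\ exists2 w, w ∈ vsnd z & vfst w = vfst z].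
have CR : C R.
  apply: (@Def_compr _ _ hM (fun e => approx (vsnd (e 0)) /\
    exists2 w, w ∈ vsnd (e 0) & vfst w = vfst (e 0))) (fun=> Mx).
  by df; apply: (@Def_subst _ _ (fun _ g => approx g)); [|df].
have [|b Mb bP] := M_collect hM CR (M_ch Mx).
  move=> u ux; have Mu := M_trans hM (M_ch Mx) ux.
  have [g [Mg ag ug]] := IH u ux Mu; exists g; split; first exact: (M_opair hM).
  by rewrite vsndE; split=> //; exists ⟨u, vrec u⟩; rewrite ?vfstE.
(* Collection may add irrelevant sets to [b]. Only the attempts among them are united, and they are
   compatible because all are parts of [vrec]. *)
pose U := vunion (vsep b [set g | M g /\ approx g]).
have MU : M U by apply: (M_vunion hM); apply: (M_sep hM).
have UP : approx U.
  apply/approxP => z /mem_vunion [g /mem_vsep[gb [Mg ag]] zg].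
  move/approxP: (ag) => /(_ z zg) [E h]; split=> // u /h ug.
  by apply/mem_vunion; exists g => //; apply/mem_vsep.
have chU u : u ∈ ch x -> ⟨u, vrec u⟩ ∈ U.
  move=> ux; have [g gb [Mg [ag [w wg]]]] := bP u ux.
  rewrite !vsndE !vfstE in ag wg * => wu; have [_ Mg'] := M_opair_inv hM Mg.
  apply/mem_vunion; exists g; first by apply/mem_vsep.
  by rewrite -wu -(approx_val ag wg).
(* The graph of [vrec] on the children is recovered from the set [U], which puts the argument of
   [H], and hence its value, into [M]. *)
have Mv : M (vrec x).
  rewrite vrec_eq; apply: M_H => //.
  have -> : vgraph (ch x) vrec = vimg (ch x) (fun u => ⟨u, vapp U u⟩).
    apply: eq_vimg => u ux; congr ⟨_, _⟩; apply/esym/vappE; last exact: chU.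
    by move=> y /(approx_val UP); rewrite vfstE => /opair_inj[].
  have d : DefT M C (fun e => vimg (ch (e 0)) (fun u => ⟨u, vapp (e 1) u⟩)) by df.
  by apply: (d.1 (fun i => if i is 0 then x else U)) => -[].
have Mxv : M ⟨x, vrec x⟩ by apply: (M_opair hM).
exists (vcup U (upair ⟨x, vrec x⟩ ⟨x, vrec x⟩)); split.
- by apply/(M_vunion hM)/(M_upair hM) => //; apply: (M_upair hM).
- apply/approxP => z /mem_vcup [zU|/mem_upair xz].
    have [E h] := (approxP U).1 UP z zU; split=> // u uz.
    by apply/mem_vcup; left; apply: h.
  have -> : z = ⟨x, vrec x⟩ by case: xz.
  by rewrite vfstE; split=> // u ux; apply/mem_vcup; left; apply: chU.
- by apply/mem_vcup; right; apply/mem_upair; left.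
Qed.

(** The graph is definable because [y] is the value at [x] exactly when some attempt in [M] contains
    the pair of [x] and [y]. *)
Lemma DefT_vrec t : DefT M C t -> DefT M C (fun e => vrec (t e)).
Proof.
apply: DefT_comp; split=> [e Me|].
  have [g [Mg _ h]] := approx_ex (Me 0).
  by have [] := M_opair_inv hM (M_trans hM Mg h).
have : Def M C (fun e => exists g, M g /\ (approx g /\ ⟨e 1, e 0⟩ ∈ g)).
  by rewrite /approx; df.
apply: Def_ext => e Me; split=> [[g [Mg [ag]]]|->].
  by move/(approx_val ag); rewrite vfstE => /opair_inj[].
by have [g [Mg ag h]] := approx_ex (Me 1); exists g.
Qed.

End Recursion.

Opaque opair upair vcup nval check vrec.

Lemma vnat_lt m n : m < n -> vnat m ∈ vnat n.
Proof.
elim: n => // n IH; rewrite ltnS leq_eqVlt => /orP[/eqP->|/IH h]; apply/mem_vsucc.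
  by right.
by left.
Qed.

Lemma mem_irr x : ~ x ∈ x.
Proof. by elim/(well_founded_ind mem_wf): x => x IH xx; apply: (IH x). Qed.

Lemma vnat_inj m n : vnat m = vnat n -> m = n.
Proof.
move=> E; case: (ltngtP m n) => // /vnat_lt; rewrite E => /mem_irr //.
Qed.

Lemma vunion1 v : vunion (upair v v) = v.
Proof.
apply: V_ext => z; rewrite mem_vunion; split=> [[y /mem_upair[]->]|zv] //.
by exists v => //; apply/mem_upair; left.
Qed.

Lemma vdom_wf : well_founded (fun y x => y ∈ vdom x).
Proof. by apply: wf_incl name_rel_wf => y x /mem_vdom. Qed.

Definition vone : V := upair vempty vempty.

Lemma upair_neq0 x y : upair x y <> vempty.
Proof. by move=> E; apply: (@not_mem_vempty x); rewrite -E; apply/mem_upair; left. Qed.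

Lemma M_vnat M C n : ctm_GBm M C -> M (vnat n).
Proof.
move=> hM; elim: n => [|n IH]; first exact: M_empty hM.
have -> : vnat n.+1 = vcup (vnat n) (upair (vnat n) (vnat n)).
  apply: V_ext => z; rewrite mem_vcup mem_upair mem_vsucc.
  by split=> [[]|[|[]]]; by [left|right|right; left].
by apply/(M_vunion hM)/(M_upair hM) => //; apply: (M_upair hM).
Qed.

(** * The class of names *)

Section Names.
Variables (M : set V) (C : set (set V)).
Hypothesis hM : ctm_GBm M C.
Variable P : set V.
Hypothesis CP : C P.

(** Being a name is an inductive notion of the universe. Its characteristic function, with values
    [vone] and [vempty], arises by recursion along [vdom], which exhibits the names as a class. *)
Definition name_step (s f : V) : V :=
  if `[< forall z, z ∈ s ->
         [/\ z = ⟨vfst z, vsnd z⟩, P (vsnd z) & vapp f (vfst z) = vone] >]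
  then vone else vempty.

Lemma name_recP s : is_name P s <-> vrec name_step vdom_wf s = vone.
Proof.
have E x : vrec name_step vdom_wf x = vone <-> forall z, z ∈ x ->
    exists y p, [/\ z = ⟨y, p⟩, P p & vrec name_step vdom_wf y = vone].
  rewrite vrec_eq /name_step; case: asboolP => h; split=> //.
  - move=> _ z zx; have [E Pz z1] := h z zx.
    exists (vfst z), (vsnd z); split=> //; move: z1; rewrite vapp_graph //.
    by apply/mem_vdom; exists (vsnd z); rewrite -E.
  - by move=> /esym/upair_neq0.
  - move=> H; case: h => z zx; have [y [p [E Pp y1]]] := H z zx.
    rewrite E vfstE vsndE; split=> //; rewrite vapp_graph //.
    by apply/mem_vdom; exists p; rewrite -E.
split; first by elim=> {}s h h' IH; apply/E => z zs;
  have [y [p [Pp zE]]] := h z zs; exists y, p; split=> //; apply: (IH y p); rewrite -zE.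
elim/(well_founded_ind name_rel_wf): s => s IH /E h; constructor.
  by move=> z zs; have [y [p [-> Pp _]]] := h z zs; exists y, p.
move=> y p yps; have [y' [p' [/opair_inj[<- _] _ y1]]] := h _ yps.
by apply: IH => //; exists p.
Qed.

Lemma C_names : C (names M P).
Proof.
have d : DefT M C (fun e => vrec name_step vdom_wf (e 0)).
  apply: (DefT_vrec _ hM); [by df| |by df]; rewrite /name_step.
  have -> : (fun e : nat -> V => if `[< forall z, z ∈ e 0 ->
     [/\ z = ⟨vfst z, vsnd z⟩, P (vsnd z) & vapp (e 1) (vfst z) = vone] >]
     then vone else vempty) = fun e => if `[< forall z, z ∈ e 0 ->
     z = ⟨vfst z, vsnd z⟩ /\ P (vsnd z) /\ vapp (e 1) (vfst z) = vone >]
     then vone else vempty.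
    apply: funext => e; congr (if _ then _ else _); apply: asbool_equiv_eq.
    by split=> h z /h; [case|case=> ? []].
  by rewrite /vone; df.
have dP : Def M C (fun e => vrec name_step vdom_wf (e 0) = vone).
  by rewrite /vone; df.
have := Def_compr hM dP (fun=> M_empty hM).
congr C; rewrite predeqE => x; split=> [[Mx /name_recP]|[Mx /name_recP]] //.
Qed.

Lemma names_inv s z : names M P s -> z ∈ s ->
  exists y p, [/\ z = ⟨y, p⟩, names M P y & P p].
Proof.
move=> [Ms ns]; case: ns Ms => {}s h h' Ms zs; have [y [p [Pp zE]]] := h _ zs.
exists y, p; split; [exact: zE| |exact: Pp]; split; last by apply: (h' y p); rewrite -zE.
by have := M_trans hM Ms zs; rewrite zE => /(M_opair_inv hM)[].
Qed.

End Names.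

(** * The uniform forcing theorem from an algebra of truth values *)

Section ValueAlgebra.
Variables (M : set V) (C : set (set V)) (P le : set V) (one : V).
Hypothesis hM : ctm_GBm M C.
Hypothesis hP : class_forcing C P le one.

(* Elements v with [good v] are sets of M standing for truth values; [hold v G] is
   their truth in the extension by G, and [Fo] is the induced forcing relation. *)
Record value_algebra (lit neg conj : V -> V) (good : V -> Prop)
    (hold : V -> set V -> Prop) (Fo : set V) : Prop := {
  va_dlit : DefT M C (fun e => lit (e 0));
  va_dneg : DefT M C (fun e => neg (e 0));
  va_dconj : DefT M C (fun e => conj (e 0));
  va_good_lit : forall r, P r -> good (lit r);
  va_good_neg : forall v, good v -> good (neg v);
  va_good_conj : forall W, M W -> (forall v, v ∈ W -> good v) -> good (conj W);
  va_hold_lit : forall r G, generic C P le G -> P r -> hold (lit r) G <-> G r;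
  va_hold_neg : forall v G, generic C P le G -> good v ->
    hold (neg v) G <-> ~ hold v G;
  va_hold_conj : forall W G, generic C P le G -> M W ->
    (forall v, v ∈ W -> good v) ->
    hold (conj W) G <-> forall v, v ∈ W -> hold v G;
  va_class : C Fo;
  va_forced : forall v p, good v -> P p ->
    Fo ⟨p, v⟩ <-> forall G, generic C P le G -> G p -> hold v G;
  va_truth : forall v G, generic C P le G -> good v -> hold v G ->
    exists2 p, G p & Fo ⟨p, v⟩
}.

Variables (lit neg conj : V -> V) (good : V -> Prop) (hold : V -> set V -> Prop).
Variable Fo : set V.
Hypothesis va : value_algebra lit neg conj good hold Fo.

Let dlit := va_dlit va.
Let dneg := va_dneg va.
Let dconj := va_dconj va.
Let CP := cf_dom_class hP.

Definition vdisj (W : V) : V := neg (conj (vimg W neg)).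

Lemma dvdisj : DefT M C (fun e => vdisj (e 0)).
Proof. by rewrite /vdisj; df. Qed.

Lemma M_img f W : DefT M C (fun e => f (e 0)) -> M W -> M (vimg W f).
Proof.
move=> df MW; have d : DefT M C (fun e => vimg (e 0) f) by df.
exact: (d.1 (fun=> W)).
Qed.

Lemma good_vdisj W : M W -> (forall v, v ∈ W -> good v) -> good (vdisj W).
Proof.
move=> MW gW; apply/(va_good_neg va)/(va_good_conj va); first exact: M_img.
by move=> v /mem_vimg [w /gW gw ->]; apply: (va_good_neg va).
Qed.

Lemma hold_vdisj W G : generic C P le G -> M W -> (forall v, v ∈ W -> good v) ->
  hold (vdisj W) G <-> exists2 v, v ∈ W & hold v G.
Proof.
move=> gG MW gW; have gW' v : v ∈ vimg W neg -> good v.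
  by move=> /mem_vimg [w /gW gw ->]; apply: (va_good_neg va).
have MW' : M (vimg W neg) by apply: M_img.
rewrite (va_hold_neg va) ?(va_hold_conj va) //; last exact: (va_good_conj va).
split=> [/existsNP [v /not_implyP [/mem_vimg [w wW ->]]]|[v vW hv] h].
  by rewrite (va_hold_neg va gG (gW _ wW)) => /contrapT; exists w.
have vW' : neg v ∈ vimg W neg by apply/mem_vimg; exists v.
exact: (va_hold_neg va gG (gW _ vW)).1 (h _ vW') hv.
Qed.

Lemma good_conj2 v w : M (upair v w) -> good v -> good w -> good (conj (upair v w)).
Proof. by move=> Mvw gv gw; apply: (va_good_conj va) => // u /mem_upair[]->. Qed.

Lemma hold_conj2 v w G : generic C P le G -> M (upair v w) -> good v -> good w ->
  hold (conj (upair v w)) G <-> hold v G /\ hold w G.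
Proof.
move=> gG Mvw gv gw; rewrite (va_hold_conj va) //; last by move=> u /mem_upair[]->.
split=> [h|[hv hw] u /mem_upair[]->//].
by split; apply: h; apply/mem_upair; [left|right].
Qed.

Lemma good_disj2 v w : M (upair v w) -> good v -> good w -> good (vdisj (upair v w)).
Proof. by move=> Mvw gv gw; apply: good_vdisj => // u /mem_upair[]->. Qed.

Lemma hold_disj2 v w G : generic C P le G -> M (upair v w) -> good v -> good w ->
  hold (vdisj (upair v w)) G <-> hold v G \/ hold w G.
Proof.
move=> gG Mvw gv gw; rewrite hold_vdisj //; last by move=> u /mem_upair[]->.
split=> [[u /mem_upair[]->]|[]h]; [by left|by right| |].
- by exists v => //; apply/mem_upair; left.
- by exists w => //; apply/mem_upair; right.
Qed.

(* Truth value of: some <x, r> in t has r in G and f x true. *)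
Definition vsome (t : V) (f : V -> V) : V :=
  vdisj (vimg t (fun w => conj (upair (lit (vsnd w)) (f (vfst w))))).

(** The implication from [r in G] to the value of [f x] is a disjunction with the negated literal,
    so pairs whose condition lies outside the filter impose nothing. *)
Definition vevery (s : V) (f : V -> V) : V :=
  conj (vimg s (fun z => vdisj (upair (neg (lit (vsnd z))) (f (vfst z))))).

Lemma DefT_vsome t (f : (nat -> V) -> V -> V) :
  DefT M C t -> DefT M C (fun e => f (fun i => e i.+1) (e 0)) ->
  DefT M C (fun e => vsome (t e) (f e)).
Proof.
move=> dt hf; apply: (DefT_comp dvdisj); apply: (DefT_vimg hM dt).
apply: (DefT_comp dconj); apply: (DefT_upair hM); first by clear -hM dlit; df.
apply: (@DefT_subst _ _ (fun e x => f (fun i => e i.+1) x)); last by clear -hM; df.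
exact: (DefT_ren (fun i => if i is j.+1 then j.+2 else 0) hf).
Qed.

Lemma DefT_vevery t (f : (nat -> V) -> V -> V) :
  DefT M C t -> DefT M C (fun e => f (fun i => e i.+1) (e 0)) ->
  DefT M C (fun e => vevery (t e) (f e)).
Proof.
move=> dt hf; apply: (DefT_comp dconj); apply: (DefT_vimg hM dt).
apply: (DefT_comp dvdisj); apply: (DefT_upair hM); first by clear -hM dlit dneg; df.
apply: (@DefT_subst _ _ (fun e x => f (fun i => e i.+1) x)); last by clear -hM; df.
exact: (DefT_ren (fun i => if i is j.+1 then j.+2 else 0) hf).
Qed.

Lemma names_pair s t p : names M P s -> ⟨t, p⟩ ∈ s -> names M P t /\ P p.
Proof.
by move=> ns /(names_inv hM ns) [y [q [/opair_inj[-> ->] ny Pq]]]; split.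
Qed.

Lemma M_vfst x : M x -> M (vfst x).
Proof. by move=> Mx; apply: ((DefT_vfst hM (DefT_var M C 0)).1 (fun=> x)). Qed.

Lemma M_vsnd x : M x -> M (vsnd x).
Proof. by move=> Mx; apply: ((DefT_vsnd hM (DefT_var M C 0)).1 (fun=> x)). Qed.

Lemma M_app (f : V -> V) x : DefT M C (fun e => f (e 0)) -> M x -> M (f x).
Proof. by move=> hf Mx; apply: (hf.1 (fun=> x)). Qed.

Lemma M_lit p : P p -> M (lit p).
Proof. by move=> Pp; apply: M_app => //; apply: (C_sub hM CP). Qed.

Section Quantifiers.
Variables (s : V) (f : V -> V).
Hypothesis ns : names M P s.
Hypothesis hf : DefT M C (fun e => f (e 0)).
Hypothesis gf : forall t p, ⟨t, p⟩ ∈ s -> good (f t).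

Let elt z : z ∈ s -> exists t p,
  [/\ z = ⟨t, p⟩, ⟨t, p⟩ ∈ s, M (f t), P p & good (f t)].
Proof.
move=> zs; have [t [p [zE [Mt _] Pp]]] := names_inv hM ns zs.
have tps : ⟨t, p⟩ ∈ s by rewrite -zE.
exists t, p; split=> //; first exact: M_app.
exact: gf tps.
Qed.

Let M_some : M (vimg s (fun w => conj (upair (lit (vsnd w)) (f (vfst w))))).
Proof. by apply: M_img; [df|case: ns]. Qed.

Let M_every : M (vimg s (fun z => vdisj (upair (neg (lit (vsnd z))) (f (vfst z))))).
Proof. by apply: M_img; [have dd := dvdisj; df|case: ns]. Qed.

Lemma good_vsome : good (vsome s f).
Proof.
apply: good_vdisj => // v /mem_vimg [w /elt [t [p [-> _ Mf Pp gft]]] ->].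
have Ml := M_lit Pp; rewrite vfstE vsndE; apply: good_conj2 => //; first exact: (M_upair hM).
exact: (va_good_lit va).
Qed.

Lemma good_vevery : good (vevery s f).
Proof.
apply: (va_good_conj va) => // v /mem_vimg [w /elt [t [p [-> _ Mf Pp gft]]] ->].
have Ml := M_lit Pp; rewrite vfstE vsndE; apply: good_disj2 => //.
  by apply: (M_upair hM) => //; apply: M_app dneg _.
by apply/(va_good_neg va)/(va_good_lit va).
Qed.

Lemma hold_vsome G : generic C P le G ->
  hold (vsome s f) G <-> exists t p, [/\ ⟨t, p⟩ ∈ s, G p & hold (f t) G].
Proof.
move=> gG; rewrite hold_vdisj //; last first.
  move=> v /mem_vimg [w /elt [t [p [-> _ Mf Pp gft]]] ->].
  have Ml := M_lit Pp; rewrite vfstE vsndE; apply: good_conj2 => //; first exact: (M_upair hM).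
  exact: (va_good_lit va).
have E t p : M (f t) -> P p -> good (f t) ->
    hold (conj (upair (lit p) (f t))) G <-> G p /\ hold (f t) G.
  move=> Mf Pp gft; have Ml := M_lit Pp; rewrite hold_conj2 ?(va_hold_lit va) //.
    exact: (M_upair hM).
  exact: (va_good_lit va).
split=> [[v /mem_vimg [w /elt [t [p [-> h Mf Pp gft]]] ->]]|[t [p [h Gp ht]]]].
  by rewrite vfstE vsndE E // => -[Gp ht]; exists t, p.
exists (conj (upair (lit p) (f t))).
  by apply/mem_vimg; exists ⟨t, p⟩; rewrite ?vfstE ?vsndE.
by have [t' [p' [/opair_inj[<- <-] _ Mf Pp gft]]] := elt h; apply/E.
Qed.

Lemma hold_vevery G : generic C P le G ->
  hold (vevery s f) G <-> forall t p, ⟨t, p⟩ ∈ s -> G p -> hold (f t) G.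
Proof.
move=> gG; rewrite (va_hold_conj va) //; last first.
  move=> v /mem_vimg [w /elt [t [p [-> _ Mf Pp gft]]] ->].
  have Ml := M_lit Pp; rewrite vfstE vsndE; apply: good_disj2 => //.
    by apply: (M_upair hM) => //; apply: M_app dneg _.
  by apply/(va_good_neg va)/(va_good_lit va).
have E t p : M (f t) -> P p -> good (f t) ->
    hold (vdisj (upair (neg (lit p)) (f t))) G <-> (G p -> hold (f t) G).
  move=> Mf Pp gft; have Ml := M_lit Pp; have gl := va_good_lit va Pp.
  rewrite hold_disj2 ?(va_hold_neg va) ?(va_hold_lit va) //.
  - by split=> [[]//|h]; case: (EM (G p)) => Gp; [right; apply: h|left].
  - by apply: (M_upair hM) => //; apply: M_app dneg _.
  - exact: (va_good_neg va).
split=> [H t p h|H v /mem_vimg [w /elt [t [p [-> h Mf Pp gft]]] ->]].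
  have [t' [p' [/opair_inj[<- <-] _ Mf Pp gft]]] := elt h; apply/E => //.
  by apply: H; apply/mem_vimg; exists ⟨t, p⟩; rewrite ?vfstE ?vsndE.
by rewrite vfstE vsndE E //; apply: H.
Qed.

End Quantifiers.

(** * Truth values of equality and membership between names *)

Definition eq_children (x : V) : V :=
  vunion (vimg (vdom (vfst x)) (fun y => vimg (vdom (vsnd x)) (fun z => ⟨y, z⟩))).

Lemma mem_eq_children x y : y ∈ eq_children x <->
  exists s t, [/\ y = ⟨s, t⟩, name_rel s (vfst x) & name_rel t (vsnd x)].
Proof.
rewrite mem_vunion; split.
  by move=> [w /mem_vimg [s /mem_vdom ss ->] /mem_vimg [t /mem_vdom tt ->]]; exists s, t.
move=> [s [t [-> ss tt]]]; exists (vimg (vdom (vsnd x)) (fun z => ⟨s, z⟩)).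
  by apply/mem_vimg; exists s => //; apply/mem_vdom.
by apply/mem_vimg; exists t => //; apply/mem_vdom.
Qed.

Lemma eq_children_wf : well_founded (fun y x => y ∈ eq_children x).
Proof.
apply: (wf_incl _ _ (fun y x => name_rel (vfst y) (vfst x))); last first.
  exact: (wf_inverse_image _ _ _ vfst name_rel_wf).
by move=> y x /mem_eq_children [s [t [-> ? _]]]; rewrite vfstE.
Qed.

(** Extensionality: each element of one value has an equal in the other. In both halves the element
    of the first name is listed first, so the two halves consult the same recursive values. *)
Definition eq_step (x f : V) : V :=
  conj (upair
    (vevery (vfst x) (fun s => vsome (vsnd x) (fun t => vapp f ⟨s, t⟩)))
    (vevery (vsnd x) (fun t => vsome (vfst x) (fun s => vapp f ⟨s, t⟩)))).

Definition veq : V -> V := vrec eq_step eq_children_wf.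

Lemma DefT_veq : DefT M C (fun e => veq (e 0)).
Proof.
apply: (DefT_vrec _ hM); [by rewrite /eq_children; df| |by df].
apply: (DefT_comp dconj); apply: (DefT_upair hM).
  apply: (@DefT_vevery _ (fun e s => vsome (vsnd (e 0)) (fun t => vapp (e 1) ⟨s, t⟩))).
    by df.
  by apply: (@DefT_vsome _ (fun e t => vapp (e 2) ⟨e 0, t⟩)); df.
apply: (@DefT_vevery _ (fun e t => vsome (vfst (e 0)) (fun s => vapp (e 1) ⟨s, t⟩))).
  by df.
by apply: (@DefT_vsome _ (fun e s => vapp (e 2) ⟨s, e 0⟩)); df.
Qed.

Lemma eq_vsome s f g : names M P s ->
  (forall t p, ⟨t, p⟩ ∈ s -> f t = g t) -> vsome s f = vsome s g.
Proof.
move=> ns fg; congr vdisj; apply: eq_vimg => z zs.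
by have [t [p [zE _ _]]] := names_inv hM ns zs; rewrite zE vfstE (fg _ p) // -zE.
Qed.

Lemma eq_vevery s f g : names M P s ->
  (forall t p, ⟨t, p⟩ ∈ s -> f t = g t) -> vevery s f = vevery s g.
Proof.
move=> ns fg; congr conj; apply: eq_vimg => z zs.
by have [t [p [zE _ _]]] := names_inv hM ns zs; rewrite zE vfstE (fg _ p) // -zE.
Qed.

Lemma veqE s t : names M P s -> names M P t -> veq ⟨s, t⟩ =
  conj (upair (vevery s (fun y => vsome t (fun z => veq ⟨y, z⟩)))
              (vevery t (fun z => vsome s (fun y => veq ⟨y, z⟩)))).
Proof.
move=> ns nt; rewrite {1}/veq vrec_eq -/veq /eq_step vfstE vsndE.
have E y p z q : ⟨y, p⟩ ∈ s -> ⟨z, q⟩ ∈ t ->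
    vapp (vgraph (eq_children ⟨s, t⟩) veq) ⟨y, z⟩ = veq ⟨y, z⟩.
  move=> ys zt; apply: vapp_graph; apply/mem_eq_children; exists y, z.
  by rewrite vfstE vsndE; split=> //; [exists p|exists q].
pose R := vgraph (eq_children ⟨s, t⟩) veq.
have E1 : vevery s (fun y => vsome t (fun z => vapp R ⟨y, z⟩)) =
    vevery s (fun y => vsome t (fun z => veq ⟨y, z⟩)).
  apply: (eq_vevery ns) => y p yp; apply: (eq_vsome nt) => z q zq; exact: E yp zq.
have E2 : vevery t (fun z => vsome s (fun y => vapp R ⟨y, z⟩)) =
    vevery t (fun z => vsome s (fun y => veq ⟨y, z⟩)).
  apply: (eq_vevery nt) => z q zq; apply: (eq_vsome ns) => y p yp; exact: E yp zq.
by rewrite E1 E2.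
Qed.

Opaque veq.

(** The two halves of [veqE] turn into the two inclusions between the values of [s] and [t]. The
    induction runs over [s] with [t] arbitrary. *)
Lemma veq_spec s t : names M P s -> names M P t ->
  good (veq ⟨s, t⟩) /\
  forall G, generic C P le G -> hold (veq ⟨s, t⟩) G <-> nval G s = nval G t.
Proof.
have dveq := DefT_veq.
elim/(well_founded_ind name_rel_wf): s t => s IH t ns nt.
have [[Ms _] [Mt _]] := (ns, nt).
have IH' y p z q : ⟨y, p⟩ ∈ s -> ⟨z, q⟩ ∈ t -> good (veq ⟨y, z⟩) /\
    forall G, generic C P le G -> hold (veq ⟨y, z⟩) G <-> nval G y = nval G z.
  move=> yp zq; have [ny _] := names_pair ns yp; have [nz _] := names_pair nt zq.
  by apply: IH => //; exists p.
pose f1 y := vsome t (fun z => veq ⟨y, z⟩); pose f2 z := vsome s (fun y => veq ⟨y, z⟩).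
have d1 : DefT M C (fun e => f1 (e 0)).
  by apply: (@DefT_vsome _ (fun e z => veq ⟨e 0, z⟩)); df.
have d2 : DefT M C (fun e => f2 (e 0)).
  by apply: (@DefT_vsome _ (fun e y => veq ⟨y, e 0⟩)); df.
have d1' y : M y -> DefT M C (fun e => veq ⟨y, e 0⟩) by move=> My; df.
have d2' y : M y -> DefT M C (fun e => veq ⟨e 0, y⟩) by move=> My; df.
have g1 y p : ⟨y, p⟩ ∈ s -> good (f1 y).
  move=> yp; have [[My _] _] := names_pair ns yp.
  by apply: (good_vsome nt (d1' _ My)) => z q /(IH' _ _ _ _ yp)[].
have g2 z q : ⟨z, q⟩ ∈ t -> good (f2 z).
  move=> zq; have [[Mz _] _] := names_pair nt zq.
  by apply: (good_vsome ns (d2' _ Mz)) => y p yp; have [] := IH' _ _ _ _ yp zq.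
have de1 : DefT M C (fun=> vevery s f1).
  by apply: (@DefT_vevery _ (fun=> f1)); [df|exact: d1].
have de2 : DefT M C (fun=> vevery t f2).
  by apply: (@DefT_vevery _ (fun=> f2)); [df|exact: d2].
have Me1 := de1.1 _ (fun=> Ms); have Me2 := de2.1 _ (fun=> Ms).
have ge1 : good (vevery s f1) by apply: good_vevery ns d1 g1.
have ge2 : good (vevery t f2) by apply: good_vevery nt d2 g2.
have Mee := M_upair hM Me1 Me2.
have -> : veq ⟨s, t⟩ = conj (upair (vevery s f1) (vevery t f2)) by exact: veqE.
split=> [|G gG]; first exact: (good_conj2 Mee ge1 ge2).
have HC := hold_conj2 gG Mee ge1 ge2.
have H1E := hold_vevery ns d1 g1 gG; have H2E := hold_vevery nt d2 g2 gG.
have h1 y p : ⟨y, p⟩ ∈ s -> hold (f1 y) G <-> nval G y ∈ nval G t.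
  move=> yp; have [[My _] _] := names_pair ns yp.
  have gy z q : ⟨z, q⟩ ∈ t -> good (veq ⟨y, z⟩) by move=> /(IH' _ _ _ _ yp)[].
  rewrite (hold_vsome nt (d1' _ My) gy gG) mem_val; split=> -[z [q [zq Gq e]]]; exists z, q; split=> //;
    exact/((IH' _ _ _ _ yp zq).2 _ gG).
have h2 z q : ⟨z, q⟩ ∈ t -> hold (f2 z) G <-> nval G z ∈ nval G s.
  move=> zq; have [[Mz _] _] := names_pair nt zq.
  have gz y p : ⟨y, p⟩ ∈ s -> good (veq ⟨y, z⟩).
    by move=> yp; have [] := IH' _ _ _ _ yp zq.
  rewrite (hold_vsome ns (d2' _ Mz) gz gG) mem_val; split=> -[y [p [yp Gp e]]]; exists y, p; split=> //.
    exact/esym/((IH' _ _ _ _ yp zq).2 _ gG).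
  by apply/((IH' _ _ _ _ yp zq).2 _ gG).
split=> [/HC [/H1E H1 /H2E H2]|E].
  apply: V_ext => x; split=> /mem_val [y [p [yp Gp ->]]].
    exact/(h1 _ _ yp)/(H1 _ _ yp).
  exact/(h2 _ _ yp)/(H2 _ _ yp).
apply/HC; split; [apply/H1E|apply/H2E] => y p yp Gp;
  [apply/(h1 _ _ yp)|apply/(h2 _ _ yp)].
  by rewrite -E; apply/mem_val; exists y, p.
by rewrite E; apply/mem_val; exists y, p.
Qed.

Definition vmem (s t : V) : V := vsome t (fun z => veq ⟨s, z⟩).

Lemma DefT_vmem : DefT M C (fun e => vmem (e 0) (e 1)).
Proof.
have dveq := DefT_veq.
by apply: (@DefT_vsome _ (fun e z => veq ⟨e 0, z⟩)); df.
Qed.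

Lemma vmem_spec s t : names M P s -> names M P t ->
  good (vmem s t) /\
  forall G, generic C P le G -> hold (vmem s t) G <-> nval G s ∈ nval G t.
Proof.
move=> ns nt; have dveq := DefT_veq; have [Ms _] := ns.
have d : DefT M C (fun e => veq ⟨s, e 0⟩) by df.
have g z q : ⟨z, q⟩ ∈ t -> good (veq ⟨s, z⟩).
  by move=> /(names_pair nt)[nz _]; have [] := veq_spec ns nz.
split=> [|G gG]; first exact: good_vsome nt d g.
rewrite (hold_vsome nt d g gG) mem_val; split=> -[z [q [zq Gq e]]]; exists z, q; split=> //;
  have [nz _] := names_pair nt zq; exact/((veq_spec ns nz).2 _ gG).
Qed.

(** * Evaluation of check names and of codes of infinitary formulas *)

Lemma generic_one G : generic C P le G -> G one.
Proof.
move=> [fG _]; have [g Gg] := filter_nonempty fG.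
by apply: (filter_up fG Gg); [exact: cf_one hP|apply: (cf_top hP); apply: (filter_sub fG)].
Qed.

Lemma nval_check G x : generic C P le G -> nval G (check one x) = x.
Proof.
move=> /generic_one G1; elim/(well_founded_ind mem_wf): x => x IH.
apply: V_ext => z; rewrite mem_val; split.
  by move=> [t [p [/mem_check [y yx /opair_inj[-> _]] _ ->]]]; rewrite IH.
move=> zx; exists (check one z), one; split=> //; last by rewrite IH.
by apply/mem_check; exists z.
Qed.

(** The code under a negation lies in the union of the whole code. In ⟨k, ⟨J, f⟩⟩ the set [f] is
    reached after three unions, its pairs after four and their second components after six. The
    other sets collected here also lie in the transitive closure, so well-foundedness is
    preserved. *)
Definition code_children (c : V) : V :=
  vcup (vunion c) (vunion (vunion (vunion (vunion (vunion (vunion c)))))).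

Lemma code_children_wf : well_founded (fun y x => y ∈ code_children x).
Proof.
apply: (wf_incl _ _ (clos_trans V mem)); last exact: wf_clos_trans mem_wf.
have tr x y z : clos_trans V mem y x -> z ∈ y -> clos_trans V mem z x.
  by move=> yx zy; apply: t_trans yx; apply: t_step.
move=> y x /mem_vcup [/mem_vunion [w wx]|].
  by apply: tr; apply: t_step.
move=> /mem_vunion [w6 /mem_vunion [w5 /mem_vunion [w4 /mem_vunion [w3 /mem_vunion [w2
  /mem_vunion [w1 h1 h2] h3] h4] h5] h6] h7].
by apply: (tr _ _ _ _ h7); apply: (tr _ _ _ _ h6); apply: (tr _ _ _ _ h5); apply: (tr _ _ _ _ h4);
   apply: (tr _ _ _ _ h3); apply: (tr _ _ _ _ h2); apply: t_step.
Qed.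

(** Intrinsic description of the sets produced by [family], namely functions with domain exactly
    [J]; it makes codes of infinitary formulas recognizable inside [M]. *)
Definition is_family (J f : V) : Prop :=
  (forall z, z ∈ f -> z = ⟨vfst z, vsnd z⟩ /\ vfst z ∈ J) /\
  (forall i, i ∈ J -> exists2 z, z ∈ f & vfst z = i) /\
  (forall z, z ∈ f -> forall w, w ∈ f -> vfst z = vfst w -> z = w).

Definition some (v : V) : V := upair v v.

(* The recursion assigns [some v] to a code of a formula with value v, and
   [vempty] to any other set. *)
Definition code_step (c f : V) : V :=
  let a := vfst (vsnd c) in let b := vsnd (vsnd c) in
  let vals := vimg b (fun z => vunion (vapp f (vsnd z))) in
  if `[< c = ⟨vnat 0, vsnd c⟩ /\ P (vsnd c) >] then some (lit (vsnd c))
  else if `[< c = ⟨vnat 1, a, b⟩ /\ names M P a /\ names M P b >] then some (veq ⟨a, b⟩)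
  else if `[< c = ⟨vnat 2, a, b⟩ /\ names M P a /\ names M P b >] then some (vmem a b)
  else if `[< c = ⟨vnat 3, vsnd c⟩ /\ ~ vapp f (vsnd c) = vempty >]
       then some (neg (vunion (vapp f (vsnd c))))
  else if `[< c = ⟨vnat 4, a, b⟩ /\ is_family a b /\
              forall z, z ∈ b -> ~ vapp f (vsnd z) = vempty >] then some (vdisj vals)
  else if `[< c = ⟨vnat 5, a, b⟩ /\ is_family a b /\
              forall z, z ∈ b -> ~ vapp f (vsnd z) = vempty >] then some (conj vals)
  else vempty.

Definition vcode : V -> V := vrec code_step code_children_wf.

Lemma DefT_vcode : DefT M C (fun e => vcode (e 0)).
Proof.
have CN := C_names hM CP; have dveq := DefT_veq; have dvmem := DefT_vmem.
have dd := dvdisj.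
have M0 := M_vnat 0 hM; have M1 := M_vnat 1 hM; have M2 := M_vnat 2 hM.
have M3 := M_vnat 3 hM; have M4 := M_vnat 4 hM; have M5 := M_vnat 5 hM.
apply: (DefT_vrec _ hM); [by rewrite /code_children; df| |by df].
by rewrite /code_step /some /is_family; df.
Qed.

Lemma mem_code_children1 k d : d ∈ code_children ⟨k, d⟩.
Proof. by apply/mem_vcup; left; apply: mem_opair_union. Qed.

Lemma mem_code_children2 k J f i d : ⟨i, d⟩ ∈ f -> d ∈ code_children ⟨k, J, f⟩.
Proof.
move=> h; apply/mem_vcup; right.
suff /mem_vunion2_opair[] : ⟨i, d⟩ ∈ vunion (vunion (vunion (vunion ⟨k, J, f⟩))) by [].
apply/mem_vunion; exists f => //.
exact: (mem_vunion2_opair (mem_opair_union _ _)).2.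
Qed.

Lemma vcodeE c : vcode c = code_step c (vgraph (code_children c) vcode).
Proof. by rewrite {1}/vcode vrec_eq. Qed.

Let vapp_code c d : d ∈ code_children c ->
  vapp (vgraph (code_children c) vcode) d = vcode d.
Proof. exact: vapp_graph. Qed.

Local Ltac tag_cases :=
  do ! (case: asboolP;
    first (by let E := fresh in move=> [/opair_inj[/vnat_inj E _]]; discriminate E); move=> _).

Lemma vcode_gen p : P p -> vcode ⟨vnat 0, p⟩ = some (lit p).
Proof.
move=> Pp; rewrite vcodeE /code_step vsndE; case: asboolP => // -[].
by split.
Qed.

Lemma vcode_eq s t : names M P s -> names M P t ->
  vcode ⟨vnat 1, s, t⟩ = some (veq ⟨s, t⟩).
Proof.
move=> ns nt; rewrite vcodeE /code_step !vsndE !vfstE; tag_cases.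
by case: asboolP => // -[].
Qed.

Lemma vcode_mem s t : names M P s -> names M P t ->
  vcode ⟨vnat 2, s, t⟩ = some (vmem s t).
Proof.
move=> ns nt; rewrite vcodeE /code_step !vsndE !vfstE; tag_cases.
by case: asboolP => // -[].
Qed.

Lemma vcode_not d : vcode d <> vempty ->
  vcode ⟨vnat 3, d⟩ = some (neg (vunion (vcode d))).
Proof.
move=> h; rewrite vcodeE /code_step !vsndE vapp_code; last exact: mem_code_children1.
tag_cases.
by case: asboolP => // -[].
Qed.

(** The union removes the wrapper [some] from each value. *)
Definition family_vals (f : V) : V := vimg f (fun z => vunion (vcode (vsnd z))).

Let family_app k J f z : is_family J f -> z ∈ f ->
  vapp (vgraph (code_children ⟨k, J, f⟩) vcode) (vsnd z) = vcode (vsnd z).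
Proof.
move=> [h _] zf; apply: vapp_code; apply: (@mem_code_children2 _ _ _ (vfst z)).
by rewrite -(h z zf).1.
Qed.

Let family_appE k J f : is_family J f ->
  vimg f (fun z => vunion (vapp (vgraph (code_children ⟨k, J, f⟩) vcode) (vsnd z)))
  = family_vals f.
Proof. by move=> Jf; apply: eq_vimg => z zf; rewrite family_app. Qed.

Lemma vcode_or J f : is_family J f -> (forall z, z ∈ f -> vcode (vsnd z) <> vempty) ->
  vcode ⟨vnat 4, J, f⟩ = some (vdisj (family_vals f)).
Proof.
move=> Jf h; rewrite vcodeE /code_step !vsndE !vfstE family_appE //; tag_cases.
case: asboolP => // -[]; split=> //; split=> // z zf.
by rewrite family_app //; apply: h.
Qed.

Lemma vcode_and J f : is_family J f -> (forall z, z ∈ f -> vcode (vsnd z) <> vempty) ->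
  vcode ⟨vnat 5, J, f⟩ = some (conj (family_vals f)).
Proof.
move=> Jf h; rewrite vcodeE /code_step !vsndE !vfstE family_appE //; tag_cases.
case: asboolP => // -[]; split=> //; split=> // z zf.
by rewrite family_app //; apply: h.
Qed.

Lemma vcode_inv c : vcode c <> vempty ->
  (exists2 p, P p & c = ⟨vnat 0, p⟩) \/
  (exists s t, [/\ names M P s, names M P t & c = ⟨vnat 1, s, t⟩]) \/
  (exists s t, [/\ names M P s, names M P t & c = ⟨vnat 2, s, t⟩]) \/
  (exists2 d, vcode d <> vempty & c = ⟨vnat 3, d⟩) \/
  (exists k J f, [/\ k = vnat 4 \/ k = vnat 5, c = ⟨k, J, f⟩, is_family J f &
    forall z, z ∈ f -> vcode (vsnd z) <> vempty]).
Proof.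
rewrite vcodeE /code_step.
case: asboolP => [[cE Pp] _|_]; first by left; exists (vsnd c).
case: asboolP => [[cE [ns nt]] _|_].
  by right; left; exists (vfst (vsnd c)), (vsnd (vsnd c)); split.
case: asboolP => [[cE [ns nt]] _|_].
  by do 2 right; left; exists (vfst (vsnd c)), (vsnd (vsnd c)); split.
case: asboolP => [[cE h] _|_].
  do 3 right; left; exists (vsnd c) => // e; apply: h; rewrite vapp_code //.
  by rewrite cE vsndE; apply: mem_code_children1.
have fam k : c = ⟨k, vfst (vsnd c), vsnd (vsnd c)⟩ ->
    is_family (vfst (vsnd c)) (vsnd (vsnd c)) ->
    (forall z, z ∈ vsnd (vsnd c) ->
      vapp (vgraph (code_children c) vcode) (vsnd z) <> vempty) ->
    forall z, z ∈ vsnd (vsnd c) -> vcode (vsnd z) <> vempty.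
  by move=> cE Jf h z zf; have := h z zf; rewrite {1}cE family_app.
case: asboolP => [[cE [Jf h]] _|_].
  do 4 right; exists (vnat 4), (vfst (vsnd c)), (vsnd (vsnd c)); split=> //; first by left.
  exact: fam cE Jf h.
case: asboolP => [[cE [Jf h]] _|_ //].
do 4 right; exists (vnat 5), (vfst (vsnd c)), (vsnd (vsnd c)); split=> //; first by right.
exact: fam cE Jf h.
Qed.

Lemma family_is_family J (c : {i : V | i ∈ J} -> V) : is_family J (family c).
Proof.
split=> [z /mem_family [i ->]|].
  by rewrite vfstE vsndE; split=> //; case: i.
split=> [i iJ|z /mem_family [i ->] w /mem_family [j ->]].
  exists ⟨i, c (exist _ i iJ)⟩; rewrite ?vfstE //.
  by apply/mem_family; exists (exist _ i iJ).
rewrite !vfstE; case: i j => [i hi] [j hj] /= ij; subst j.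
by rewrite (Prop_irrelevance hi hj).
Qed.

Lemma some_neq0 v : some v <> vempty.
Proof. exact: upair_neq0. Qed.

Lemma vunion_some v : vunion (some v) = v.
Proof. exact: vunion1. Qed.

Lemma M_family_vals f : M f -> M (family_vals f).
Proof. by move=> Mf; apply: M_img Mf; have := DefT_vcode => dv; df. Qed.

(** One value serves all generic filters at once. In the infinitary cases the values of the
    subformulas are chosen outside [M], but together they form the set [family_vals], which lies in
    [M] by definability of [vcode]. *)
Lemma vcode_spec phi : wf_ifml M P phi -> exists v,
  [/\ vcode (code phi) = some v, good v &
      forall G, generic C P le G -> hold v G <-> isat one G phi].
Proof.
have fam J (phi' : {i : V | i ∈ J} -> ifml) :
    (forall i, exists v, [/\ vcode (code (phi' i)) = some v, good v &
      forall G, generic C P le G -> hold v G <-> isat one G (phi' i)]) ->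
    let f := family (fun i => code (phi' i)) in M f ->
    [/\ is_family J f, forall z, z ∈ f -> vcode (vsnd z) <> vempty,
      forall v, v ∈ family_vals f -> good v &
      forall G, generic C P le G ->
        ((exists2 v, v ∈ family_vals f & hold v G) <-> exists i, isat one G (phi' i)) /\
        ((forall v, v ∈ family_vals f -> hold v G) <-> forall i, isat one G (phi' i))].
  move=> /choice [v vP] f Mf.
  have mv w : w ∈ family_vals f <-> exists i, w = v i.
    rewrite mem_vimg; split=> [[z /mem_family [i ->] ->]|[i ->]]; first exists i.
      by have [E _ _] := vP i; rewrite vsndE E vunion_some.
    exists ⟨sval i, code (phi' i)⟩; first by apply/mem_family; exists i.
    by have [E _ _] := vP i; rewrite vsndE E vunion_some.
  split.
  - exact: family_is_family.
  - move=> z /mem_family [i ->]; have [E _ _] := vP i; rewrite vsndE E.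
    exact: some_neq0.
  - by move=> w /mv [i ->]; have [] := vP i.
  move=> G gG; split; split.
  - by move=> [w /mv [i ->]]; have [_ _ H] := vP i; move/(H _ gG); exists i.
  - move=> [i hi]; exists (v i); first by apply/mv; exists i.
    by have [_ _ H] := vP i; apply/(H _ gG).
  - move=> h i; have [_ _ H] := vP i; apply/(H _ gG); apply: h.
    by apply/mv; exists i.
  - by move=> h w /mv [i ->]; have [_ _ H] := vP i; apply/(H _ gG).
elim: phi => [p|s t|s t|phi IH|J phi' IH|J phi' IH] /=.
- move=> Pp; exists (lit p); split; [exact: vcode_gen|exact: (va_good_lit va)|].
  by move=> G gG; rewrite (nval_check _ gG); apply: (va_hold_lit va).
- by move=> [ns nt]; exists (veq ⟨s, t⟩); have [] := veq_spec ns nt; split=> //;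
    apply: vcode_eq.
- by move=> [ns nt]; exists (vmem s t); have [] := vmem_spec ns nt; split=> //;
    apply: vcode_mem.
- move=> /IH [v [vE gv hv]]; exists (neg v); split.
  + by rewrite vcode_not vE ?vunion_some //; apply: some_neq0.
  + exact: (va_good_neg va).
  + by move=> G gG; rewrite -hv //; apply: (va_hold_neg va).
- move=> [MJ Mf wf]; have [i|Jf nz gf hf] := fam J phi' _ Mf; first exact: IH.
  have MW := M_family_vals Mf.
  exists (vdisj (family_vals (family (fun i => code (phi' i))))); split.
  + exact: vcode_or.
  + exact: good_vdisj.
  + by move=> G gG; rewrite (hold_vdisj gG MW gf); case: (hf G gG).
- move=> [MJ Mf wf]; have [i|Jf nz gf hf] := fam J phi' _ Mf; first exact: IH.
  have MW := M_family_vals Mf.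
  exists (conj (family_vals (family (fun i => code (phi' i))))); split.
  + exact: vcode_and.
  + exact: (va_good_conj va).
  + by move=> G gG; rewrite (va_hold_conj va gG MW gf); case: (hf G gG).
Qed.

Lemma M_code phi : wf_ifml M P phi -> M (code phi).
Proof.
have Mt n x : M x -> M ⟨vnat n, x⟩ by apply: (M_opair hM); apply: M_vnat hM.
elim: phi => [p|s t|s t|phi IH|J phi' IH|J phi' IH].
- by move=> /(C_sub hM CP); apply: (Mt 0).
- by move=> [[Ms _] [Mt' _]]; apply: (Mt 1); apply: (M_opair hM).
- by move=> [[Ms _] [Mt' _]]; apply: (Mt 2); apply: (M_opair hM).
- by move=> /IH; apply: (Mt 3).
- by move=> [MJ Mf _]; apply: (Mt 4); apply: (M_opair hM).
- by move=> [MJ Mf _]; apply: (Mt 5); apply: (M_opair hM).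
Qed.

(** With [vcode_spec] this identifies the codes with the sets of [M] that have a nonempty value, so
    formulas defined outside the model have a class of codes. Choosing the subformulas outside [M]
    is harmless, since the family of their codes is the given set [f]. *)
Lemma vcode_surj c : M c -> vcode c <> vempty -> exists2 phi, wf_ifml M P phi & code phi = c.
Proof.
elim/(well_founded_ind code_children_wf): c => c IH Mc.
case/vcode_inv=> [[p Pp ->]|[[s [t [ns nt ->]]]|[[s [t [ns nt ->]]]|[[d d0 cE]|]]]].
- by exists (iGen p).
- by exists (iEq s t).
- by exists (iMem s t).
- have dc : d ∈ code_children c by rewrite cE; apply: mem_code_children1.
  have Md : M d by move: Mc; rewrite cE => /(M_opair_inv hM)[].
  by have [phi wphi phid] := IH d dc Md d0; exists (iNot phi) => //=; rewrite phid -cE.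
move=> [k [J [f [k45 cE [f1 [f2 f3]] nz]]]].
have [MJ Mf] : M J /\ M f by move: Mc; rewrite cE => /(M_opair_inv hM)[_ /(M_opair_inv hM)].
have /choice [phi phiP] (i : {i : V | i ∈ J}) : exists phi,
    wf_ifml M P phi /\ ⟨sval i, code phi⟩ ∈ f.
  have [z zf zi] := f2 _ (svalP i); have [zE _] := f1 z zf.
  have zE' : ⟨sval i, vsnd z⟩ ∈ f by rewrite -zi -zE.
  have dc : vsnd z ∈ code_children c.
    by rewrite cE; apply: (@mem_code_children2 _ _ _ (sval i)).
  have Md : M (vsnd z) by apply/M_vsnd/(M_trans hM Mf zf).
  by have [phi wphi phid] := IH _ dc Md (nz z zf); exists phi; rewrite phid.
have fE : family (fun i => code (phi i)) = f.
  apply: V_ext => z; rewrite mem_family; split=> [[i ->]|zf]; first by case: (phiP i).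
  have [zE zJ] := f1 z zf; pose i : {i : V | i ∈ J} := exist (fun i => i ∈ J) _ zJ.
  by exists i; apply: f3; [exact: zf|case: (phiP i)|rewrite vfstE].
by case: k45 => kE; [exists (iOr phi)|exists (iAnd phi)]; rewrite /= ?fE ?cE ?kE //;
  split=> // i; case: (phiP i).
Qed.

Theorem value_algebra_uniform_forcing : uniform_forcing_theorem M C P le one.
Proof.
have forced phi p v : P p -> vcode (code phi) = some v -> good v ->
    (forall G, generic C P le G -> hold v G <-> isat one G phi) ->
    Fo ⟨p, v⟩ <-> iforces C P le one phi p.
  move=> Pp vE gv hv; rewrite (va_forced va) //; split=> h G gG Gp; apply/hv => //; exact: h.
split; last first.
  move=> phi G wphi gG; have [v [vE gv hv]] := vcode_spec wphi.
  move/(hv _ gG)/(va_truth va gG gv) => [p Gp Fp]; exists p => //.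
  exact: (forced _ _ _ (filter_sub gG.1 Gp) vE gv hv).1 Fp.
have dv := DefT_vcode; have CFo := va_class va.
(* Nonemptiness of the value recognizes codes, and the union extracts the truth value that [Fo] is
   applied to. *)
have d : Def M C (fun e => e 0 = ⟨vfst (e 0), vsnd (e 0)⟩ /\ P (vfst (e 0)) /\
    ~ vcode (vsnd (e 0)) = vempty /\ Fo ⟨vfst (e 0), vunion (vcode (vsnd (e 0)))⟩).
  by df.
have := Def_compr hM d (fun=> M_empty hM); congr C; rewrite predeqE => z; split.
  move=> [Mz [zE [Pz [nz Fz]]]].
  have Mc : M (vsnd z) by apply: M_vsnd.
  have [phi wphi phiE] := vcode_surj Mc nz.
  have [v [vE gv hv]] := vcode_spec wphi.
  exists (vfst z), phi; rewrite phiE; split=> //.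
  by apply: (forced _ _ _ Pz vE gv hv).1; move: Fz; rewrite -phiE vE vunion_some.
move=> [p [phi [Pp wphi -> fp]]]; have [v [vE gv hv]] := vcode_spec wphi.
have Mc := M_code wphi; have Mp := C_sub hM CP Pp.
split; first exact: (M_opair hM).
rewrite /= vfstE vsndE vE vunion_some; split=> //; split=> //; split.
  exact: some_neq0.
exact: (forced _ _ _ Pp vE gv hv).2 fp.
Qed.

End ValueAlgebra.

(** * Generic filters *)

Section Generic.
Variables (M : set V) (C : set (set V)) (P le : set V) (one : V).
Hypothesis hM : ctm_GBm M C.
Hypothesis hP : class_forcing C P le one.

Lemma le_dom p q : le ⟨p, q⟩ -> P p /\ P q.
Proof. by move=> /(cf_le_rel hP) [p' [q' [Pp Pq /opair_inj[-> ->]]]]. Qed.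

(** Countability of [C] gives an injection [f] into the natural numbers. A descending sequence
    enters at stage [n] the dense class of index [n], and the filter consists of the conditions
    above some member of the sequence. *)
Lemma generic_exists p : P p -> exists2 G, generic C P le G & G p.
Proof.
move=> Pp; have /countable_injP [f f_inj] := ctm_countable_classes hM.
(* The pair is a stage and a current condition. The condition is kept when no dense class has this
   index; otherwise that class is unique by injectivity of [f]. *)
have /choice [s sP] (nx : nat * V) : exists r, P nx.2 ->
    [/\ P r, le ⟨r, nx.2⟩ & forall D, C D -> dense P le D -> f D = nx.1 -> D r].
  case: nx => n x /=; case: (EM (P x)) => [Px|]; last by exists x.
  case: (EM (exists D, [/\ C D, dense P le D & f D = n])) => [[D [CD dD fD]]|nD].
    have [r Dr rx] := dD.2 x Px; exists r => _; split=> //; first exact: dD.1.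
    move=> D' CD' _ fD'; suff -> : D' = D by [].
    by apply: f_inj; rewrite ?inE // fD'.
  exists x => _; split=> //; first exact: (cf_refl hP).
  by move=> D CD dD fD; case: nD; exists D.
pose q := fix q n := if n is m.+1 then s (m, q m) else p.
have Pq n : P (q n) by elim: n => //= n /(sP (n, _)) [].
have qS n : le ⟨q n.+1, q n⟩ by have [] := sP (n, q n) (Pq n).
have qle m n : m <= n -> le ⟨q n, q m⟩.
  elim: n => [|n IH]; first by rewrite leqn0 => /eqP->; apply: (cf_refl hP).
  rewrite leq_eqVlt => /orP[/eqP->|/IH h]; first exact: (cf_refl hP).
  exact: cf_trans hP _ _ _ (qS n) h.
exists [set x | exists n, le ⟨q n, x⟩]; last by exists 0; apply: (cf_refl hP).
split=> [|D CD dD]; last first.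
  exists (q (f D).+1); split; first by exists (f D).+1; apply: (cf_refl hP).
  by have [_ _] := sP (f D, q (f D)) (Pq _); apply.
split.
- by move=> x [n /le_dom[]].
- by exists p; exists 0; apply: (cf_refl hP).
- by move=> x y [n xn] _ xy; exists n; apply: cf_trans hP _ _ _ xn xy.
- move=> x y [m xm] [n yn]; exists (q (maxn m n)); split.
  + by exists (maxn m n); apply: (cf_refl hP).
  + by apply: cf_trans hP _ _ _ _ xm; apply/qle/leq_maxl.
  + by apply: cf_trans hP _ _ _ _ yn; apply/qle/leq_maxr.
Qed.

Lemma generic_up G p q : generic C P le G -> G p -> le ⟨p, q⟩ -> G q.
Proof. by move=> [fG _] Gp pq; apply: (filter_up fG Gp (le_dom pq).2 pq). Qed.

(** The conditions below [p] or incompatible with [p] form a dense class, and a filter omitting [p]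
    can only meet it in an incompatible condition. *)
Lemma generic_decides G p : generic C P le G -> P p -> ~ G p ->
  exists2 q, G q & ~ compatible P le q p.
Proof.
move=> gG Pp nGp; have CP := cf_dom_class hP; have Cle := cf_le_class hP.
have Mp := C_sub hM CP Pp.
have d : Def M C (fun e => P (e 0) /\ (le ⟨e 0, p⟩ \/
    ~ exists r, P r /\ (le ⟨r, e 0⟩ /\ le ⟨r, p⟩))).
  df; apply: Def_exb; first by move=> e x _ [] /(C_sub hM CP).
  by df.
have CD := Def_compr hM d (fun=> Mp).
have [|q [Gq [_ [Pq [qp|nc]]]]] := gG.2 _ CD.
- split=> [q [_ [Pq _]]//|q Pq].
  case: (EM (exists r, P r /\ (le ⟨r, q⟩ /\ le ⟨r, p⟩))) => [[r [Pr [rq rp]]]|nc].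
    exists r => //; split; first exact: (C_sub hM CP Pr).
    by split=> //; left.
  exists q; last exact: (cf_refl hP).
  by split; [exact: (C_sub hM CP Pq)|split=> //; right].
- by case: nGp; apply: generic_up gG Gq qp.
by exists q => // -[r [Pr rq rp]]; apply: nc; exists r.
Qed.

Lemma incompatible_generic G p q : generic C P le G -> G p ->
  ~ compatible P le p q -> ~ G q.
Proof.
move=> [fG _] Gp npq Gq; have [r [Gr rp rq]] := filter_dir fG Gp Gq.
by apply: npq; exists r; split=> //; apply: (filter_sub fG).
Qed.

End Generic.

(** * Equations between names as truth values *)

Section NameAlgebra.
Variables (M : set V) (C : set (set V)) (P le : set V) (one : V).
Hypothesis hM : ctm_GBm M C.
Hypothesis hP : class_forcing C P le one.

Let CP := cf_dom_class hP.
Let M1 : M one := C_sub hM CP (cf_one hP).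

Lemma name_intro s : M s ->
  (forall z, z ∈ s -> exists t p, [/\ z = ⟨t, p⟩, names M P t & P p]) -> names M P s.
Proof.
move=> Ms h; split; [exact: Ms|constructor] => [z /h [t [p [-> _ Pp]]]|t p /h].
  by exists t, p; split; [exact: Pp|].
by move=> [t' [p' [/opair_inj[-> _] [_ nt] _]]]; exact: nt.
Qed.

Lemma name_empty : names M P vempty.
Proof. by apply: (name_intro (M_empty hM)) => z /not_mem_vempty. Qed.

Lemma nval_empty G : nval G vempty = vempty.
Proof.
by apply: V_ext => z; split=> [/mem_val [t [p [/not_mem_vempty]]]|/not_mem_vempty].
Qed.

Lemma name_cup s t : names M P s -> names M P t -> names M P (vcup s t).
Proof.
move=> ns nt; apply: name_intro => [|z /mem_vcup[]]; last 2 first.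
- exact: (names_inv hM ns).
- exact: (names_inv hM nt).
by apply: (M_vunion hM); apply: (M_upair hM); [case: ns|case: nt].
Qed.

Lemma nval_cup G s t : nval G (vcup s t) = vcup (nval G s) (nval G t).
Proof.
apply: V_ext => z; rewrite mem_vcup !mem_val; split.
  by move=> [y [p [/mem_vcup[h|h] Gp ->]]]; [left|right]; exists y, p.
by move=> [] [y [p [h Gp ->]]]; exists y, p; split=> //; apply/mem_vcup; [left|right].
Qed.

(** The condition [one] lies in every generic filter, so no element is lost in the evaluation. *)
Definition nset (S : V) : V := vimg S (fun s => ⟨s, one⟩).

Lemma DefT_nset : DefT M C (fun e => nset (e 0)).
Proof. by rewrite /nset; df. Qed.

Lemma name_nset S : M S -> (forall s, s ∈ S -> names M P s) -> names M P (nset S).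
Proof.
move=> MS nS; apply: name_intro => [|z /mem_vimg [s sS ->]].
  by apply: (DefT_nset.1 (fun=> S)).
by exists s, one; split; [|exact: nS|exact: (cf_one hP)].
Qed.

Lemma nval_nset G S : generic C P le G -> nval G (nset S) = vimg S (nval G).
Proof.
move=> gG; apply: V_ext => z; rewrite mem_val mem_vimg; split.
  by move=> [t [p [/mem_vimg [s sS /opair_inj[-> _]] _ ->]]]; exists s.
move=> [s sS ->]; exists s, one; split=> //; first by apply/mem_vimg; exists s.
exact: (generic_one hP gG).
Qed.

Definition npair (s t : V) : V := nset (upair s t).
Definition nop (s t : V) : V := npair (npair s s) (npair s t).

Lemma DefT_npair : DefT M C (fun e => npair (e 0) (e 1)).
Proof. by have dn := DefT_nset; rewrite /npair; df. Qed.

Lemma DefT_nop : DefT M C (fun e => nop (e 0) (e 1)).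
Proof. by have dn := DefT_nset; rewrite /nop /npair; df. Qed.

Lemma name_pair s t : names M P s -> names M P t -> names M P (npair s t).
Proof.
move=> ns nt; apply: name_nset => [|u /mem_upair[]->]; [|exact: ns|exact: nt].
by apply: (M_upair hM); [case: ns|case: nt].
Qed.

Lemma name_op s t : names M P s -> names M P t -> names M P (nop s t).
Proof. by move=> ns nt; apply: name_pair; apply: name_pair. Qed.

Lemma nval_pair G s t : generic C P le G -> nval G (npair s t) = upair (nval G s) (nval G t).
Proof.
move=> gG; rewrite nval_nset //; apply: V_ext => z; rewrite mem_vimg mem_upair; split.
  by move=> [u /mem_upair[]-> ->]; [left|right].
by move=> []->; [exists s|exists t] => //; apply/mem_upair; [left|right].
Qed.

Lemma nval_op G s t : generic C P le G -> nval G (nop s t) = ⟨nval G s, nval G t⟩.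
Proof. by move=> gG; rewrite !nval_pair. Qed.

Opaque npair nop.

(** The value is {∅} if [r] is in the filter and ∅ otherwise. Thus [r in G] is the equation of
    [nlit r] with [nlit one], and [r not in G] its equation with [vempty]. *)
Definition nlit (r : V) : V := upair ⟨vempty, r⟩ ⟨vempty, r⟩.

Lemma name_lit r : P r -> names M P (nlit r).
Proof.
move=> Pr; have M0 := M_empty hM; have Mr := C_sub hM CP Pr.
apply: name_intro => [|z /mem_upair zE]; first by do 2 apply: (M_upair hM) => //; apply: (M_upair hM).
by exists vempty, r; split; [case: zE|exact: name_empty|exact: Pr].
Qed.

Lemma mem_nval_lit G r z : z ∈ nval G (nlit r) <-> G r /\ z = vempty.
Proof.
rewrite mem_val; split.
  by move=> [t [p [/mem_upair[] /opair_inj[-> ->] Gr ->]]]; rewrite nval_empty.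
move=> [Gr ->]; exists vempty, r; split=> //; last by rewrite nval_empty.
by apply/mem_upair; left.
Qed.

(* A pair of names stands for the equation between them. *)
Definition eqname (x : V) : Prop := names M P (vfst x) /\ names M P (vsnd x).
Definition eqhold (x : V) (G : set V) : Prop := nval G (vfst x) = nval G (vsnd x).

(* With D = {<a, a>} and N = {<a, b>}, where a = b ranges over the equations in X:
   all of them hold iff D u N = D, and some of them holds iff N is one of the sets
   N u {<a, a>}. *)
Definition eqdiag (X : V) : V := nset (vimg X (fun x => nop (vfst x) (vfst x))).
Definition eqgraph (X : V) : V := nset (vimg X (fun x => nop (vfst x) (vsnd x))).
Definition eqpert (X : V) : V := nset (vimg X (fun x =>
  vcup (eqgraph X) (nset (upair (nop (vfst x) (vfst x)) (nop (vfst x) (vfst x)))))).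
Definition eqall (X : V) : V := ⟨vcup (eqdiag X) (eqgraph X), eqdiag X⟩.
Definition eqsome (X : V) : V := ⟨vcup (eqpert X) (npair (eqgraph X) (eqgraph X)), eqpert X⟩.

Lemma DefT_eqgraph : DefT M C (fun e => eqgraph (e 0)).
Proof. by have dn := DefT_nset; have dp := DefT_nop; rewrite /eqgraph; df. Qed.

Lemma DefT_eqdiag : DefT M C (fun e => eqdiag (e 0)).
Proof. by have dn := DefT_nset; have dp := DefT_nop; rewrite /eqdiag; df. Qed.

Lemma DefT_eqpert : DefT M C (fun e => eqpert (e 0)).
Proof.
have dn := DefT_nset; have dp := DefT_nop; have dg := DefT_eqgraph.
by rewrite /eqpert; df.
Qed.

Lemma DefT_eqall : DefT M C (fun e => eqall (e 0)).
Proof. by have dd := DefT_eqdiag; have dg := DefT_eqgraph; rewrite /eqall; df. Qed.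

Lemma DefT_eqsome : DefT M C (fun e => eqsome (e 0)).
Proof.
have dn := DefT_nset; have dd := DefT_eqpert; have dg := DefT_eqgraph.
have dp := DefT_npair.
by rewrite /eqsome; df.
Qed.

Section Equations.
Variable X : V.
Hypothesis MX : M X.
Hypothesis eX : forall x, x ∈ X -> eqname x.

Lemma name_eqdiag : names M P (eqdiag X).
Proof.
apply: name_nset => [|s /mem_vimg [x /eX [nx _] ->]]; last exact: name_op.
have dp := DefT_nop.
by apply: (M_app (f := fun X => vimg X (fun x => nop (vfst x) (vfst x)))) MX; df.
Qed.

Lemma name_eqgraph : names M P (eqgraph X).
Proof.
apply: name_nset => [|s /mem_vimg [x /eX [nx ny] ->]]; last exact: name_op.
have dp := DefT_nop.
by apply: (M_app (f := fun X => vimg X (fun x => nop (vfst x) (vsnd x)))) MX; df.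
Qed.

Lemma name_eqpert : names M P (eqpert X).
Proof.
apply: name_nset => [|s /mem_vimg [x /eX [nx ny] ->]].
  have dp := DefT_nop; have dg := DefT_eqgraph; have dn := DefT_nset.
  by apply: (M_app (f := fun X => vimg X (fun x => vcup (eqgraph X)
    (nset (upair (nop (vfst x) (vfst x)) (nop (vfst x) (vfst x))))))) MX; df.
apply: name_cup; first exact: name_eqgraph.
by apply: name_pair; apply: name_op.
Qed.

Lemma eqname_all : eqname (eqall X).
Proof.
rewrite /eqname vfstE vsndE; split; last exact: name_eqdiag.
by apply: name_cup; [exact: name_eqdiag|exact: name_eqgraph].
Qed.

Lemma eqname_some : eqname (eqsome X).
Proof.
rewrite /eqname vfstE vsndE; split; last exact: name_eqpert.
apply: name_cup; first exact: name_eqpert.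
by apply: name_pair; exact: name_eqgraph.
Qed.

Variable G : set V.
Hypothesis gG : generic C P le G.

Let a (x : V) := nval G (vfst x).
Let b (x : V) := nval G (vsnd x).

Lemma nval_eqdiag : nval G (eqdiag X) = vimg X (fun x => ⟨a x, a x⟩).
Proof.
rewrite nval_nset //; apply: V_ext => z; rewrite !mem_vimg; split.
  by move=> [s /mem_vimg [x xX ->] ->]; exists x; rewrite ?nval_op.
move=> [x xX ->]; exists (nop (vfst x) (vfst x)); rewrite ?nval_op //.
by apply/mem_vimg; exists x.
Qed.

Lemma nval_eqgraph : nval G (eqgraph X) = vimg X (fun x => ⟨a x, b x⟩).
Proof.
rewrite nval_nset //; apply: V_ext => z; rewrite !mem_vimg; split.
  by move=> [s /mem_vimg [x xX ->] ->]; exists x; rewrite ?nval_op.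
move=> [x xX ->]; exists (nop (vfst x) (vsnd x)); rewrite ?nval_op //.
by apply/mem_vimg; exists x.
Qed.

Lemma mem_nval_eqpert z : z ∈ nval G (eqpert X) <-> exists2 x, x ∈ X &
  z = vcup (nval G (eqgraph X)) (upair ⟨a x, a x⟩ ⟨a x, a x⟩).
Proof.
have E x : nval G (vcup (eqgraph X) (nset (upair (nop (vfst x) (vfst x)) (nop (vfst x) (vfst x)))))
    = vcup (nval G (eqgraph X)) (upair ⟨a x, a x⟩ ⟨a x, a x⟩).
  by rewrite nval_cup nval_pair // nval_op.
rewrite nval_nset // mem_vimg; split.
  by move=> [s /mem_vimg [x xX ->] ->]; exists x; rewrite ?E.
move=> [x xX ->]; rewrite -E; eexists; last by [].
by apply/mem_vimg; exists x.
Qed.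

Opaque nset eqdiag eqgraph eqpert.

(** A point ⟨a, b⟩ of the graph that lies on the diagonal equals some ⟨a', a'⟩, whence a = b,
    whichever equation contributed the diagonal point. *)
Lemma eqhold_all : eqhold (eqall X) G <-> forall x, x ∈ X -> eqhold x G.
Proof.
rewrite /eqhold vfstE vsndE nval_cup nval_eqdiag nval_eqgraph; split=> [E x xX|h].
  have : ⟨a x, b x⟩ ∈ vimg X (fun x => ⟨a x, a x⟩).
    by rewrite -E; apply/mem_vcup; right; apply/mem_vimg; exists x.
  by move=> /mem_vimg [y _ /opair_inj[ab aa]]; rewrite -/(a x) -/(b x) ab aa.
apply: V_ext => z; rewrite mem_vcup; split=> [[//|/mem_vimg [x xX ->]]|]; last by left.
by apply/mem_vimg; exists x => //; congr ⟨_, _⟩; apply/esym/h.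
Qed.

Lemma eqhold_some : eqhold (eqsome X) G <-> exists2 x, x ∈ X & eqhold x G.
Proof.
rewrite /eqhold vfstE vsndE nval_cup nval_pair //; split=> [E|[x xX xh]].
  have : nval G (eqgraph X) ∈ nval G (eqpert X).
    by rewrite -E; apply/mem_vcup; right; apply/mem_upair; left.
  move=> /mem_nval_eqpert [x xX Ex].
  (* Adding this point does not change the graph, so it already lies there. The equation that
     contributed it, [y] below, is true, and it may differ from [x]. *)
  have : ⟨a x, a x⟩ ∈ nval G (eqgraph X).
    by rewrite Ex; apply/mem_vcup; right; apply/mem_upair; left.
  rewrite nval_eqgraph => /mem_vimg [y yX /opair_inj[e1 e2]].
  by exists y => //; rewrite -/(a y) -/(b y) -e1 -e2.
apply: V_ext => z; rewrite mem_vcup; split=> [[//|]|]; last by left.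
move=> /mem_upair zE; apply/mem_nval_eqpert; exists x => //.
have -> : z = nval G (eqgraph X) by case: zE.
apply: V_ext => w; rewrite mem_vcup; split=> [|[//|/mem_upair wE]]; first by left.
have -> : w = ⟨a x, a x⟩ by case: wE.
by rewrite nval_eqgraph; apply/mem_vimg; exists x => //; congr ⟨_, _⟩.
Qed.

End Equations.

Variable FE : set V.
Hypothesis CFE : C FE.
Definition eqforced (p x : V) : Prop := forall G, generic C P le G -> G p -> eqhold x G.
Hypothesis FEP : forall p s t, P p -> names M P s -> names M P t ->
  FE ⟨p, s, t⟩ <-> forall G, generic C P le G -> G p -> nval G s = nval G t.

Let FEx p x : P p -> eqname x -> FE ⟨p, vfst x, vsnd x⟩ <-> eqforced p x.
Proof. by move=> Pp [n1 n2]; apply: FEP. Qed.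

(* A truth value is a pair of equations, of which exactly one holds in every
   generic extension; the second equation is the negation of the first. *)
Record ngood (v : V) : Prop := {
  ngood_M : M v;
  ngood_pos : eqname (vfst v);
  ngood_neg : eqname (vsnd v);
  ngood_excl : forall G, generic C P le G -> eqhold (vsnd v) G <-> ~ eqhold (vfst v) G;
  ngood_decided : forall G, generic C P le G ->
    exists2 p, G p & eqforced p (vfst v) \/ eqforced p (vsnd v)
}.

Definition nhold (v : V) (G : set V) : Prop := eqhold (vfst v) G.
Definition vlit (r : V) : V := ⟨⟨nlit r, nlit one⟩, nlit r, vempty⟩.
Definition vneg (v : V) : V := ⟨vsnd v, vfst v⟩.
Definition vconj (W : V) : V := ⟨eqall (vimg W vfst), eqsome (vimg W vsnd)⟩.

Lemma ngood_vlit r : P r -> ngood (vlit r).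
Proof.
move=> Pr; have Mr := C_sub hM CP Pr; have M0 := M_empty hM.
have hl G : generic C P le G -> eqhold ⟨nlit r, nlit one⟩ G <-> G r.
  move=> gG; have G1 := generic_one hP gG.
  rewrite /eqhold vfstE vsndE; split=> [E|Gr].
    have : vempty ∈ nval G (nlit one) by apply/mem_nval_lit.
    by rewrite -E => /mem_nval_lit[].
  by apply: V_ext => z; rewrite !mem_nval_lit; split=> -[].
have hn G : generic C P le G -> eqhold ⟨nlit r, vempty⟩ G <-> ~ G r.
  move=> gG; rewrite /eqhold vfstE vsndE nval_empty; split=> [E Gr|nGr].
    by apply: (@not_mem_vempty vempty); rewrite -{2}E; apply/mem_nval_lit.
  by apply: V_ext => z; split=> [/mem_nval_lit[]//|/not_mem_vempty].
rewrite /vlit; split; rewrite ?vfstE ?vsndE.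
- have [Ml _] := name_lit Pr; have [Ml1 _] := name_lit (cf_one hP).
  by do 2 apply: (M_opair hM) => //; apply: (M_opair hM).
- by rewrite /eqname vfstE vsndE; split; apply: name_lit => //; apply: (cf_one hP).
- by rewrite /eqname vfstE vsndE; split; [apply: name_lit|apply: name_empty].
- by move=> G gG; rewrite hn // hl.
- move=> G gG; case: (EM (G r)) => [Gr|nGr].
    by exists r => //; left=> G' gG' G'r; apply/hl.
  have [q Gq qr] := generic_decides hM hP gG Pr nGr.
  by exists q => //; right=> G' gG' G'q; apply/hn => //; apply: (incompatible_generic gG' G'q qr).
Qed.

Lemma nhold_vlit r G : generic C P le G -> P r -> nhold (vlit r) G <-> G r.
Proof.
move=> gG Pr; have G1 := generic_one hP gG.
rewrite /nhold /vlit vfstE /eqhold vfstE vsndE; split=> [E|Gr].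
  have : vempty ∈ nval G (nlit one) by apply/mem_nval_lit.
  by rewrite -E => /mem_nval_lit[].
by apply: V_ext => z; rewrite !mem_nval_lit; split=> -[].
Qed.

Lemma ngood_vneg v : ngood v -> ngood (vneg v).
Proof.
move=> [Mv vp vn ve vd]; rewrite /vneg; split; rewrite ?vfstE ?vsndE //.
- by apply: (M_app (f := fun v => ⟨vsnd v, vfst v⟩)) Mv; df.
- move=> G gG; have := ve G gG; case: (EM (eqhold (vfst v) G)) => h; tauto.
- by move=> G gG; have [p Gp h] := vd G gG; exists p => //; case: h; [right|left].
Qed.

Section Conjunction.
Variable W : V.
Hypothesis MW : M W.
Hypothesis gW : forall v, v ∈ W -> ngood v.

Let M_pos : M (vimg W vfst).
Proof. by apply: (M_app (f := fun W => vimg W vfst)) MW; df. Qed.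

Let M_neg : M (vimg W vsnd).
Proof. by apply: (M_app (f := fun W => vimg W vsnd)) MW; df. Qed.

Let e_pos x : x ∈ vimg W vfst -> eqname x.
Proof. by move=> /mem_vimg [v /gW gv ->]; apply: ngood_pos. Qed.

Let e_neg x : x ∈ vimg W vsnd -> eqname x.
Proof. by move=> /mem_vimg [v /gW gv ->]; apply: ngood_neg. Qed.

Lemma eqhold_conj G : generic C P le G ->
  eqhold (eqall (vimg W vfst)) G <-> forall v, v ∈ W -> nhold v G.
Proof.
move=> gG; rewrite eqhold_all //; split=> [h v vW|h x /mem_vimg [v vW ->]].
  by apply: h; apply/mem_vimg; exists v.
exact: h.
Qed.

Lemma eqhold_conj_neg G : generic C P le G ->
  eqhold (eqsome (vimg W vsnd)) G <-> exists2 v, v ∈ W & eqhold (vsnd v) G.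
Proof.
move=> gG; rewrite eqhold_some //; split=> [[x /mem_vimg [v vW ->]]|[v vW h]].
  by exists v.
by exists (vsnd v) => //; apply/mem_vimg; exists v.
Qed.

(** Density of the deciding conditions: if [p] does not force the conjunction, some generic [G']
    through [p] falsifies a member [v]. Since [v] is decided in [G'], a condition of [G'] forces its
    negative equation, and so does a common extension with [p]. *)
Lemma decided_conj G : generic C P le G -> exists2 p, G p &
  eqforced p (eqall (vimg W vfst)) \/ eqforced p (eqsome (vimg W vsnd)).
Proof.
move=> gG; have da := DefT_eqall.
have ea : eqname (eqall (vimg W vfst)) by apply: eqname_all.
have d : Def M C (fun e => P (e 0) /\
    (FE ⟨e 0, vfst (eqall (vimg W vfst)), vsnd (eqall (vimg W vfst))⟩ \/
     exists2 v, v ∈ W & FE ⟨e 0, vfst (vsnd v), vsnd (vsnd v)⟩)).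
  have Mc := M_app da M_pos.
  have Mc1 : M (vfst (eqall (vimg W vfst))) := M_vfst hM Mc.
  have Mc2 : M (vsnd (eqall (vimg W vfst))) := M_vsnd hM Mc.
  move: (vfst _) (vsnd _) Mc1 Mc2 => c1 c2 Mc1 Mc2.
  by df.
have CD := Def_compr hM d (fun=> MW).
have [|p [Gp [_ [Pp [/(FEx Pp ea) h|[v vW /(FEx Pp (ngood_neg (gW vW))) h]]]]]] :=
  gG.2 _ CD; last 2 first.
- by exists p => //; left.
- exists p => //; right=> G' gG' G'p; apply/eqhold_conj_neg => //.
  by exists v => //; apply: h.
split=> [p [_ []]//|p Pp].
case: (EM (eqforced p (eqall (vimg W vfst)))) => [h|].
  exists p; last exact: (cf_refl hP).
  split; first exact: (C_sub hM CP Pp).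
  by split=> //; left; apply/FEx.
move=> /existsNP [G' /not_implyP [gG' /not_implyP [G'p]]].
move=> nh; have /existsNP [v /not_implyP [vW nv]] : ~ forall v, v ∈ W -> nhold v G'.
  by move=> h; apply: nh; apply/eqhold_conj.
have [q G'q qv] := ngood_decided (gW vW) gG'.
case: qv => [/(_ G' gG' G'q)//|qv].
have [r [G'r rp rq]] := filter_dir gG'.1 G'p G'q.
have Pr := filter_sub gG'.1 G'r.
exists r => //; split; first exact: (C_sub hM CP Pr).
split=> //; right; exists v => //; apply/(FEx Pr (ngood_neg (gW vW))).
by move=> G2 gG2 G2r; apply: qv => //; apply: (generic_up hP gG2 G2r).
Qed.

Lemma ngood_vconj : ngood (vconj W).
Proof.
rewrite /vconj; split; rewrite ?vfstE ?vsndE.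
- have da := DefT_eqall; have ds := DefT_eqsome.
  by apply: (M_opair hM); [apply: M_app da _|apply: M_app ds _].
- exact: eqname_all.
- exact: eqname_some.
- move=> G gG; rewrite eqhold_conj_neg // eqhold_conj //; split.
    by move=> [v vW /(ngood_excl (gW vW) gG)] h /(_ v vW).
  move=> /existsNP [v /not_implyP [vW nv]]; exists v => //.
  exact/(ngood_excl (gW vW) gG).
- exact: decided_conj.
Qed.

Lemma nhold_vconj G : generic C P le G ->
  nhold (vconj W) G <-> forall v, v ∈ W -> nhold v G.
Proof. by move=> gG; rewrite /nhold /vconj vfstE eqhold_conj. Qed.

End Conjunction.

Theorem name_uniform_forcing : uniform_forcing_theorem M C P le one.
Proof.
pose Fo := [set z | M z /\ (P (vfst z) /\
  FE ⟨vfst z, vfst (vfst (vsnd z)), vsnd (vfst (vsnd z))⟩)].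
have CFo : C Fo.
  apply: (@Def_compr _ _ hM (fun e => P (vfst (e 0)) /\
    FE ⟨vfst (e 0), vfst (vfst (vsnd (e 0))), vsnd (vfst (vsnd (e 0)))⟩)) (fun=> M1).
  by df.
have FoP v p : ngood v -> P p -> Fo ⟨p, v⟩ <-> eqforced p (vfst v).
  move=> gv Pp; rewrite /Fo /= vfstE vsndE; split=> [[_ [_ /(FEx Pp (ngood_pos gv))]]//|h].
  split; first by apply: (M_opair hM); [exact: (C_sub hM CP Pp)|exact: ngood_M].
  by split=> //; apply/(FEx Pp (ngood_pos gv)).
apply: (@value_algebra_uniform_forcing M C P le one hM hP vlit vneg vconj ngood nhold Fo).
have M0 := M_empty hM; have da := DefT_eqall; have ds := DefT_eqsome.
split.
- by rewrite /vlit /nlit; df.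
- by rewrite /vneg; df.
- by rewrite /vconj; df.
- exact: ngood_vlit.
- exact: ngood_vneg.
- exact: ngood_vconj.
- exact: nhold_vlit.
- by move=> v G gG gv; rewrite /nhold /vneg vfstE; apply: ngood_excl.
- by move=> W G gG MW gW; apply: nhold_vconj.
- exact: CFo.
- exact: FoP.
(* The truth lemma is built into [ngood]: of the two decided alternatives, the negative one
   contradicts the truth of [v]. *)
- move=> v G gG gv hv; have [p Gp h] := ngood_decided gv gG; exists p => //.
  apply/(FoP _ _ gv (filter_sub gG.1 Gp)); case: h => // h.
  by case: ((ngood_excl gv gG).1 (h G gG Gp)).
Qed.

End NameAlgebra.

(** * Truth values in a Boolean completion *)

Section BooleanTheory.
Variables (B : set V) (meet join : V -> V -> V) (compl : V -> V) (bot top : V).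
Hypothesis hB : boolean_algebra B meet join compl bot top.

Local Notation ble := (ba_le meet).

Lemma ble_refl a : B a -> ble a a.
Proof.
move=> Ba; rewrite /ba_le -{2}(ba_meetK hB Ba Ba) (ba_joinK hB) //.
exact: (ba_meet_closed hB).
Qed.

Lemma ble_trans a b c : B a -> B b -> B c -> ble a b -> ble b c -> ble a c.
Proof. by rewrite /ba_le => Ba Bb Bc <- bc; rewrite -(ba_meetA hB) // bc. Qed.

Lemma ble_anti a b : B a -> B b -> ble a b -> ble b a -> a = b.
Proof. by rewrite /ba_le => Ba Bb ab ba; rewrite -ab (ba_meetC hB). Qed.

Lemma meet_bot a : B a -> meet a bot = bot.
Proof.
move=> Ba; have Bc := ba_compl_closed hB Ba.
by rewrite -(ba_meet_compl hB Ba) (ba_meetA hB) // (ble_refl Ba).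
Qed.

Lemma meet_top a : B a -> meet a top = a.
Proof.
move=> Ba; have Bc := ba_compl_closed hB Ba.
by rewrite -(ba_join_compl hB Ba) (ba_joinK hB).
Qed.

Lemma join_bot a : B a -> join a bot = a.
Proof.
move=> Ba; have Bc := ba_compl_closed hB Ba.
by rewrite -(ba_meet_compl hB Ba) (ba_meetK hB).
Qed.

(** Splitting [a] along [b] and its complement turns the order into the vanishing of a meet, the
    form in which density of [pi] applies. *)
Lemma meet_compl_eq0 a b : B a -> B b -> meet a (compl b) = bot <-> ble a b.
Proof.
move=> Ba Bb; have Bc := ba_compl_closed hB Bb; rewrite /ba_le; split=> [h|<-].
  rewrite -[RHS](meet_top Ba) -(ba_join_compl hB Bb) (ba_meetD hB) // h.
  by rewrite join_bot //; apply: (ba_meet_closed hB).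
by rewrite -(ba_meetA hB) // (ba_meet_compl hB) // meet_bot.
Qed.

Lemma meet_le_l a b : B a -> B b -> ble (meet a b) a.
Proof.
move=> Ba Bb; rewrite /ba_le (ba_meetC hB) ?(ba_meetA hB) ?(ble_refl Ba) //.
exact: (ba_meet_closed hB).
Qed.

Lemma meet_le_r a b : B a -> B b -> ble (meet a b) b.
Proof. by move=> Ba Bb; rewrite (ba_meetC hB) //; apply: meet_le_l. Qed.

Lemma complK a : B a -> compl (compl a) = a.
Proof.
move=> Ba; have Bc := ba_compl_closed hB Ba; have Bcc := ba_compl_closed hB Bc.
apply: ble_anti => //.
  by apply/meet_compl_eq0 => //; rewrite (ba_meetC hB) // (ba_meet_compl hB).
have Bm := ba_meet_closed hB Ba Bcc; have B0 := ba_bot hB.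
rewrite /ba_le -[RHS](meet_top Ba) -(ba_join_compl hB Bc) (ba_meetD hB) //.
by rewrite (ba_meet_compl hB) // (ba_joinC hB) // join_bot.
Qed.

Lemma ble_disjoint a v : B a -> B v -> ble a v -> ble a (compl v) -> a = bot.
Proof.
move=> Ba Bv av /= h; have Bc := ba_compl_closed hB Bv.
by rewrite -h; apply/meet_compl_eq0.
Qed.

Lemma ble_compl a b : B a -> B b -> ble a b -> ble (compl b) (compl a).
Proof.
move=> Ba Bb ab; have Bc := ba_compl_closed hB.
by apply/meet_compl_eq0; rewrite ?complK ?(ba_meetC hB (Bc _ Bb)) //; auto;
   apply/meet_compl_eq0.
Qed.

End BooleanTheory.

Section BooleanAlgebra.
Variables (M : set V) (C : set (set V)) (P le : set V) (one : V).
Hypothesis hM : ctm_GBm M C.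
Hypothesis hP : class_forcing C P le one.
Variables (B : set V) (meet join : V -> V -> V) (compl : V -> V) (bot top : V).
Variable pi : V -> V.
Hypothesis hB : boolean_algebra B meet join compl bot top.
Hypothesis hcomplete : M_complete M B meet.
Hypothesis CB : C B.
Hypothesis Cmeet : C (graph2 B meet).
Hypothesis Ccompl : C (graph1 B compl).
Hypothesis hpi : dense_embedding P le B meet bot pi.
Hypothesis Cpi : C (graph1 P pi).

Local Notation ble := (ba_le meet).

Let CP := cf_dom_class hP.
Let Bpi p (Pp : P p) : B (pi p) := (de_range hpi Pp).1.
Let Bc := ba_compl_closed hB.

(** The functions [pi], [compl] and [meet] are arbitrary outside their domains, and only their
    graphs are classes. Reading values off the graphs yields definable operations. *)
Definition blit (r : V) : V := the (fun y => graph1 P pi ⟨r, y⟩).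
Definition bneg (v : V) : V := the (fun y => graph1 B compl ⟨v, y⟩).
Definition blec (a b : V) : Prop := graph2 B meet ⟨⟨a, b⟩, a⟩.
(** Since [B] is a class, its elements lie in [M], so letting the competing bounds range over [M]
    changes nothing and makes the description first order over the model. *)
Definition bsup (W : V) : V := the (fun s => (forall a, a ∈ W -> B a) /\
  (B s /\ ((forall a, a ∈ W -> blec a s) /\
  forall b, M b -> B b -> (forall a, a ∈ W -> blec a b) -> blec s b))).
(** Completeness is formulated for suprema; infima come from them by De Morgan. *)
Definition bconj (W : V) : V := bneg (bsup (vimg W bneg)).

Lemma graph1E (D : set V) (f : V -> V) x y : graph1 D f ⟨x, y⟩ <-> D x /\ y = f x.
Proof.
by split=> [[x' Dx' /opair_inj[-> ->]]|[Dx ->]]; [|exists x].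
Qed.

Lemma blecE a b : blec a b <-> [/\ B a, B b & ble a b].
Proof.
split=> [[x [y [Bx By /opair_inj[/opair_inj[-> ->] E]]]]|[Ba Bb E]]; first by split.
by exists a, b; split=> //; rewrite E.
Qed.

Lemma blitE r : P r -> blit r = pi r.
Proof.
by move=> Pr; apply: the_eq => [y y' /graph1E[_ ->] /graph1E[_ ->]|]//; apply/graph1E.
Qed.

Lemma bnegE v : B v -> bneg v = compl v.
Proof.
by move=> Bv; apply: the_eq => [y y' /graph1E[_ ->] /graph1E[_ ->]|]//; apply/graph1E.
Qed.

Lemma bsup_is_sup W : (forall a, a ∈ W -> B a) -> M W ->
  is_sup B meet [set x | x ∈ W] (bsup W).
Proof.
move=> WB MW; have [s [Bs us ls]] := hcomplete MW WB.
suff -> : bsup W = s by [].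
apply: the_eq => [t t' [_ [Bt [ut lt]]] [_ [Bt' [ut' lt']]]|].
  have tt' := lt t' (C_sub hM CB Bt') Bt' ut'.
  have t't := lt' t (C_sub hM CB Bt) Bt ut.
  by move: tt' t't => /blecE[_ _ h] /blecE[_ _ h']; apply: (ble_anti hB).
split=> //; split=> //; split=> [a aW|b _ Bb ub].
  by apply/blecE; split=> //; [exact: WB|exact: us].
by apply/blecE; split=> //; apply: ls => // a /ub /blecE[].
Qed.

Lemma DefT_blit : DefT M C (fun e => blit (e 0)).
Proof.
apply: (DefT_the hM); last by df.
  by move=> e y _ /(C_sub hM Cpi) /(M_opair_inv hM)[].
by move=> e y y' _ /graph1E[_ ->] /graph1E[_ ->].
Qed.

Lemma DefT_bneg : DefT M C (fun e => bneg (e 0)).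
Proof.
apply: (DefT_the hM); last by df.
  by move=> e y _ /(C_sub hM Ccompl) /(M_opair_inv hM)[].
by move=> e y y' _ /graph1E[_ ->] /graph1E[_ ->].
Qed.

Lemma DefT_bsup : DefT M C (fun e => bsup (e 0)).
Proof.
apply: (DefT_the hM); last by rewrite /blec; df.
  by move=> e y _ [_ [By _]]; apply: (C_sub hM CB By).
move=> e t t' _ [_ [Bt [ut lt]]] [_ [Bt' [ut' lt']]].
have tt' := lt t' (C_sub hM CB Bt') Bt' ut'.
have t't := lt' t (C_sub hM CB Bt) Bt ut.
by move: tt' t't => /blecE[_ _ h] /blecE[_ _ h']; apply: (ble_anti hB).
Qed.

Lemma DefT_bconj : DefT M C (fun e => bconj (e 0)).
Proof.
by have dn := DefT_bneg; have ds := DefT_bsup; rewrite /bconj; df.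
Qed.

Lemma bconj_is_inf W : M W -> (forall v, v ∈ W -> B v) ->
  [/\ B (bconj W), forall v, v ∈ W -> ble (bconj W) v &
    forall b, B b -> (forall v, v ∈ W -> ble b v) -> ble b (bconj W)].
Proof.
move=> MW WB; have dn := DefT_bneg; pose W' := vimg W bneg.
have MW' : M W' by apply: (M_app (f := fun W => vimg W bneg)) MW; df.
have W'B a : a ∈ W' -> B a by move=> /mem_vimg [v /WB Bv ->]; rewrite bnegE //; apply: Bc.
have [Bs us ls] := bsup_is_sup W'B MW'.
have -> : bconj W = compl (bsup W') by rewrite /bconj bnegE.
have Bcs := Bc Bs; split=> // [v vW|b Bb bv].
  have Bv := WB v vW; rewrite -[v](complK hB) //; apply: (ble_compl hB) => //; first exact: Bc.
  by apply: us; apply/mem_vimg; exists v; rewrite ?bnegE.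
rewrite -[b](complK hB) //; apply: (ble_compl hB) => //; first exact: Bc.
apply: ls; first exact: Bc.
move=> a /mem_vimg [v vW ->]; rewrite bnegE; last exact: WB.
by apply: (ble_compl hB) => //; [exact: WB|exact: bv].
Qed.

(** The meet of [pi p] with the complement of [b] is nonzero, so density puts some [pi q] below it.
    This refinement is the source of the dense classes used for [bhold]. *)
Lemma pi_below p b : P p -> B b -> ~ ble (pi p) b ->
  exists q, [/\ P q, le ⟨q, p⟩ & ble (pi q) (compl b)].
Proof.
move=> Pp Bb nb; have Bp := Bpi Pp; have Bcb := Bc Bb.
have Bm := ba_meet_closed hB Bp Bcb.
have [|q Pq qm] := de_dense hpi Bm; first by move/(meet_compl_eq0 hB Bp Bb).
have Bq := Bpi Pq; exists q; split=> //.
  by apply/(de_le hpi Pq Pp); apply: (ble_trans hB Bq Bm Bp qm); apply: (meet_le_l hB).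
by apply: (ble_trans hB Bq Bm Bcb qm); apply: (meet_le_r hB).
Qed.

Lemma pi_mono p q b : le ⟨p, q⟩ -> B b -> ble (pi q) b -> ble (pi p) b.
Proof.
move=> pq Bb; have [Pp Pq] := le_dom hP pq.
by apply: (ble_trans hB (Bpi Pp) (Bpi Pq) Bb); apply/(de_le hpi).
Qed.

Lemma pi_disjoint G p q b : generic C P le G -> B b -> G p -> G q ->
  ble (pi p) b -> ble (pi q) (compl b) -> False.
Proof.
move=> [fG _] Bb Gp Gq pb qb; have [r [Gr rp rq]] := filter_dir fG Gp Gq.
have Pr := filter_sub fG Gr; have [Br r0] := de_range hpi Pr.
apply: r0; apply: (ble_disjoint hB Br Bb); first exact: pi_mono pb.
by apply: pi_mono qb => //; apply: Bc.
Qed.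

Definition bhold (v : V) (G : set V) : Prop := exists2 p, G p & ble (pi p) v.

Lemma bhold_forced v p : B v -> P p ->
  ble (pi p) v <-> forall G, generic C P le G -> G p -> bhold v G.
Proof.
move=> Bv Pp; split=> [pv G gG Gp|h]; first by exists p.
apply: contrapT => /(pi_below Pp Bv) [q [Pq qp qv]].
have [G gG Gq] := generic_exists hM hP Pq.
have [r Gr rv] := h G gG (generic_up hP gG Gq qp).
exact: pi_disjoint gG Bv Gr Gq rv qv.
Qed.

Lemma bhold_compl v G : generic C P le G -> B v -> bhold (compl v) G <-> ~ bhold v G.
Proof.
move=> gG Bv; split=> [[p Gp pv] [q Gq qv]|nh].
  exact: pi_disjoint gG Bv Gq Gp qv pv.
have Mv := C_sub hM CB Bv; have dl := DefT_blit; have dn := DefT_bneg.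
have d : Def M C (fun e => P (e 0) /\
    (blec (blit (e 0)) v \/ blec (blit (e 0)) (bneg v))) by rewrite /blec; df.
have [|p [Gp [_ [Pp]]]] := gG.2 _ (Def_compr hM d (fun=> Mv)).
  split=> [p [_ [Pp _]]//|p Pp]; have Bcv := Bc Bv.
  have H q : P q -> ble (pi q) v \/ ble (pi q) (compl v) -> [set x | M x /\
      (P (env_cons x (fun=> v) 0) /\ (blec (blit (env_cons x (fun=> v) 0)) v \/
       blec (blit (env_cons x (fun=> v) 0)) (bneg v)))] q.
    move=> Pq h; split; first exact: (C_sub hM CP Pq).
    split=> //=; rewrite blitE // bnegE //; have Bq := Bpi Pq.
    by case: h; [left|right]; apply/blecE.
  case: (EM (ble (pi p) v)) => [pv|/(pi_below Pp Bv) [q [Pq qp qv]]].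
    by exists p; [apply: H => //; left|apply: (cf_refl hP)].
  by exists q => //; apply: H => //; right.
move=> /= []; rewrite blitE ?bnegE // => /blecE[_ _ h]; last by exists p.
by case: nh; exists p.
Qed.

(** By [pi_below] it is dense to lie below the infimum or below the complement of some member of
    [W]. If all members hold in the extension, the filter can only meet this class in the first
    way. *)
Lemma bhold_conj W G : generic C P le G -> M W -> (forall v, v ∈ W -> B v) ->
  bhold (bconj W) G <-> forall v, v ∈ W -> bhold v G.
Proof.
move=> gG MW WB; have [Bi lei gei] := bconj_is_inf MW WB.
split=> [[p Gp pi_] v vW|h].
  exists p => //; have Pp := filter_sub gG.1 Gp.
  exact: (ble_trans hB (Bpi Pp) Bi (WB v vW) pi_ (lei v vW)).
have dl := DefT_blit; have dn := DefT_bneg; have Mi := C_sub hM CB Bi.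
have d : Def M C (fun e => P (e 0) /\ (blec (blit (e 0)) (bconj W) \/
    exists2 v, v ∈ W & blec (blit (e 0)) (bneg v))) by rewrite /blec; df.
have [|p [Gp [_ [Pp]]]] := gG.2 _ (Def_compr hM d (fun=> MW)); last first.
  move=> /= []; rewrite blitE //; first by move=> /blecE[_ _ hp]; exists p.
  move=> [v vW]; have Bv := WB v vW; rewrite bnegE // => /blecE[_ _ pv].
  by have [q Gq qv] := h v vW; case: (pi_disjoint gG Bv Gq Gp qv pv).
split=> [p [_ [Pp _]]//|p Pp]; have Bp := Bpi Pp.
case: (EM (ble (pi p) (bconj W))) => [hp|nh].
  exists p; last exact: (cf_refl hP).
  split; first exact: (C_sub hM CP Pp).
  by split=> //=; left; rewrite blitE //; apply/blecE.
have /existsNP [v /not_implyP [vW nv]] : ~ forall v, v ∈ W -> ble (pi p) v.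
  by move=> H; apply: nh; apply: gei.
have Bv := WB v vW; have [q [Pq qp qv]] := pi_below Pp Bv nv.
exists q => //; split; first exact: (C_sub hM CP Pq).
split=> //=; right; exists v => //; rewrite blitE // bnegE //; apply/blecE.
by split=> //; [exact: Bpi|exact: Bc].
Qed.

Lemma boolean_uniform_forcing : uniform_forcing_theorem M C P le one.
Proof.
have dl := DefT_blit; have dn := DefT_bneg.
pose Fo := [set z | M z /\ (P (vfst z) /\ (B (vsnd z) /\ blec (blit (vfst z)) (vsnd z)))].
have CFo : C Fo.
  have d : Def M C (fun e => P (vfst (e 0)) /\ (B (vsnd (e 0)) /\
    blec (blit (vfst (e 0))) (vsnd (e 0)))) by rewrite /blec; df.
  exact: (Def_compr hM d (fun=> M_empty hM)).
have FoP v p : B v -> P p -> Fo ⟨p, v⟩ <-> ble (pi p) v.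
  move=> Bv Pp; have Bp := Bpi Pp.
  rewrite /Fo /= vfstE vsndE blitE //; split=> [[_ [_ [_ /blecE[]]]]//|h].
  split; first by apply: (M_opair hM); [exact: (C_sub hM CP Pp)|exact: (C_sub hM CB Bv)].
  by split=> //; split=> //; apply/blecE.
apply: (@value_algebra_uniform_forcing M C P le one hM hP blit bneg bconj B bhold Fo).
split=> //.
- exact: DefT_bconj.
- by move=> r Pr; rewrite blitE //; apply: Bpi.
- by move=> v Bv; rewrite bnegE //; apply: Bc.
- by move=> W MW WB; have [] := bconj_is_inf MW WB.
- move=> r G gG Pr; rewrite blitE //; split=> [[p Gp pr]|Gr].
    apply: (generic_up hP gG Gp); apply/(de_le hpi) => //.
    exact: (filter_sub gG.1 Gp).
  by exists r => //; apply: (ble_refl hB); apply: Bpi.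
- by move=> v G gG Bv; rewrite bnegE //; apply: bhold_compl.
- by move=> W G gG MW WB; apply: bhold_conj.
- by move=> v p Bv Pp; rewrite FoP //; apply: bhold_forced.
- move=> v G gG Bv [p Gp pv]; exists p => //; apply/FoP => //.
  exact: (filter_sub gG.1 Gp).
Qed.

(** [pi_below] gives an extension of [p] below the complement of [pi q]; the image of a common
    extension with [q] would be zero. *)
Lemma boolean_separative : separative P le.
Proof.
move=> p q Pp Pq npq; have Bq := Bpi Pq.
have [|r [Pr rp rq]] := pi_below Pp Bq; first by move/(de_le hpi Pp Pq).
exists r; split=> // -[s [Ps sr sq]]; have [Bs s0] := de_range hpi Ps.
apply: s0; apply: (ble_disjoint hB Bs Bq); first exact/(de_le hpi Ps Pq).
by apply: (pi_mono sr) rq; apply: Bc.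
Qed.

Lemma boolean_antisymmetric : antisymmetric_po le.
Proof.
move=> p q pq qp; have [Pp Pq] := le_dom hP pq.
apply: (de_inj hpi Pp Pq); apply: (ble_anti hB); rewrite ?Bpi //; try exact: Bpi.
  exact/(de_le hpi Pp Pq).
exact/(de_le hpi Pq Pp).
Qed.

End BooleanAlgebra.

(** * First-order formulas *)

Lemma family_inj J (c c' : {i : V | i ∈ J} -> V) : family c = family c' -> c = c'.
Proof.
move=> E; apply: funext => i.
have : ⟨sval i, c i⟩ ∈ family c' by rewrite -E; apply/mem_family; exists i.
move=> /mem_family [j /opair_inj[ij ->]]; congr c'.
case: i j ij => [i hi] [j hj] /= ij; subst j.
by rewrite (Prop_irrelevance hj hi).
Qed.

(** Unique readability: it allows a pair in the forcing class to be read back as forcing of one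
    particular formula. *)
Lemma code_inj : injective code.
Proof.
elim=> [p|s t|s t|phi IH|J phi IH|J phi IH] [p'|s' t'|s' t'|phi'|J' phi'|J' phi'] /opair_inj
  [/vnat_inj E]; try discriminate E; move=> {E}.
- by move=> ->.
- by move=> /opair_inj[-> ->].
- by move=> /opair_inj[-> ->].
- by move=> /IH ->.
- move=> /opair_inj[E]; subst J' => /family_inj /(congr1 (fun f => f _)) E.
  by congr iOr; apply: funext => i; apply: IH; apply: E.
- move=> /opair_inj[E]; subst J' => /family_inj /(congr1 (fun f => f _)) E.
  by congr iAnd; apply: funext => i; apply: IH; apply: E.
Qed.

(** * Simultaneous substitution and the coding of tuples *)

Section Substitution.
Variables (M : set V) (C : set (set V)).
Hypothesis hM : ctm_GBm M C.

Lemma Def_substs Q (t : nat -> (nat -> V) -> V) :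
  Def M C Q -> (forall i, DefT M C (t i)) -> Def M C (fun e => Q (fun i => t i e)).
Proof.
move=> dQ; elim: dQ t => {Q}.
- by move=> i j t dt; apply: Def_mem.
- by move=> i j t dt; apply: Def_eq.
- by move=> X i CX t dt; apply: Def_cls.
- by move=> Q _ h t dt; apply: Def_not; apply: h.
- by move=> Q R _ h _ h' t dt; apply: Def_and; [apply: h|apply: h'].
- move=> Q _ h t dt; pose t' i e := if i is j.+1 then t j (fun i => e i.+1) else e 0 : V.
  have dt' i : DefT M C (t' i) by case: i => [|i]; [apply: DefT_var|apply: DefT_shift].
  apply: Def_ext (Def_all0 (h t' dt')) => e _.
  suff E x : (fun i => t' i (env_cons x e)) = env_cons x (fun i => t i e).
    by split=> H x Mx; have := H x Mx; rewrite E.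
  by apply: funext => -[].
- by move=> Q R QR _ h t dt; apply: Def_ext (h t dt) => e Me; apply: QR => i; apply: (dt i).1.
Qed.

Lemma Def_forall_lt (Q : nat -> (nat -> V) -> Prop) n :
  (forall i, Def M C (Q i)) -> Def M C (fun e => forall i, i < n -> Q i e).
Proof.
move=> dQ; elim: n => [|n IH].
  have d : Def M C (fun e => e 0 = e 0) by apply: Def_eq0.
  by apply: Def_ext d => e _.
apply: Def_ext (Def_and IH (dQ n)) => e _; split=> [[h hn] i|h].
  by rewrite ltnS leq_eqVlt => /orP[/eqP->|/h].
by split=> [i /ltnW|]; apply: h.
Qed.

(** Inverse of [vtuple]: index 0 is the condition, the later ones are the names. The last entry is
    not wrapped in a pair, so at length 0 the whole set is returned. *)
Fixpoint vproj (m : nat) (z : V) (i : nat) : V :=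
  if m is m'.+1 then if i is j.+1 then vproj m' (vsnd z) j else vfst z else z.

Fixpoint is_vtuple (m : nat) (z : V) : Prop :=
  if m is m'.+1 then z = ⟨vfst z, vsnd z⟩ /\ is_vtuple m' (vsnd z) else True.

Lemma DefT_vproj m t i : DefT M C t -> DefT M C (fun e => vproj m (t e) i).
Proof.
elim: m t i => [|m IH] t i dt //=; case: i => [|i]; first exact: DefT_vfst.
by apply: (IH (fun e => vsnd (t e))); apply: DefT_vsnd.
Qed.

Lemma Def_is_vtuple m t : DefT M C t -> Def M C (fun e => is_vtuple m (t e)).
Proof.
elim: m t => [|m IH] t dt /=; first by apply: Def_ext (Def_eq dt dt) => e _.
have d := DefT_vsnd hM dt; have d' := DefT_vfst hM dt.
apply: Def_and; last exact: IH.
by apply: Def_eq => //; apply: DefT_opair.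
Qed.

Lemma is_vtupleP m z : is_vtuple m z <-> exists p (s : m.-tuple V), z = vtuple p s.
Proof.
split.
  elim: m z => [|m IH] z /=; first by exists z, [tuple].
  move=> [zE /IH [p [s sE]]]; exists (vfst z), [tuple of p :: s].
  by rewrite /= -sE.
move=> [p [s ->]]; case: s => s /= /eqP <-.
by elim: s p => //= y s IH p; rewrite vfstE vsndE.
Qed.

Lemma vproj_vtuple m p (s : m.-tuple V) :
  vproj m (vtuple p s) 0 = p /\
  etuple m (fun i => vproj m (vtuple p s) i.+1) = s.
Proof.
have H x0 : forall t q i, i <= size t -> vproj (size t) (vtuple q t) i = nth x0 (q :: t) i.
  by elim=> [|y t IH] q [|i] //=; rewrite ?vfstE ?vsndE //; apply: IH.
case: s => s ss; have /eqP E := ss; subst m.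
split; first by rewrite (H p).
by apply: eq_from_tnth => i; rewrite tnth_mktuple (H p) /= ?(tnth_nth p).
Qed.

Lemma M_vtuple m p (s : m.-tuple V) : M p -> all_in M s -> M (vtuple p s).
Proof.
have H x0 : forall t q, M q -> (forall i, i < size t -> M (nth x0 t i)) -> M (vtuple q t).
  elim=> //= y t IH q Mq Mt; apply: (M_opair hM) => //.
  by apply: IH => [|i it_]; [apply: (Mt 0)|apply: (Mt i.+1)].
move=> Mp Ms; apply: (H p) => // i; rewrite size_tuple => im.
by have := Ms (Ordinal im); rewrite (tnth_nth p).
Qed.

End Substitution.

Section FirstOrder.
Variables (M : set V) (C : set (set V)) (P le : set V) (one : V).
Hypothesis hM : ctm_GBm M C.
Hypothesis hP : class_forcing C P le one.
Hypothesis hU : uniform_forcing_theorem M C P le one.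

Let CP := cf_dom_class hP.
Let Cle := cf_le_class hP.
Let CN := C_names hM CP.
Let M1 : M one := C_sub hM CP (cf_one hP).

Definition uforced : set V := [set z | exists p phi,
  [/\ P p, wf_ifml M P phi, z = ⟨p, code phi⟩ & iforces C P le one phi p]].

Let CU : C uforced := hU.1.

Lemma uforcedE p phi : P p -> wf_ifml M P phi ->
  uforced ⟨p, code phi⟩ <-> iforces C P le one phi p.
Proof.
move=> Pp wphi; split=> [[p' [phi' [_ _ /opair_inj[-> /code_inj->]]]]//|h].
by exists p, phi.
Qed.

Lemma sat0_all G n (phi : formula 0 n.+1) (s : n.-tuple V) :
  sat0 (generic_ext M P G) (fAll phi) (val_tuple G s) <->
  forall x, names M P x -> sat0 (generic_ext M P G) phi (val_tuple G [tuple of x :: s]).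
Proof.
have E x : val_tuple G [tuple of x :: s] = [tuple of nval G x :: val_tuple G s].
  exact: val_inj.
rewrite /sat0 /=; split=> [h x nx|h _ [x nx <-]].
  by rewrite E; apply: h; exists x.
by rewrite -E; apply: h.
Qed.

Lemma forces_mono m (phi : formula 0 m) p q s :
  le ⟨q, p⟩ -> forces M C P le phi p s -> forces M C P le phi q s.
Proof. by move=> qp h G gG Gq; apply: h => //; apply: (generic_up hP gG Gq qp). Qed.

Definition forces_def m (phi : formula 0 m) (Q : (nat -> V) -> Prop) : Prop :=
  Def M C Q /\ forall e, Menv M e -> P (e 0) -> (forall i, i < m -> names M P (e i.+1)) ->
  Q e <-> forces M C P le phi (e 0) (etuple m (fun i => e i.+1)).

(** Beyond the tuple, the value [one] keeps the environment inside [M]. *)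
Definition tuple_env m (s : m.-tuple V) (i : nat) : V := nth one s i.

Lemma tuple_envE m (s : m.-tuple V) : etuple m (tuple_env s) = s.
Proof.
by apply: eq_from_tnth => i; rewrite tnth_mktuple /tuple_env (tnth_nth one).
Qed.

Lemma Menv_tuple m (s : m.-tuple V) : all_in (names M P) s -> Menv M (tuple_env s).
Proof.
move=> ns i; rewrite /tuple_env; case: (ltnP i m) => im; last first.
  by rewrite nth_default // size_tuple.
by have [] := ns (Ordinal im); rewrite (tnth_nth one).
Qed.

Lemma forces_def_tuple m (phi : formula 0 m) Q p (s : m.-tuple V) :
  forces_def phi Q -> P p -> all_in (names M P) s ->
  Q (env_cons p (tuple_env s)) <-> forces M C P le phi p s.
Proof.
move=> [_ QP] Pp ns.
have Me := Menv_cons (C_sub hM CP Pp) (Menv_tuple ns).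
have ne i : i < m -> names M P (tuple_env s i).
  by move=> im; move: (ns (Ordinal im)); rewrite (tnth_nth one); apply.
have : Q (env_cons p (tuple_env s)) <-> forces M C P le phi p (etuple m (tuple_env s)).
  exact: QP _ Me Pp ne.
by rewrite tuple_envE.
Qed.

Definition Qnot (Q : (nat -> V) -> Prop) (e : nat -> V) : Prop :=
  forall q, M q -> P q /\ le ⟨q, e 0⟩ -> ~ Q (env_cons q (fun i => e i.+1)).

Lemma Def_Qnot Q : Def M C Q -> Def M C (Qnot Q).
Proof.
move=> dQ; apply: (@Def_all _ _ (fun e q => P q /\ le ⟨q, e 0⟩ ->
  ~ Q (env_cons q (fun i => e i.+1)))).
apply: Def_imp; first by df.
apply: Def_not; apply: Def_ext (Def_ren (fun i => if i is j.+1 then j.+2 else 0) dQ) => e _.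
suff -> : (fun i => e match i with 0 => 0 | j.+1 => j.+2 end) =
  env_cons (e 0) (fun i => e i.+2) by [].
by apply: funext => -[].
Qed.

(** That [p] forces the negation when no stronger condition forces [phi] rests on the truth lemma
    for [phi], so definability and truth must be proved together. Truth of the negation comes from
    the dense class of conditions satisfying [Q] or [Qnot Q]. *)
Lemma forces_not m (phi : formula 0 m) Q :
  forces_def phi Q -> truth_lemma M C P le phi ->
  forces_def (fNot phi) (Qnot Q) /\ truth_lemma M C P le (fNot phi).
Proof.
move=> [dQ QP] tl.
have nD : forces_def (fNot phi) (Qnot Q).
  split=> [|e Me Pe ne]; first exact: Def_Qnot.
  set s := etuple _ _; have ns : all_in (names M P) s.
    by move=> i; rewrite tnth_mktuple; apply: ne.
  have Qq q : P q -> Q (env_cons q (fun i => e i.+1)) <-> forces M C P le phi q s.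
    move=> Pq; have Mq := C_sub hM CP Pq.
    by apply: QP => //; apply: Menv_cons => // i.
  split=> [h G gG Gp hs|h q Mq [Pq qp] /(Qq _ Pq) hq].
    have [q Gq hq] := tl s G ns gG hs.
    have [r [Gr rp rq]] := filter_dir gG.1 Gp Gq.
    have Pr := filter_sub gG.1 Gr.
    apply: (h r (C_sub hM CP Pr) (conj Pr rp)); apply/(Qq _ Pr).
    exact: forces_mono rq hq.
  have [G gG Gq] := generic_exists hM hP Pq.
  exact: (h G gG (generic_up hP gG Gq qp) (hq G gG Gq)).
split=> // s G ns gG nphi.
have [|p [Gp [Mp [Pp h]]]] := gG.2 _ (Def_compr hM
  (Q := fun e => P (e 0) /\ (Q e \/ Qnot Q e))
  (Def_and (Def_cls CP (DefT_var M C 0)) (Def_or dQ (Def_Qnot dQ))) (Menv_tuple ns)).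
  split=> [p [_ [Pp _]]//|p Pp].
  case: (EM (Qnot Q (env_cons p (tuple_env s)))) => [h|].
    exists p; last exact: (cf_refl hP).
    by split; [exact: (C_sub hM CP Pp)|split=> //; right].
  move=> /existsNP [q /not_implyP [Mq /not_implyP [[Pq qp] /contrapT h]]].
  exists q => //; split=> //; split=> //; left.
  exact: h.
have Pp' : P p := Pp; exists p => //.
case: h => [/(forces_def_tuple (conj dQ QP) Pp' ns) h|]; first by case: nphi; apply: h.
by move/(forces_def_tuple nD Pp' ns).
Qed.

(** The induction takes place outside the model, one formula at a time. Only the atomic cases appeal
    to the uniform theorem; quantifiers over names are treated directly. *)
Lemma forces_definable m (phi : formula 0 m) :
  (exists Q, forces_def phi Q) /\ truth_lemma M C P le phi.
Proof.
elim: phi => {m} [m i j|m i j|m i [//]|m phi [[Q QP] tl]|m phi [[Q QP] tl] psi [[R RP] tl']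
                 |m phi [[Q QP] tl]].
- have M2 := M_vnat 2 hM; have fE p s : all_in (names M P) s ->
      forces M C P le (fMem 0 i j) p s <-> iforces C P le one (iMem (tnth s i) (tnth s j)) p.
    by move=> ns; split=> h G gG Gp; have := h G gG Gp; rewrite /sat0 /= !tnth_map.
  split.
    exists (fun e => uforced ⟨e 0, ⟨vnat 2, e i.+1, e j.+1⟩⟩); split=> [|e Me Pe ne]; first by df.
    have ns : all_in (names M P) (etuple m (fun i => e i.+1)).
      by move=> k; rewrite tnth_mktuple; apply: ne.
    rewrite (fE _ _ ns) !tnth_mktuple.
    exact: (@uforcedE (e 0) (iMem (e i.+1) (e j.+1)) Pe (conj (ne _ (ltn_ord i)) (ne _ (ltn_ord j)))).
  move=> s G ns gG h; have [||p Gp hp] := hU.2 (iMem (tnth s i) (tnth s j)) G _ gG.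
  + exact: conj (ns i) (ns j).
  + by move: h; rewrite /sat0 /= !tnth_map.
  by exists p => //; apply/fE.
- have M1' := M_vnat 1 hM; have fE p s : all_in (names M P) s ->
      forces M C P le (fEq 0 i j) p s <-> iforces C P le one (iEq (tnth s i) (tnth s j)) p.
    by move=> ns; split=> h G gG Gp; have := h G gG Gp; rewrite /sat0 /= !tnth_map.
  split.
    exists (fun e => uforced ⟨e 0, ⟨vnat 1, e i.+1, e j.+1⟩⟩); split=> [|e Me Pe ne]; first by df.
    have ns : all_in (names M P) (etuple m (fun i => e i.+1)).
      by move=> k; rewrite tnth_mktuple; apply: ne.
    rewrite (fE _ _ ns) !tnth_mktuple.
    exact: (@uforcedE (e 0) (iEq (e i.+1) (e j.+1)) Pe (conj (ne _ (ltn_ord i)) (ne _ (ltn_ord j)))).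
  move=> s G ns gG h; have [||p Gp hp] := hU.2 (iEq (tnth s i) (tnth s j)) G _ gG.
  + exact: conj (ns i) (ns j).
  + by move: h; rewrite /sat0 /= !tnth_map.
  by exists p => //; apply/fE.
- by have [dn tn] := forces_not QP tl; split=> //; exists (Qnot Q).
- split.
    exists (fun e => Q e /\ R e); split=> [|e Me Pe ne]; first exact: Def_and QP.1 RP.1.
    rewrite QP.2 // RP.2 //; split=> [[h h'] G gG Gp|h].
      by split; [apply: h|apply: h'].
    by split=> G gG Gp; have [] := h G gG Gp.
  move=> s G ns gG [h h']; have [p Gp hp] := tl s G ns gG h.
  have [q Gq hq] := tl' s G ns gG h'; have [r [Gr rp rq]] := filter_dir gG.1 Gp Gq.
  exists r => // G' gG' G'r.
  by split; [exact: (forces_mono rp hp)|exact: (forces_mono rq hq)].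
have [nD ntl] := forces_not QP tl.
(* The quantified name is variable 0 of the body, so it is inserted right after the condition. *)
pose ins (e : nat -> V) x := env_cons (e 0) (env_cons x (fun i => e i.+1)).
have dins Q' : Def M C Q' -> Def M C (fun e => Q' (ins (fun i => e i.+1) (e 0))).
  move=> dQ'.
  apply: Def_ext (Def_ren (fun i => match i with 0 => 1 | 1 => 0 | j => j end) dQ') => e _.
  suff -> : (fun i => e match i with 0 => 1 | 1 => 0 | j => j end) =
    ins (fun i => e i.+1) (e 0) by [].
  by apply: funext => -[|[]].
pose A e := forall x, M x -> names M P x -> Q (ins e x).
have dA : Def M C A.
  by apply: (@Def_all _ _ (fun e x => names M P x -> Q (ins e x)));
    apply: Def_imp; [df|apply: dins QP.1].
have insP (psi : formula 0 m.+1) R e x : forces_def psi R -> Menv M e -> P (e 0) ->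
    (forall i, i < m -> names M P (e i.+1)) -> names M P x ->
    R (ins e x) <-> forces M C P le psi (e 0) [tuple of x :: etuple m (fun i => e i.+1)].
  move=> [_ RP] Me Pe ne nx; rewrite etuple_cons; apply: RP; [|exact: Pe|].
    by case: nx => Mx _; do 2 apply: Menv_cons => //; move=> i.
  by case=> [|i] im; [exact: nx|exact: ne].
have AP : forces_def (fAll phi) A.
  split=> // e Me Pe ne; split=> [h G gG Gp|h x Mx nx].
    apply/sat0_all => x nx; have /(insP _ _ _ _ QP Me Pe ne nx) := h x nx.1 nx.
    exact.
  apply/(insP _ _ _ _ QP Me Pe ne nx) => G gG Gp.
  exact: (sat0_all _ _ _).1 (h G gG Gp) x nx.
split; first by exists A.
move=> s G ns gG h.
(* Forcing the universal statement or the negation of one instance is dense: a failing instance in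
   some extension is forced to fail, by the truth lemma for the negated body. *)
have dD : Def M C (fun e => P (e 0) /\ (A e \/ exists x, M x /\
    (names M P x /\ Qnot Q (ins e x)))).
  apply: Def_and; first by df.
  apply: Def_or => //; apply: (@Def_ex _ _ (fun e x => names M P x /\ Qnot Q (ins e x))).
  by apply: Def_and; [df|apply: dins nD.1].
have env p (Pp : P p) : [/\ Menv M (env_cons p (tuple_env s)), P (env_cons p (tuple_env s) 0)
    & forall i, i < m -> names M P (env_cons p (tuple_env s) i.+1)].
  split=> [||i im]; [exact: Menv_cons (C_sub hM CP Pp) (Menv_tuple ns)|exact: Pp|].
  by move: (ns (Ordinal im)); rewrite (tnth_nth one); apply.
have [|p [Gp [Mp [Pp]]]] := gG.2 _ (Def_compr hM dD (Menv_tuple ns)); last first.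
  have [Me Pe ne] := env p Pp; move=> [hA|[x [Mx [nx]]]].
    by exists p => //; apply/(forces_def_tuple AP Pp ns).
  move/(insP _ _ _ _ nD Me Pe ne nx) => /(_ G gG Gp); case.
  have := (sat0_all _ _ _).1 h x nx.
  have E : etuple m (fun i => env_cons p (tuple_env s) i.+1) = s := tuple_envE s.
  by rewrite E.
split=> [p [_ [Pp _]]//|p Pp].
case: (EM (forces M C P le (fAll phi) p s)) => [hp|].
  exists p; last exact: (cf_refl hP).
  split; first exact: (C_sub hM CP Pp).
  by split=> //; left; apply/(forces_def_tuple AP Pp ns).
move=> /existsNP [G' /not_implyP [gG' /not_implyP [G'p]]].
move=> nh; have /existsNP [x /not_implyP [nx hx]] : ~ forall x, names M P x ->
    sat0 (generic_ext M P G') phi (val_tuple G' [tuple of x :: s]).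
  by move=> H; apply: nh; apply/sat0_all.
have nxs : all_in (names M P) [tuple of x :: s].
  by move=> i; case: (unliftP ord0 i) => [j ->|->]; rewrite ?tnth0 ?tnthS.
have [q G'q hq] := ntl _ G' nxs gG' hx.
have [r [G'r rp rq]] := filter_dir gG'.1 G'p G'q; have Pr := filter_sub gG'.1 G'r.
have [Me Pe ne] := env r Pr.
exists r => //; split; first exact: (C_sub hM CP Pr).
split=> //; right; exists x; split; first by case: nx.
split=> //; apply/(insP _ _ _ _ nD Me Pe ne nx).
have E : etuple m (fun i => env_cons r (tuple_env s) i.+1) = s := tuple_envE s.
rewrite E; exact: forces_mono rq hq.
Qed.

Theorem forcing_theorem_all m (phi : formula 0 m) : forcing_theorem M C P le phi.
Proof.
have [[Q QP] tl] := forces_definable phi; split=> //.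
have d : Def M C (fun e => is_vtuple m (e 0) /\ P (vproj m (e 0) 0) /\
    (forall i, i < m -> names M P (vproj m (e 0) i.+1)) /\ Q (fun i => vproj m (e 0) i)).
  have dp i : DefT M C (fun e => vproj m (e 0) i) by apply: DefT_vproj; df.
  apply: Def_and; first by apply: Def_is_vtuple; df.
  apply: Def_and; first exact: Def_cls.
  apply: Def_and; last exact: (Def_substs QP.1 dp).
  by apply: Def_forall_lt => i; apply: Def_cls.
have Mp i z : M z -> M (vproj m z i).
  by move=> Mz; have := (DefT_vproj hM m i (DefT_var M C 0)).1 (fun=> z); apply.
have := Def_compr hM d (fun=> M1); congr C; rewrite predeqE => z; split.
  move=> [Mz [/is_vtupleP [p [s zE]] [Pz [nz Qz]]]].
  rewrite /= in zE Mz Pz nz Qz; subst z; have [E1 E2] := vproj_vtuple p s.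
  exists p, s; split; [by rewrite -E1| |by []|].
    by move=> i; rewrite -E2 tnth_mktuple; apply: nz (ltn_ord i).
  by have := (QP.2 (vproj m (vtuple p s)) (fun i => Mp i _ Mz) Pz nz).1 Qz; rewrite E1 E2.
move=> [p [s [Pp ns -> h]]]; have [E1 E2] := vproj_vtuple p s.
have Mz : M (vtuple p s).
  by apply: (M_vtuple hM (C_sub hM CP Pp)) => i; case: (ns i).
have nz i : i < m -> names M P (vproj m (vtuple p s) i.+1).
  by move=> im; move: (ns (Ordinal im)); rewrite -{1}E2 tnth_mktuple; apply.
have Pz : P (vproj m (vtuple p s) 0) by rewrite E1.
split; first exact: Mz.
split; first by apply/is_vtupleP; exists p, s.
split; [exact: Pz|split; first exact: nz].
by apply/(QP.2 (vproj m (vtuple p s)) (fun i => Mp i _ Mz) Pz nz); rewrite E1 E2.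
Qed.

End FirstOrder.

(** * Construction of the Boolean completion *)

Definition vtwo : V := upair vempty vone.

Definition bin (phi psi : ifml) (i : {i : V | i ∈ vtwo}) : ifml :=
  if `[< sval i = vempty >] then phi else psi.

Lemma vtwo0 : vempty ∈ vtwo. Proof. by apply/mem_upair; left. Qed.
Lemma vtwo1 : vone ∈ vtwo. Proof. by apply/mem_upair; right. Qed.

Definition two0 : {i : V | i ∈ vtwo} := exist (fun i => i ∈ vtwo) _ vtwo0.
Definition two1 : {i : V | i ∈ vtwo} := exist (fun i => i ∈ vtwo) _ vtwo1.

Lemma bin0 phi psi : bin phi psi two0 = phi.
Proof. by rewrite /bin; case: asboolP. Qed.

Lemma bin1 phi psi : bin phi psi two1 = psi.
Proof. by rewrite /bin; case: asboolP => //= /upair_neq0. Qed.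

Lemma two_cases (Q : {i : V | i ∈ vtwo} -> Prop) : Q two0 -> Q two1 -> forall i, Q i.
Proof.
move=> Q0 Q1 [i hi]; have := hi => /mem_upair [] E; subst i.
  by rewrite (Prop_irrelevance hi vtwo0).
by rewrite (Prop_irrelevance hi vtwo1).
Qed.

(** The family of a binary conjunction or disjunction as an explicit set term in the two codes; the
    graphs of meet and join are definable through it. *)
Definition bin_code (c d : V) : V := upair ⟨vempty, c⟩ ⟨vone, d⟩.

Lemma family_bin phi psi :
  family (fun i => code (bin phi psi i)) = bin_code (code phi) (code psi).
Proof.
apply: V_ext => z; rewrite mem_family mem_upair; split.
  move=> [i ->]; move: i; apply: two_cases; first by left; rewrite bin0.
  by right; rewrite bin1.
by move=> [->|->]; [exists two0; rewrite bin0|exists two1; rewrite bin1].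
Qed.

Definition iand (phi psi : ifml) : ifml := iAnd (bin phi psi).
Definition ior (phi psi : ifml) : ifml := iOr (bin phi psi).

Lemma isat_iand one G phi psi :
  isat one G (iand phi psi) <-> isat one G phi /\ isat one G psi.
Proof.
split=> [/= h|[h h']]; last by apply: two_cases; rewrite ?bin0 ?bin1.
by split; [have := h two0|have := h two1]; rewrite ?bin0 ?bin1.
Qed.

Lemma isat_ior one G phi psi :
  isat one G (ior phi psi) <-> isat one G phi \/ isat one G psi.
Proof.
split=> [/= [i]|[h|h]]; [|by exists two0; rewrite bin0|by exists two1; rewrite bin1].
by move: i; apply: two_cases; rewrite ?bin0 ?bin1; [left|right].
Qed.

Definition ifalse : ifml := @iOr vempty (fun i => iNot (iGen (sval i))).
Definition itrue : ifml := iNot ifalse.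

Lemma isat_ifalse one G : ~ isat one G ifalse.
Proof. by move=> [[i h]]; case: (not_mem_vempty h). Qed.

(** * Boolean laws through a representation by sets *)

Section AlgebraOfSets.
Variables (T : Type) (U : set T) (val : V -> set T) (A : set V).
Variables (meet join : V -> V -> V) (compl : V -> V) (bot top : V).
Hypothesis Am : forall a b, A (meet a b).
Hypothesis Aj : forall a b, A (join a b).
Hypothesis Ac : forall a, A (compl a).
Hypothesis A0 : A bot.
Hypothesis A1 : A top.
Hypothesis val_sub : forall a, val a `<=` U.
Hypothesis val_inj : forall a b, A a -> A b -> val a = val b -> a = b.
Hypothesis val_meet : forall a b, val (meet a b) = val a `&` val b.
Hypothesis val_join : forall a b, val (join a b) = val a `|` val b.
Hypothesis val_compl : forall a, val (compl a) = U `\` val a.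
Hypothesis val_bot : val bot = set0.
Hypothesis val_top : val top = U.

(** Since [val] is injective on [A], each law reduces to an identity of sets. In the application [U]
    consists of the generic filters, and [val a] of those in which a formula representing [a]
    holds. *)
Lemma boolean_algebra_of_sets : boolean_algebra A meet join compl bot top.
Proof.
split=> //; intros; apply: val_inj => //;
  rewrite ?(val_meet, val_join, val_compl, val_bot, val_top).
- exact: setIC.
- exact: setUC.
- exact: setIA.
- exact: setUA.
- by apply/setIidPl; left.
- by apply/setUidPl => x [].
- exact: setIUr.
- exact: setUIr.
- exact: setDIK.
- exact/setDUK/val_sub.
Qed.

Lemma ba_le_of_sets a b : A a -> A b -> ba_le meet a b <-> val a `<=` val b.
Proof.
move=> Aa Ab; rewrite /ba_le -setIidPl -val_meet; split=> [->//|].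
exact: val_inj.
Qed.

End AlgebraOfSets.

Section Completion.
Variables (M : set V) (C : set (set V)) (P le : set V) (one : V).
Hypothesis hM : ctm_GBm M C.
Hypothesis hP : class_forcing C P le one.
Hypothesis hU : uniform_forcing_theorem M C P le one.

Let CP := cf_dom_class hP.
Let M1 : M one := C_sub hM CP (cf_one hP).
Let CU : C (uforced M C P le one) := hU.1.

Local Notation wf := (wf_ifml M P).
Local Notation gen := (generic C P le).

Lemma M_vone : M vone.
Proof. by apply: (M_upair hM); apply: M_empty hM. Qed.

Lemma M_vtwo : M vtwo.
Proof. by apply: (M_upair hM); [apply: M_empty hM|apply: M_vone]. Qed.

Lemma M_bin phi psi : wf phi -> wf psi -> M (family (fun i => code (bin phi psi i))).
Proof.
move=> wphi wpsi; have Mc := M_code hM hP wphi; have Md := M_code hM hP wpsi.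
rewrite family_bin; apply: (M_upair hM); apply: (M_opair hM) => //; first exact: M_empty hM.
exact: M_vone.
Qed.

Lemma wf_iand phi psi : wf phi -> wf psi -> wf (iand phi psi).
Proof.
move=> wphi wpsi; split; [exact: M_vtwo|exact: M_bin|].
by apply: two_cases; rewrite ?bin0 ?bin1.
Qed.

Lemma wf_ior phi psi : wf phi -> wf psi -> wf (ior phi psi).
Proof.
move=> wphi wpsi; split; [exact: M_vtwo|exact: M_bin|].
by apply: two_cases; rewrite ?bin0 ?bin1.
Qed.

Lemma wf_ifalse : wf ifalse.
Proof.
split; [exact: M_empty hM| |by move=> [i h]; case: (not_mem_vempty h)].
suff -> : family (fun i : {i | i ∈ vempty} => code (iNot (iGen (sval i)))) = vempty.
  exact: M_empty hM.
apply: V_ext => z; split=> [/mem_family [[i h]]|/not_mem_vempty//].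
by case: (not_mem_vempty h).
Qed.

Definition is_code (c : V) : Prop := exists2 phi, wf phi & code phi = c.

(** The class of codes is recovered from the forcing class: in a given extension the formula or its
    negation is true, hence forced by some condition. *)
Lemma is_codeP c : is_code c <-> exists p, P p /\
  (uforced M C P le one ⟨p, c⟩ \/ uforced M C P le one ⟨p, vnat 3, c⟩).
Proof.
split=> [[phi wphi <-]|[p [Pp [[p' [phi [_ wphi /opair_inj[_ ->] _]]]|]]]]; last 2 first.
- by exists phi.
- move=> [p' [phi [_ wphi /opair_inj[_ E] _]]].
  case: phi wphi E => [q|s t|s t|phi|J phi|J phi] wphi /opair_inj[/vnat_inj E];
    try discriminate E.
  by move=> ->; exists phi.
have [G gG _] := generic_exists hM hP (cf_one hP).
have wn : wf (iNot phi) := wphi.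
case: (EM (isat one G phi)) => h.
  have [p Gp hp] := hU.2 phi G wphi gG h; have Pp := filter_sub gG.1 Gp.
  by exists p; split=> //; left; apply/uforcedE.
have [p Gp hp] := hU.2 (iNot phi) G wn gG h; have Pp := filter_sub gG.1 Gp.
by exists p; split=> //; right; apply/(uforcedE _ _ _ Pp wn).
Qed.

Definition iequiv (phi psi : ifml) : Prop :=
  forall G, gen G -> isat one G phi <-> isat one G psi.

(** By the truth lemma, holding in an extension means being forced by a condition of the filter.
    Equivalence in all extensions thereby becomes a first-order statement about the forcing
    class. *)
Lemma iequivP phi psi : wf phi -> wf psi -> iequiv phi psi <-> forall p, P p ->
  uforced M C P le one ⟨p, code phi⟩ <-> uforced M C P le one ⟨p, code psi⟩.
Proof.
move=> wphi wpsi; split=> [h p Pp|h].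
  by split=> /(uforcedE _ _ _) H; apply/uforcedE => // G gG Gp; apply/h => //; apply: H.
have half a b G : wf a -> wf b -> gen G -> (forall p, P p ->
    uforced M C P le one ⟨p, code a⟩ -> uforced M C P le one ⟨p, code b⟩) ->
    isat one G a -> isat one G b.
  move=> wa wb gG H /(hU.2 a G wa gG) [p Gp ha]; have Pp := filter_sub gG.1 Gp.
  have /(uforcedE _ _ _ Pp wb) : uforced M C P le one ⟨p, code b⟩ by apply: H => //; apply/uforcedE.
  exact.
by move=> G gG; split; apply: half => // p Pp; apply h.
Qed.

Definition code_equiv : set V := [set z | exists phi psi,
  [/\ wf phi, wf psi, z = ⟨code phi, code psi⟩ & iequiv phi psi]].

Lemma code_equivE phi psi : wf phi -> wf psi ->
  code_equiv ⟨code phi, code psi⟩ <-> iequiv phi psi.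
Proof.
move=> wphi wpsi; split=> [|h]; last by exists phi, psi.
by move=> [phi' [psi' [_ _ /opair_inj[/code_inj-> /code_inj->]]]].
Qed.

Lemma Def_is_code t : DefT M C t -> Def M C (fun e => is_code (t e)).
Proof.
move=> dt; have M3 := M_vnat 3 hM.
have d : Def M C (fun e => exists p, P p /\ (uforced M C P le one ⟨p, e 0⟩ \/
    uforced M C P le one ⟨p, vnat 3, e 0⟩)).
  apply: Def_exb; last by df.
  by move=> e p _ [/(C_sub hM CP)].
apply: (@Def_subst _ _ (fun _ c => is_code c)) dt.
by apply: Def_ext d => e _; rewrite is_codeP.
Qed.

Lemma C_code_equiv : C code_equiv.
Proof.
have d : Def M C (fun e => e 0 = ⟨vfst (e 0), vsnd (e 0)⟩ /\
   (is_code (vfst (e 0)) /\ (is_code (vsnd (e 0)) /\ forall p, M p -> P p ->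
   (uforced M C P le one ⟨p, vfst (e 0)⟩ <-> uforced M C P le one ⟨p, vsnd (e 0)⟩)))).
  apply: Def_and; first by df.
  apply: Def_and; first by apply: Def_is_code; df.
  apply: Def_and; first by apply: Def_is_code; df.
  apply: (@Def_all _ _ (fun e p => P p -> (uforced M C P le one ⟨p, vfst (e 0)⟩ <->
    uforced M C P le one ⟨p, vsnd (e 0)⟩))).
  by df.
have := Def_compr hM d (fun=> M1); congr C; rewrite predeqE => z; split.
  move=> [Mz [/= zE [[phi wphi phiE] [[psi wpsi psiE] h]]]].
  exists phi, psi; rewrite phiE psiE; split=> //; apply/iequivP => // p Pp.
  by rewrite phiE psiE; apply: h => //; apply: (C_sub hM CP Pp).
move=> [phi [psi [wphi wpsi -> h]]]; have Mc := M_code hM hP wphi.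
have Md := M_code hM hP wpsi; split; first exact: (M_opair hM).
rewrite /= vfstE vsndE; split=> //; split; first by exists phi.
by split=> [|p _ Pp]; [exists psi|exact: ((iequivP wphi wpsi).1 h p Pp)].
Qed.

Lemma code_equiv_dom c : domr code_equiv c <-> is_code c.
Proof.
split=> [[d [phi [psi [wphi _ /opair_inj[-> _] _]]]]|[phi wphi <-]]; first by exists phi.
by exists (code phi), phi, phi; split.
Qed.

Lemma code_equiv_is_equiv : is_equiv code_equiv.
Proof.
split.
- by move=> z [phi [psi [_ _ -> _]]]; exists (code phi), (code psi).
- by move=> c /code_equiv_dom [phi wphi <-]; apply/code_equivE.
- move=> c d [phi [psi [wphi wpsi /opair_inj[-> ->] h]]]; apply/code_equivE => // G gG.
  by rewrite h.
- move=> c d e [phi [psi [wphi wpsi /opair_inj[-> ->] h]]].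
  move=> [psi' [chi [_ wchi /opair_inj[/code_inj<- ->] h']]].
  by apply/code_equivE => // G gG; rewrite h // h'.
Qed.

Hypothesis hrep : rep_choice C.

Lemma completion_exists : separative P le -> antisymmetric_po le ->
  has_boolean_completion M C P le.
Proof.
move=> hsep hanti.
have [A [q [CA Cq [[_ qfun] qdom qran qE]]]] := hrep C_code_equiv code_equiv_is_equiv.
pose cl phi := the (fun a => q ⟨code phi, a⟩).
have qcode c a : q ⟨c, a⟩ -> is_code c.
  by move=> h; apply/code_equiv_dom; rewrite -qdom; exists a.
have clP phi : wf phi -> q ⟨code phi, cl phi⟩.
  move=> wphi; apply: (theP (Q := fun a => q ⟨code phi, a⟩)).
  have : domr q (code phi) by rewrite qdom; apply/code_equiv_dom; exists phi.
  by [].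
have clq phi a : q ⟨code phi, a⟩ -> cl phi = a.
  by move=> h; apply: the_eq h => y y'; apply: qfun.
have Acl phi : wf phi -> A (cl phi).
  by move=> wphi; rewrite -qran; exists (code phi); apply: clP.
have clE phi psi : wf phi -> wf psi -> cl phi = cl psi <-> iequiv phi psi.
  move=> wphi wpsi; rewrite -code_equivE //.
  have dphi : domr code_equiv (code phi) by apply/code_equiv_dom; exists phi.
  have dpsi : domr code_equiv (code psi) by apply/code_equiv_dom; exists psi.
  rewrite (qE _ _ dphi dpsi); split=> [E|[z /clq-> /clq->]//].
  by exists (cl phi); [|rewrite E]; apply: clP.
(* The representing formulas are chosen outside the model. The value [ifalse] for sets outside [A]
   keeps the operations defined below total, with values in [A]. *)
have /choice [F FP] (a : V) : exists phi, wf phi /\ (A a -> q ⟨code phi, a⟩).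
  case: (EM (A a)) => [|nA]; last by exists ifalse; split; [exact: wf_ifalse|].
  rewrite -qran => -[c ca]; have [phi wphi phiE] := qcode _ _ ca.
  by exists phi; rewrite phiE.
have wF a : wf (F a) by case: (FP a).
have clF a : A a -> cl (F a) = a by move=> Aa; apply: clq; case: (FP a) => _; apply.
pose val a := [set G | gen G /\ isat one G (F a)].
have val_cl phi : wf phi -> val (cl phi) = [set G | gen G /\ isat one G phi].
  move=> wphi; have /clE h : cl (F (cl phi)) = cl phi by apply: clF; apply: Acl.
  by rewrite predeqE => G; split=> -[gG iG]; split=> //; apply/(h (wF _) wphi _ gG).
have val_inj a b : A a -> A b -> val a = val b -> a = b.
  move=> Aa Ab E; rewrite -(clF a) // -(clF b) //; apply/clE => // G gG.
  by split=> h; [have : val a G by []; rewrite E|have : val b G by []; rewrite -E] => -[].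
have val_sub a : val a `<=` gen by move=> G [].
have wmeet a b : wf (iand (F a) (F b)) by apply: wf_iand.
have wjoin a b : wf (ior (F a) (F b)) by apply: wf_ior.
have wcompl a : wf (iNot (F a)) by apply: wF.
have wtop : wf itrue by apply: wf_ifalse.
have [meet meetE] : exists meet, forall a b, meet a b = cl (iand (F a) (F b)).
  exact: (ex_intro _ (fun a b => cl (iand (F a) (F b))) (fun _ _ => erefl)).
have [join joinE] : exists join, forall a b, join a b = cl (ior (F a) (F b)).
  exact: (ex_intro _ (fun a b => cl (ior (F a) (F b))) (fun _ _ => erefl)).
have [compl complE] : exists compl, forall a, compl a = cl (iNot (F a)).
  exact: (ex_intro _ (fun a => cl (iNot (F a))) (fun=> erefl)).
have Am a b : A (meet a b) by rewrite meetE; apply: Acl.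
have Aj a b : A (join a b) by rewrite joinE; apply: Acl.
have Ac a : A (compl a) by rewrite complE; apply: (Acl _ (wcompl a)).
have A0 : A (cl ifalse) by apply: (Acl _ wf_ifalse).
have A1 : A (cl itrue) by apply: (Acl _ wtop).
have vm a b : val (meet a b) = val a `&` val b.
  rewrite meetE val_cl //; apply/seteqP; split=> G.
    by move=> [gG /isat_iand[ha hb]]; split.
  by move=> [[gG ha] [_ hb]]; split=> //; apply/isat_iand.
have vj a b : val (join a b) = val a `|` val b.
  rewrite joinE val_cl //; apply/seteqP; split=> G.
    by move=> [gG /isat_ior[h|h]]; [left|right].
  by move=> [[gG h]|[gG h]]; split=> //; apply/isat_ior; [left|right].
have vc a : val (compl a) = gen `\` val a.
  rewrite complE (val_cl _ (wcompl a)); apply/seteqP; split=> G [gG h]; split=> //.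
    by move=> [].
  by move=> h'; apply: h.
have v0 : val (cl ifalse) = set0.
  by rewrite (val_cl _ wf_ifalse); apply/seteqP; split=> G // [_ /isat_ifalse].
have v1 : val (cl itrue) = gen.
  rewrite (val_cl _ wtop); apply/seteqP; split=> G [] // gG; split=> //.
  exact: isat_ifalse.
have hB := boolean_algebra_of_sets Am Aj Ac A0 A1 val_sub val_inj vm vj vc v0 v1.
have ble := ba_le_of_sets Am val_inj vm.
have vpi p G : P p -> gen G -> val (cl (iGen p)) G <-> G p.
  move=> Pp gG; rewrite (val_cl (iGen p)) //= (nval_check hP _ gG).
  by split=> [[]|].
have qA c x : q ⟨c, x⟩ -> A x by move=> h; rewrite -qran; exists c.
have qF a : A a -> q ⟨code (F a), a⟩ by case: (FP a).
have qinv c x : q ⟨c, x⟩ -> exists phi, [/\ wf phi, c = code phi & cl phi = x].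
  move=> h; have [phi wphi E] := qcode _ _ h; exists phi; split=> //.
  by apply: clq; rewrite E.
(* The choice [F] lives outside the model, so the graph is described by quantifying over all codes
   that [q] sends to the arguments; by [econ] the result does not depend on these codes. *)
have C_graph2 k con op : (forall phi psi, code (con phi psi) =
      ⟨vnat k, vtwo, bin_code (code phi) (code psi)⟩) ->
    (forall phi psi, wf phi -> wf psi -> wf (con phi psi)) ->
    (forall phi psi phi' psi', iequiv phi phi' -> iequiv psi psi' ->
      iequiv (con phi psi) (con phi' psi')) ->
    (forall a b, op a b = cl (con (F a) (F b))) -> C (graph2 A op).
  move=> ccon wcon econ opE.
  have [Mk [M2 [Mv0 Mv1]]] : M (vnat k) /\ M vtwo /\ M vempty /\ M vone.
    by split; [apply: M_vnat hM|split; [exact: M_vtwo|split; [exact: M_empty hM|exact: M_vone]]].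
  have d : Def M C (fun e => e 0 = ⟨⟨vfst (vfst (e 0)), vsnd (vfst (e 0))⟩, vsnd (e 0)⟩ /\
      exists c, M c /\ exists d, M d /\ (q ⟨c, vfst (vfst (e 0))⟩ /\
      (q ⟨d, vsnd (vfst (e 0))⟩ /\
       q ⟨⟨vnat k, vtwo, upair ⟨vempty, c⟩ ⟨vone, d⟩⟩, vsnd (e 0)⟩))) by df.
  have := Def_compr hM d (fun=> M1); congr C; rewrite predeqE => z; split.
    move=> [Mz [/= zE [c [Mc [d' [Md [h1 [h2 h3]]]]]]]].
    exists (vfst (vfst z)), (vsnd (vfst z)); split; [exact: qA h1|exact: qA h2|].
    rewrite {1}zE; congr ⟨_, _⟩; rewrite opE.
    have [phi [wphi cE phiE]] := qinv _ _ h1; have [psi [wpsi dE psiE]] := qinv _ _ h2.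
    have h3' : q ⟨code (con phi psi), vsnd z⟩ by rewrite ccon -cE -dE.
    rewrite -(clq _ _ h3'); apply/clE; [exact: wcon|exact: wcon|].
    by apply: econ; apply/clE => //; rewrite clF ?phiE ?psiE //; [exact: qA h1|exact: qA h2].
  move=> [a [b [Aa Ab ->]]]; have Ma := C_sub hM CA Aa; have Mb := C_sub hM CA Ab.
  have wc := wcon _ _ (wF a) (wF b).
  have Mab : M (op a b) by rewrite opE; apply: (C_sub hM CA (Acl _ wc)).
  split; first by do 2 apply: (M_opair hM) => //.
  rewrite /= !vfstE !vsndE; split=> //.
  exists (code (F a)); split; first exact: (M_code hM hP (wF a)).
  exists (code (F b)); split; first exact: (M_code hM hP (wF b)).
  split; first exact: qF.
  split; first exact: qF.
  by have := clP _ wc; rewrite ccon -opE.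
have Ccompl : C (graph1 A compl).
  have M3 := M_vnat 3 hM.
  have d : Def M C (fun e => e 0 = ⟨vfst (e 0), vsnd (e 0)⟩ /\
      exists c, M c /\ (q ⟨c, vfst (e 0)⟩ /\ q ⟨⟨vnat 3, c⟩, vsnd (e 0)⟩)) by df.
  have := Def_compr hM d (fun=> M1); congr C; rewrite predeqE => z; split.
    move=> [Mz [/= zE [c [Mc [h1 h2]]]]].
    exists (vfst z); first exact: qA h1.
    rewrite {1}zE; congr ⟨_, _⟩; rewrite complE.
    have [phi [wphi cE phiE]] := qinv _ _ h1.
    have h2' : q ⟨code (iNot phi), vsnd z⟩ by rewrite /= -cE.
    rewrite -(clq _ _ h2'); apply/clE; [exact: wphi|exact: (wF (vfst z))|] => G gG /=.
    have E : iequiv phi (F (vfst z)).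
      by apply/clE => //; rewrite phiE clF //; apply: qA h1.
    by have [E1 E2] := E G gG; split=> [h /E2|h /E1].
  move=> [a Aa ->]; have Ma := C_sub hM CA Aa.
  split; first by apply: (M_opair hM) => //; apply: (C_sub hM CA (Ac a)).
  rewrite /= vfstE vsndE; split=> //.
  exists (code (F a)); split; first exact: (M_code hM hP (wF a)).
  split; first exact: qF.
  by rewrite complE; apply: (clP _ (wcompl a)).
have Cpi : C (graph1 P (fun p => cl (iGen p))).
  have M0 := M_vnat 0 hM.
  have d : Def M C (fun e => e 0 = ⟨vfst (e 0), vsnd (e 0)⟩ /\
      (P (vfst (e 0)) /\ q ⟨⟨vnat 0, vfst (e 0)⟩, vsnd (e 0)⟩)) by df.
  have := Def_compr hM d (fun=> M1); congr C; rewrite predeqE => z; split.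
    move=> [Mz [/= zE [Pz h]]]; exists (vfst z) => //.
    by rewrite {1}zE; congr ⟨_, _⟩; apply/esym/clq.
  move=> [p Pp ->]; have Mp := C_sub hM CP Pp; have wp : wf (iGen p) := Pp.
  split; first by apply: (M_opair hM) => //; apply: (C_sub hM CA (Acl _ wp)).
  by rewrite /= vfstE vsndE; split=> //; split=> //; apply: (clP _ wp).
have hcomplete : M_complete M A meet.
  move=> a Ma aA.
  pose R := [set z | M z /\ (z = ⟨vfst z, vsnd z⟩ /\ q ⟨vsnd z, vfst z⟩)].
  have CR : C R.
    by apply: (@Def_compr _ _ hM (fun e => e 0 = ⟨vfst (e 0), vsnd (e 0)⟩ /\
      q ⟨vsnd (e 0), vfst (e 0)⟩)) (fun=> M1); df.
  have [|b Mb bP] := M_collect hM CR Ma.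
    move=> x xa; have Ax := aA x xa; exists (code (F x)); split.
      by apply: (M_opair hM); [exact: (M_trans hM Ma xa)|exact: (M_code hM hP (wF x))].
    by rewrite vfstE vsndE; split=> //; apply: qF.
  (* Picking one code for each element of [a] would call for choice in [M]. Instead the disjunction
     runs over all codes in [b] representing an element of [a], each code being its own index. *)
  pose I := vsep b (fun c => exists2 x, x ∈ a & q ⟨c, x⟩).
  have MI : M I.
    have d : DefT M C (fun e => vsep b (fun c => exists2 x, x ∈ a & q ⟨c, x⟩)) by df.
    exact: (d.1 (fun=> one) (fun=> M1)).
  have /choice [phi phiP] (i : {c | c ∈ I}) : exists psi, wf psi /\ code psi = sval i.
    have /mem_vsep [_ [x _ /qcode [psi wpsi E]]] := svalP i.
    by exists psi.
  have wor : wf (iOr phi).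
    split=> // [|i]; last by case: (phiP i).
    have -> : family (fun i => code (phi i)) = vimg I (fun c => ⟨c, c⟩).
      apply: V_ext => z; rewrite mem_family mem_vimg; split=> [[i ->]|[c cI ->]].
        by exists (sval i); [exact: (svalP i)|have [_ ->] := phiP i].
      pose i : {c | c ∈ I} := exist (fun c => c ∈ I) c cI.
      by exists i; have [_ ->] := phiP i.
    have d : DefT M C (fun e => vimg I (fun c => ⟨c, c⟩)) by df.
    exact: (d.1 (fun=> one) (fun=> M1)).
  have vor G : val (cl (iOr phi)) G <-> exists2 x, x ∈ a & val x G.
    have phix i x : q ⟨sval i, x⟩ -> cl (phi i) = x.
      by move=> h; apply: clq; have [_ ->] := phiP i.
    rewrite (val_cl _ wor); split=> [[gG [i hi]]|[x xa vx]].
      have /mem_vsep [_ [x xa ix]] := svalP i; exists x => //.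
      by rewrite -(phix i x ix) val_cl //; case: (phiP i).
    have gG := val_sub _ _ vx; split=> //.
    have [c cb [_ [_]]] := bP x xa; rewrite vfstE vsndE => cx.
    have cI : c ∈ I by apply/mem_vsep; split=> //; exists x.
    pose i : {c | c ∈ I} := exist (fun c => c ∈ I) c cI.
    exists i; move: vx; rewrite -(phix i x cx) val_cl; last by case: (phiP i).
    by case.
  exists (cl (iOr phi)); split.
  - exact: Acl.
  - move=> x xa; apply/ble; [exact: aA|exact: Acl|] => G vx.
    by apply/vor; exists x.
  - move=> y Ay ub; apply/ble; [exact: Acl|exact: Ay|] => G /vor [x xa vx].
    by have /(ble _ _ (aA x xa) Ay) := ub x xa; apply.
exists A, meet, join, compl, (cl ifalse), (cl itrue), (fun p => cl (iGen p)); split.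
- exact: hB.
- exact: hcomplete.
- split=> //.
  + apply: (C_graph2 5 iand) => //; [by move=> phi psi; rewrite /= family_bin|exact: wf_iand|].
    by move=> phi psi phi' psi' h h' G gG; rewrite !isat_iand h // h'.
  + apply: (C_graph2 4 ior) => //; [by move=> phi psi; rewrite /= family_bin|exact: wf_ior|].
    by move=> phi psi phi' psi' h h' G gG; rewrite !isat_ior h // h'.
- split.
  + move=> p Pp; split=> [|E]; first exact: Acl.
    have [G gG Gp] := generic_exists hM hP Pp.
    by have /(vpi p G Pp gG) := Gp; rewrite E v0.
  (* If one condition is not below the other, separativity gives an extension of the first
     incompatible with the second, and a generic filter through it separates the two elements. *)
  + move=> p p' Pp Pp' E; apply: hanti; apply: contrapT.
      move=> /(hsep _ _ Pp Pp') [r [Pr rp nr]].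
      have [G gG Gr] := generic_exists hM hP Pr.
      have Gp := generic_up hP gG Gr rp.
      apply: (incompatible_generic gG Gr nr).
      by apply/(vpi p' G Pp' gG); rewrite -E; apply/vpi.
    move=> /(hsep _ _ Pp' Pp) [r [Pr rp nr]].
    have [G gG Gr] := generic_exists hM hP Pr.
    have Gp := generic_up hP gG Gr rp.
    apply: (incompatible_generic gG Gr nr).
    by apply/(vpi p G Pp gG); rewrite E; apply/vpi.
  + move=> p p' Pp Pp'; have wp : wf (iGen p) := Pp; have wp' : wf (iGen p') := Pp'.
    rewrite ble; [|exact: Acl|exact: Acl]; split=> [pp' G h|h].
      have gG := val_sub _ _ h; apply/vpi => //.
      by apply: (generic_up hP gG _ pp'); apply/(vpi p G Pp gG).
    apply: contrapT => /(hsep _ _ Pp Pp') [r [Pr rp nr]].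
    have [G gG Gr] := generic_exists hM hP Pr.
    apply: (incompatible_generic gG Gr nr).
    apply/(vpi p' G Pp' gG); apply: h; apply/(vpi p G Pp gG).
    exact: (generic_up hP gG Gr rp).
  + move=> b Ab b0.
    (* A nonzero element is true in some extension, and a condition forcing its formula is mapped
       below it. *)
    case: (EM (exists G, val b G)) => [[G [gG hb]]|nb]; last first.
      case: b0; apply: val_inj => //; rewrite v0 predeqE => G.
      by split=> // vb; apply: nb; exists G.
    have [p Gp fp] := hU.2 (F b) G (wF b) gG hb; have Pp := filter_sub gG.1 Gp.
    exists p; [exact: Pp|apply/ble; [exact: Acl|exact: Ab|]] => G' h; have gG' := val_sub _ _ h; split=> //.
    by apply: fp => //; apply/(vpi p G' Pp gG').
- exact: Cpi.
Qed.

End Completion.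

(** * From definability of one atomic formula to the uniform forcing theorem *)

Section AtomicDefinability.
Variables (M : set V) (C : set (set V)) (P le : set V) (one : V).
Hypothesis hM : ctm_GBm M C.
Hypothesis hP : class_forcing C P le one.

Let CP := cf_dom_class hP.
Let M1 : M one := C_sub hM CP (cf_one hP).

Definition forced_class (phi : formula 0 2) : set V :=
  [set z | exists p (s : 2.-tuple V),
       [/\ P p, all_in (names M P) s, z = vtuple p s & forces M C P le phi p s]].

Lemma forced_classE phi p s t : P p -> names M P s -> names M P t ->
  forced_class phi ⟨p, s, t⟩ <-> forces M C P le phi p [tuple s; t].
Proof.
move=> Pp ns nt; split=> [[p' [u [_ _ E h]]]|h]; last first.
  exists p, [tuple s; t]; split; [exact: Pp| |by []|exact: h].
  by move=> i; case: (unliftP ord0 i) => [j ->|->]; rewrite ?tnth0 ?tnthS ?ord1;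
    [exact: nt|exact: ns].
case: u E h => -[|a [|b []]] //= ab /opair_inj[<- /opair_inj[sa tb]] h.
suff -> : [tuple s; t] = @Tuple 2 V [:: a; b] ab by [].
by apply: val_inj; rewrite /= sa tb.
Qed.

Lemma uniform_of_eq_definability :
  definability_lemma M C P le v0_eq_v1 -> uniform_forcing_theorem M C P le one.
Proof.
move=> CE; apply: (name_uniform_forcing hM hP (FE := forced_class v0_eq_v1)) => //.
move=> p s t Pp ns nt; exact: (forced_classE _ Pp ns nt).
Qed.

(* The equation of s and t is the statement that s is a member of {<t, 1>}. *)
Lemma uniform_of_mem_definability :
  definability_lemma M C P le v0_in_v1 -> uniform_forcing_theorem M C P le one.
Proof.
move=> CE; have CE' : C (forced_class v0_in_v1) := CE.
have dp := DefT_npair hM hP.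
have d : Def M C (fun e => forced_class v0_in_v1 ⟨vfst (e 0), vfst (vsnd (e 0)),
    npair one (vsnd (vsnd (e 0))) (vsnd (vsnd (e 0)))⟩) by df.
apply: (name_uniform_forcing hM hP (Def_compr hM d (fun=> M1))).
move=> p s t Pp ns nt; have ntt := name_pair hM hP nt nt.
have Mz : M ⟨p, s, t⟩.
  apply: (M_opair hM); first exact: (C_sub hM CP Pp).
  by apply: (M_opair hM); [case: ns|case: nt].
have E := forced_classE v0_in_v1 Pp ns ntt.
split=> [[_]|h].
  rewrite /env_cons !vsndE !vfstE => /E h G gG Gp.
  have := h G gG Gp; rewrite /sat0 /= !tnth_map /=.
  by rewrite (nval_pair hP _ _ gG) => /mem_upair[].
split=> //; rewrite /env_cons !vsndE !vfstE; apply/E => G gG Gp.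
rewrite /sat0 /= !tnth_map /= (nval_pair hP _ _ gG).
by apply/mem_upair; left; apply: h.
Qed.

End AtomicDefinability.

Theorem theorem5p5 (M : set V) (C : set (set V))
  (hM : ctm_GBm M C) (hrep : rep_choice C)
  (P le : set V) (one : V) (hP : class_forcing C P le one) :
  let st1 := definability_lemma M C P le v0_in_v1 \/
             definability_lemma M C P le v0_eq_v1 in
  let st2 := forall (m : nat) (phi : formula 0 m),
               forcing_theorem M C P le phi in
  let st3 := uniform_forcing_theorem M C P le one in
  let st4 := has_boolean_completion M C P le in
  (separative P le -> antisymmetric_po le ->
     (st1 <-> st2) /\ (st2 <-> st3) /\ (st3 <-> st4)) /\
  ((st1 <-> st2) /\ (st2 <-> st3)) /\
  (st4 -> st1 /\ st2 /\ st3) /\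
  (st4 -> separative P le /\ antisymmetric_po le).
Proof.
move=> st1 st2 st3 st4.
have CP := cf_dom_class hP; have M1 := C_sub hM CP (cf_one hP).
have h12 : st2 -> st1 by move=> h; left; case: (h 2 v0_in_v1).
have h23 : st3 -> st2 by move=> h m phi; apply: (forcing_theorem_all hM hP h).
have h43 : st4 -> st3.
  move=> [B [meet [join [compl [bot [top [pi [hB hc [CB Cm _ Cc] hpi Cpi]]]]]]]].
  exact: (boolean_uniform_forcing hM hP hB hc CB Cm Cc hpi Cpi).
have h4 : st4 -> separative P le /\ antisymmetric_po le.
  move=> [B [meet [join [compl [bot [top [pi [hB hc [CB Cm _ Cc] hpi Cpi]]]]]]]].
  split; [exact: (boolean_separative hP hB hpi)|exact: (boolean_antisymmetric hP hB hpi)].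
have h13 : st1 -> st3.
  by case; [exact: uniform_of_mem_definability|exact: uniform_of_eq_definability].
have e12 : st1 <-> st2 by split=> [/h13/h23|].
have e23 : st2 <-> st3 by split=> [/h12/h13|].
split; last split; [|by split|split=> [/h43 h|//]].
  move=> hsep hanti; split=> //; split=> //; split=> // h.
  exact: (completion_exists hM hP h hrep hsep hanti).
by split; [apply/h12/h23|split=> //; apply: h23].
Qed.
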